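(* Let $G$ be a countable group. If $G$ is measure equivalent to a (countable) free group, then the group von Neumann algebra $L(G)$ is solid; that is, for every diffuse von Neumann subalgebra $N \subset L(G)$, the relative commutant $N' \cap L(G)$ is injective.
   Context: Measure equivalence: Countable groups $G$ and $\Gamma$ are measure equivalent if there exist a standard ($\sigma$-finite, nonzero) measure space $(\Sigma,\nu)$, a measure preserving action of $G \times \Gamma$ on $\Sigma$, and measurable subsets $X, Y \subset \Sigma$ such that (up to null sets) $\Sigma = \bigsqcup_{\gamma \in \Gamma} \gamma(X) = \bigsqcup_{g \in G} g(Y)$, $\nu(X) < \infty$ and $\nu(Y) < \infty$. Von Neumann subalgebras are unital, i.e. they contain the unit of $L(G)$. A von Neumann algebra is diffuse if it has no nonzero minimal projections. *)

(* Defs.v *)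
From HB Require Import structures.
From mathcomp Require Import all_boot all_order all_algebra.
From mathcomp Require Import all_classical all_reals all_analysis.
From mathcomp Require Import complex ring.

Set Implicit Arguments.
Unset Strict Implicit.
Unset Printing Implicit Defensive.

Import Order.TTheory GRing.Theory Num.Theory.
Import ComplexField.Normc.

Local Open Scope classical_set_scope.
Local Open Scope ring_scope.

Section SquareSummable.
Variables (R : realType) (J : choiceType).
Implicit Types (f g : J -> R[i]) (a : R[i]).

Definition sqsum f : \bar R := \esum_(j in [set: J]) (normc (f j) ^+ 2)%:E.

Definition square_summable : {pred J -> R[i]} :=
  [pred f | (sqsum f < +oo)%E].

Lemma normc_ge0 (z : R[i]) : 0 <= normc z.
Proof. by case: z => x y; rewrite /normc sqrtr_ge0. Qed.

Lemma sqsum_ge0 f : (0 <= sqsum f)%E.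
Proof. by apply: esum_ge0 => j _; rewrite lee_fin sqr_ge0. Qed.

Lemma esumZ_le (c : R) (u : J -> R) : 0 <= c ->
  (\esum_(j in [set: J]) (c * u j)%:E
     <= c%:E * \esum_(j in [set: J]) (u j)%:E)%E.
Proof.
move=> c0; apply: ge_ereal_sup => _ [A [finA _] <-].
rewrite (_ : (\sum_(x \in A) (c * u x)%:E)%E =
             (c%:E * (\sum_(x \in A) (u x)%:E))%E); last first.
  by rewrite !fsbig_finite//= !sumEFin -EFinM mulr_sumr.
apply: lee_wpmul2l; first by rewrite lee_fin.
by apply: ereal_sup_ubound; exists A.
Qed.

Lemma sqsum_lin a f g :
  (sqsum (a *: f + g)%R <=
     (2 * normc a ^+ 2)%:E * sqsum f + 2%:E * sqsum g)%E.
Proof.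
have -> : sqsum (a *: f + g)%R =
    (\esum_(j in [set: J]) (normc (a * f j + g j) ^+ 2)%:E)%E by [].
have le2 (z w : R[i]) : normc (z + w) ^+ 2 <= 2 * normc z ^+ 2 + 2 * normc w ^+ 2.
  apply: (@le_trans _ _ ((normc z + normc w) ^+ 2)).
    have := @le_normcD R z w; rewrite -ler_sqr ?nnegrE ?normc_ge0//.
    by rewrite addr_ge0 ?normc_ge0.
  rewrite -subr_ge0 (_ : _ - _ = (normc z - normc w) ^+ 2) ?sqr_ge0//.
  by ring.
apply: (@le_trans _ _ (\esum_(j in [set: J])
   ((2 * normc a ^+ 2) * normc (f j) ^+ 2 + 2 * normc (g j) ^+ 2)%:E)%E).
  apply: le_esum => j _; rewrite lee_fin (le_trans (le2 _ _))// normcM.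
  by rewrite exprMn mulrA.
under eq_esum do rewrite EFinD.
rewrite esumD; last 2 first.
- by move=> j _; rewrite lee_fin mulr_ge0 ?sqr_ge0// mulr_ge0 ?sqr_ge0.
- by move=> j _; rewrite lee_fin mulr_ge0 ?ler0n ?sqr_ge0.
by apply: leeD; apply: esumZ_le => //; rewrite mulr_ge0 ?sqr_ge0.
Qed.

Lemma sqsum0 : sqsum (0 : J -> R[i]) = 0%E.
Proof. by apply: esum1 => j _; rewrite normc0 expr0n. Qed.

Lemma square_summable_submod : submod_closed square_summable.
Proof.
split=> [|a f g]; first by rewrite inE sqsum0 ltry.
rewrite !inE => fs gs; apply: (le_lt_trans (sqsum_lin a f g)).
by apply: lte_add_pinfty; apply: lte_mul_pinfty => //;
  rewrite lee_fin// mulr_ge0 ?sqr_ge0.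
Qed.

HB.instance Definition _ :=
  GRing.isSubmodClosed.Build _ _ square_summable square_summable_submod.

End SquareSummable.

Record ell2 (R : realType) (J : choiceType) := Ell2 {
  ell2_val :> J -> R[i];
  _ : ell2_val \in @square_summable R J }.

Section Ell2.
Variables (R : realType) (J : choiceType).
Local Notation H := (ell2 R J).

HB.instance Definition _ := [isSub for @ell2_val R J].
HB.instance Definition _ := [Choice of H by <:].
HB.instance Definition _ := [SubChoice_isSubLmodule of H by <:].

Definition ell2_norm (x : H) : R := Num.sqrt (fine (sqsum x)).

(* Sums of positive and negative parts: rsum and csum are the unordered sums
   of absolutely summable families, and junk values otherwise. *)
Definition rsum (u : J -> R) : R :=
  fine (\esum_(j in [set: J]) (Num.max (u j) 0)%:E) -
  fine (\esum_(j in [set: J]) (Num.max (- u j) 0)%:E).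

Definition csum (u : J -> R[i]) : R[i] :=
  Complex (rsum (fun j => complex.Re (u j))) (rsum (fun j => complex.Im (u j))).

Definition ell2_inner (x y : H) : R[i] := csum (fun j => x j * (y j)^*).

Definition bounded_operator : {pred H -> H} :=
  [pred T | `[< linear T /\
    exists M : R, forall x, ell2_norm (T x) <= M * ell2_norm x >]].

Lemma ell2_norm_ge0 x : 0 <= ell2_norm x.
Proof. exact: sqrtr_ge0. Qed.

Lemma sqsum_fin (x : H) : sqsum x \is a fin_num.
Proof. by rewrite ge0_fin_numE ?sqsum_ge0//; case: x => x /=; rewrite inE. Qed.

Lemma ell2_normE (x : H) : (ell2_norm x ^+ 2)%:E = sqsum x.
Proof.
by rewrite sqr_sqrtr ?fineK ?sqsum_fin// fine_ge0// sqsum_ge0.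
Qed.

Lemma ell2_norm_lin (a : R[i]) (x y : H) :
  ell2_norm (a *: x + y) ^+ 2 <=
    2 * normc a ^+ 2 * ell2_norm x ^+ 2 + 2 * ell2_norm y ^+ 2.
Proof.
by rewrite -lee_fin EFinD !(EFinM _ (ell2_norm _ ^+ 2)) !ell2_normE sqsum_lin.
Qed.

Lemma bounded_operator_submod : submod_closed bounded_operator.
Proof.
split=> [|a S T].
  rewrite inE; split=> [b x y|]; first by rewrite /= scaler0 addr0.
  exists 0 => x; rewrite mul0r -[leRHS](sqrtr0 R) ler_wsqrtr//.
  by rewrite (@sqsum0 R J).
rewrite !inE => -[linS [M SM]] [linT [N TN]]; split=> [b x y|].
  have -> z : (a *: S + T) z = a *: S z + T z by [].
  rewrite linS linT !scalerDr !scalerA (mulrC b a) !addrA; congr (_ + _).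
  by rewrite addrAC.
exists (Num.sqrt (2 * normc a ^+ 2 * M ^+ 2 + 2 * N ^+ 2)) => x.
have sq0 (p q : R) : 0 <= p -> 0 <= 2 * p * q ^+ 2.
  by move=> p0; rewrite mulr_ge0 ?sqr_ge0// mulr_ge0.
have c0 : 0 <= 2 * normc a ^+ 2 * M ^+ 2 + 2 * N ^+ 2.
  by rewrite addr_ge0 ?sq0 ?sqr_ge0// -[2]mulr1 sq0.
rewrite -ler_sqr ?nnegrE ?ell2_norm_ge0//; last first.
  by rewrite mulr_ge0 ?sqrtr_ge0 ?ell2_norm_ge0.
rewrite exprMn (sqr_sqrtr c0); apply: (le_trans (ell2_norm_lin a (S x) (T x))).
have sqle (p q : R) : 0 <= p -> p <= q -> p ^+ 2 <= q ^+ 2.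
  by move=> p0 pq; rewrite ler_sqr ?nnegrE// (le_trans p0).
have SM2 := sqle _ _ (ell2_norm_ge0 _) (SM x).
have TN2 := sqle _ _ (ell2_norm_ge0 _) (TN x).
rewrite [leRHS]mulrDl; apply: lerD.
  rewrite -[leRHS]mulrA -exprMn; apply: ler_wpM2l SM2.
  by rewrite mulr_ge0 ?sqr_ge0.
by rewrite -[leRHS]mulrA -exprMn; apply: ler_wpM2l TN2.
Qed.

HB.instance Definition _ :=
  GRing.isSubmodClosed.Build _ _ bounded_operator bounded_operator_submod.

End Ell2.

Record bop (R : realType) (J : choiceType) := Bop {
  bop_val :> ell2 R J -> ell2 R J;
  _ : bop_val \in @bounded_operator R J }.

Section BoundedOperators.
Variables (R : realType) (J : choiceType).
Local Notation H := (ell2 R J).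
Local Notation B := (bop R J).

HB.instance Definition _ := [isSub for @bop_val R J].
HB.instance Definition _ := [Choice of B by <:].
HB.instance Definition _ := [SubChoice_isSubLmodule of B by <:].

Lemma bop_linear (T : B) : linear T.
Proof. by case: T => T /= /[1!inE] -[]. Qed.

Lemma id_bounded : (@id H) \in @bounded_operator R J.
Proof. by rewrite inE; split=> //; exists 1 => x; rewrite mul1r. Qed.

Lemma comp_bounded (S T : B) : S \o T \in @bounded_operator R J.
Proof.
case: S T => [S /= /[1!inE] -[linS [M SM]]] [T /= /[1!inE] -[linT [N TN]]].
rewrite inE; split=> [a x y|]; first by rewrite /= linT linS.
exists (`|M| * N) => x; rewrite (le_trans (SM _))// -mulrA.
apply: (@le_trans _ _ (`|M| * ell2_norm (T x))).
  by rewrite ler_wpM2r ?ell2_norm_ge0 ?ler_norm.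
by rewrite ler_wpM2l.
Qed.

Definition bop1 : B := Bop id_bounded.
Definition bop_mul (S T : B) : B := Bop (comp_bounded S T).

Lemma bop_eqP (S T : B) : S =1 T -> S = T.
Proof. by move=> ST; apply/val_inj/funext. Qed.

Lemma bop_mulA : associative bop_mul.
Proof. by move=> S T U; apply: bop_eqP. Qed.
Lemma bop_mul1l : left_id bop1 bop_mul.
Proof. by move=> S; apply: bop_eqP. Qed.
Lemma bop_mul1r : right_id bop1 bop_mul.
Proof. by move=> S; apply: bop_eqP. Qed.
Lemma bop_mulDl : left_distributive bop_mul +%R.
Proof. by move=> S T U; apply: bop_eqP. Qed.
Lemma bop_mulDr : right_distributive bop_mul +%R.
Proof.
move=> S T U; apply: bop_eqP => x.
have := bop_linear S 1 (T x) (U x); rewrite !scale1r; exact.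
Qed.

HB.instance Definition _ := GRing.Zmodule_isPzRing.Build B
  bop_mulA bop_mul1l bop_mul1r bop_mulDl bop_mulDr.

Definition opnorm (T : B) : R :=
  sup [set ell2_norm (T x) | x in [set x | ell2_norm x <= 1]].

Definition adjoint_of (T S : B) : Prop :=
  forall x y, ell2_inner (T x) y = ell2_inner x (S y).

(* Closed in the weak operator topology: the finite lists s of pairs of vectors
   and the radii e index its basic neighbourhoods. *)
Definition wot_closed (M : set B) : Prop :=
  forall T : B,
    (forall (s : seq (H * H)) (e : R), 0 < e ->
       exists2 S : B, M S & forall p, p \in s ->
         normc (ell2_inner ((S - T) p.1) p.2) < e) ->
    M T.

Record von_neumann_algebra (M : set B) : Prop := {
  vna_one : M 1;
  vna_lin : forall (a : R[i]) (S T : B), M S -> M T -> M (a *: S + T);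
  vna_mul : forall S T : B, M S -> M T -> M (S * T);
  vna_adj : forall T : B, M T -> exists2 S : B, M S & adjoint_of T S;
  vna_wot : wot_closed M }.

Definition commutant (M : set B) : set B :=
  [set T | forall S, M S -> T * S = S * T].

Definition projection (p : B) : Prop := p * p = p /\ adjoint_of p p.

(* For projections, q <= p is expressed by p * q = q. *)
Definition minimal_projection (M : set B) (p : B) : Prop :=
  [/\ M p, projection p, p <> 0 &
      forall q : B, M q -> projection q -> p * q = q -> q = 0 \/ q = p].

Definition diffuse (M : set B) : Prop :=
  forall p : B, ~ minimal_projection M p.

(* A projection of norm one from B(H) onto M; its norm is 1 as soon as it is
   at most 1, because E 1 = 1 for a von Neumann algebra M. *)
Definition injective_vna (M : set B) : Prop :=
  exists E : {linear B -> B},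
    [/\ forall T, M (E T), forall T, M T -> E T = T &
        forall T, opnorm (E T) <= opnorm T].

Definition solid (M : set B) : Prop :=
  forall N : set B, von_neumann_algebra N -> N `<=` M -> diffuse N ->
    injective_vna (commutant N `&` M).

End BoundedOperators.

Section GroupVonNeumannAlgebra.
Variables (R : realType) (G : groupType).

Lemma sqsum_translate (g : G) (f : G -> R[i]) :
  sqsum (fun h => f (g^-1 * h)%g) = sqsum f.
Proof.
rewrite /sqsum [RHS](@reindex_esum R G G setT setT (fun h => (g^-1 * h)%g))//.
split=> // [x y _ _ /mulgI//|x _ /=].
by exists (g * x)%g => //; rewrite mulKg.
Qed.

Lemma translate_summable (g : G) (x : ell2 R G) :
  (fun h => x (g^-1 * h)%g) \in @square_summable R G.
Proof. by rewrite inE sqsum_translate -ge0_fin_numE ?sqsum_ge0 ?sqsum_fin. Qed.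

Definition translate (g : G) (x : ell2 R G) : ell2 R G :=
  Ell2 (translate_summable g x).

Lemma translate_bounded (g : G) : translate g \in @bounded_operator R G.
Proof.
rewrite inE; split=> [a x y|]; first exact/val_inj.
by exists 1 => x; rewrite mul1r /ell2_norm /= sqsum_translate.
Qed.

Definition left_regular (g : G) : bop R G := Bop (translate_bounded g).

(* By the bicommutant theorem, the von Neumann algebra generated by the left
   regular representation. *)
Definition group_vna : set (bop R G) :=
  commutant (commutant (range left_regular)).

End GroupVonNeumannAlgebra.
Arguments group_vna : clear implicits.

(* T is Borel isomorphic to a Polish space P. *)
Definition standard_borel (R : realType) d (T : measurableType d) : Prop :=
  exists (P : completePseudoMetricType R) (f : T -> P),
    [/\ hausdorff_space P, @second_countable P, bijective f &
        forall A : set T, measurable A <-> <<s @open P >> (f @` A)].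

(* Universal property of the group freely generated by B; the values of f
   outside B are irrelevant. *)
Definition free_group (F : groupType) : Prop :=
  exists B : set F, forall (H : groupType) (f : F -> H),
    exists2 phi : {multiplicative F -> H},
      forall b, B b -> phi b = f b &
      forall psi : {multiplicative F -> H},
        (forall b, B b -> psi b = f b) -> psi =1 phi.

Section MeasureEquivalence.
Variables (R : realType) (d : measure_display) (S : measurableType d).
Variable nu : {measure set S -> \bar R}.

Definition measure_preserving_action (K : groupType) (act : K -> S -> S)
    : Prop :=
  [/\ forall s, act 1%g s = s,
      forall g h s, act (g * h)%g s = act g (act h s),
      forall g, measurable_fun [set: S] (act g) &
      forall g A, measurable A -> nu (act g @^-1` A) = nu A].

Definition fundamental_domain (K : groupType) (act : K -> S -> S) (X : set S)
    : Prop :=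
  [/\ measurable X,
      nu (~` \bigcup_(g in [set: K]) (act g @` X)) = 0%E &
      forall g h, g <> h -> nu (act g @` X `&` act h @` X) = 0%E].

End MeasureEquivalence.

Definition measure_equivalent (R : realType) (G Gam : groupType) : Prop :=
  exists (d : measure_display) (S : measurableType d)
         (nu : {measure set S -> \bar R}) (act : (G * Gam)%type -> S -> S)
         (X Y : set S),
    [/\ standard_borel R S, sigma_finite [set: S] nu,
        nu [set: S] <> 0%E, measure_preserving_action nu act &
        [/\ fundamental_domain nu (fun c : Gam => act (1%g, c)) X,
            fundamental_domain nu (fun g : G => act (g, 1%g)) Y,
            (nu X < +oo)%E & (nu Y < +oo)%E]].

(* Main.v *)
Require Import Defs.
From HB Require Import structures.
From mathcomp Require Import all_boot all_order all_algebra finmap.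
From mathcomp Require Import all_classical all_reals all_analysis.
From mathcomp Require Import complex ring lra zify measurable_realfun.

(* Realize the free group Gam on its pairs (vertex, generator) and one
   extra vector by letting a basis element b act as the left translation followed
   by a rotation, by a small angle, in the plane of the extra vector and of the
   edge (1, b). The orbit of the extra vector under the resulting orthogonal
   representation is almost equivariant for left translation when the angles are
   small, while its matrix coefficient is c_0 on Gam. Through the cocycle
   c : S -> Gam of the coupling this kernel is transported to G: integrating over
   the fundamental domain of G yields vectors f(a, g) that are almost invariant
   under right translation of g and under the diagonal left translation, and
   asymptotically of norm one as g leaves finite sets.

   Now let N be diffuse in L(G). It contains selfadjoint unitaries u_n tending
   weakly to 0; the operators V_n x (h, a) = (u_n x)(a h) f(a, a h) are
   asymptotically isometric and intertwine the right regular representation with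
   an amplification. The ultralimit of T |-> V_n^* (T x 1) V_n maps B(l2 G) to
   L(G) and fixes N' cap L(G), because an element of N' commutes with u_n and the
   vectors are almost left equivariant. Followed by the conditional expectation
   of L(G) onto N' cap L(G), it is the required projection of norm one. *)

Set Implicit Arguments.
Unset Strict Implicit.
Unset Printing Implicit Defensive.

Import Order.TTheory GRing.Theory Num.Theory.
Import ComplexField.Normc.
Import numFieldNormedType.Exports.

Local Open Scope classical_set_scope.
Local Open Scope ring_scope.

(** * Unordered sums *)

Section RealSums.
Variables (R : realType) (J : choiceType).
Implicit Types u v : J -> R.

(** An element z of the relative commutant has only square summable Fourier coefficients, whereas
    almost equivariance is available for finitely many group elements at a time; truncations of z
    approximate it in 2-norm but not in operator norm. The Gram domination in [gram_bound] is
    designed for this: it makes the amplification of z, applied to the image of a point mass, at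
    most the 2-norm of z ([trace_bound]), so that truncation in 2-norm suffices.

    From the orbit of the extra vector only the edge coordinates are transported. The group moves
    edges freely, so a sum over vertices can be exchanged for a sum over translates of a fundamental
    domain; and since the orbit consists of unit vectors, the edge part tends to norm one exactly
    because the coefficient on the extra vector is c_0.

    The array needs a discrete index set, while integration over a fundamental domain produces
    vectors of an L2 space. Only their Gram matrix on a countable set matters, and triangular
    elimination realizes it by vectors indexed by [nat]. *)

Definition rabs u := (\esum_(j in [set: J]) (`|u j|)%:E < +oo)%E.

Lemma rabs_le u v : (forall j, `|u j| <= v j) ->
  (\esum_(j in [set: J]) (v j)%:E < +oo)%E -> rabs u.
Proof. by move=> uv; apply: le_lt_trans; apply: le_esum => j _; rewrite lee_fin. Qed.

Lemma rabsD u v : rabs u -> rabs v -> rabs (fun j => u j + v j).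
Proof.
move=> hu hv; apply: (@rabs_le _ (fun j => `|u j| + `|v j|)) => [j|].
  exact: ler_normD.
under eq_esum do rewrite EFinD.
by rewrite esumD//; apply: lte_add_pinfty.
Qed.

Lemma rabsZ c u : rabs u -> rabs (fun j => c * u j).
Proof.
move=> hu; apply: (@rabs_le _ (fun j => `|c| * `|u j|)) => [j|].
  by rewrite normrM.
apply: (le_lt_trans (esumZ_le _ _)) => //.
by apply: lte_mul_pinfty => //; rewrite lee_fin.
Qed.

Lemma esum_fin_num u : (forall j, 0 <= u j) ->
  (\esum_(j in [set: J]) (u j)%:E < +oo)%E ->
  (\esum_(j in [set: J]) (u j)%:E)%E \is a fin_num.
Proof. by move=> u0 fu; rewrite ge0_fin_numE ?esum_ge0// => j _; rewrite lee_fin. Qed.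

(** Every decomposition into nonnegative summable families computes the sum, not only the one into
    positive and negative parts; additivity in [rsumD] rests on this freedom. *)
Lemma rsumB u v : (forall j, 0 <= u j) -> (forall j, 0 <= v j) ->
  (\esum_(j in [set: J]) (u j)%:E < +oo)%E ->
  (\esum_(j in [set: J]) (v j)%:E < +oo)%E ->
  rsum (fun j => u j - v j) = fine (\esum_(j in [set: J]) (u j)%:E) -
                              fine (\esum_(j in [set: J]) (v j)%:E).
Proof.
move=> u0 v0 fu fv.
have sab (w : J -> R) : (forall j, 0 <= w j) ->
    (\esum_(j in [set: J]) (w j)%:E < +oo)%E -> summable [set: J] (EFin \o w).
  move=> w0 fw; rewrite /summable; apply: le_lt_trans fw.
  by apply: le_esum => j _; rewrite /= ger0_norm.
have e1 : (\esum_(i in [set: J]) ((EFin \o u) \- (EFin \o v))^\+ i =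
           \esum_(j in [set: J]) (Num.max (u j - v j) 0)%:E)%E.
  by apply: eq_esum => j _; rewrite funeposE EFin_max.
have e2 : (\esum_(i in [set: J]) ((EFin \o u) \- (EFin \o v))^\- i =
           \esum_(j in [set: J]) (Num.max (- (u j - v j)) 0)%:E)%E.
  by apply: eq_esum => j _; rewrite funenegE EFin_max.
have H : (\esum_(j in [set: J]) (Num.max (u j - v j) 0)%:E -
    \esum_(j in [set: J]) (Num.max (- (u j - v j)) 0)%:E =
    \esum_(j in [set: J]) (u j)%:E - \esum_(j in [set: J]) (v j)%:E)%E.
  by rewrite -e1 -e2; apply: (esumB (sab _ u0 fu) (sab _ v0 fv)) => j _;
    rewrite lee_fin.
have fn (w w' : J -> R) : (forall j, 0 <= w j) -> (forall j, w j <= w' j) ->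
   (\esum_(j in [set: J]) (w' j)%:E < +oo)%E ->
   (\esum_(j in [set: J]) (w j)%:E)%E \is a fin_num.
  move=> w0 ww' fw'; apply: esum_fin_num => //; apply: le_lt_trans fw'.
  by apply: le_esum => j _; rewrite lee_fin.
have M1 : (\esum_(j in [set: J]) (Num.max (u j - v j) 0)%:E)%E \is a fin_num.
  apply: (fn _ u) => // j; first by rewrite le_max lexx orbT.
  by rewrite ge_max u0 gerBl v0.
have M2 : (\esum_(j in [set: J]) (Num.max (- (u j - v j)) 0)%:E)%E \is a fin_num.
  apply: (fn _ v) => // j; first by rewrite le_max lexx orbT.
  by rewrite opprB ge_max v0 gerBl u0.
have Mu := esum_fin_num u0 fu; have Mv := esum_fin_num v0 fv.
by rewrite /rsum -!fineB//; congr fine.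
Qed.

Lemma rabs_pos u : rabs u ->
  (\esum_(j in [set: J]) (Num.max (u j) 0)%:E < +oo)%E.
Proof.
by apply: le_lt_trans; apply: le_esum => j _; rewrite lee_fin ge_max ler_norm /=.
Qed.

Lemma rabsN u : rabs u -> rabs (fun j => - u j).
Proof. by rewrite /rabs; under eq_esum do rewrite -normrN. Qed.

Lemma max_pos_neg (a : R) : a = Num.max a 0 - Num.max (- a) 0.
Proof.
have [a0|a0] := leP 0 a.
  by rewrite max_r ?oppr_le0// subr0.
by rewrite max_l ?oppr_ge0 ?ltW// opprK add0r.
Qed.

Lemma rsumD u v : rabs u -> rabs v ->
  rsum (fun j => u j + v j) = rsum u + rsum v.
Proof.
move=> hu hv.
have m0 (a : R) : 0 <= Num.max a 0 by rewrite le_max lexx orbT.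
have -> : (fun j => u j + v j) =
    (fun j => (Num.max (u j) 0 + Num.max (v j) 0) -
              (Num.max (- u j) 0 + Num.max (- v j) 0)).
  by apply/funext => j; rewrite {1}(max_pos_neg (u j)) {1}(max_pos_neg (v j)); ring.
have hu1 := rabs_pos hu; have hv1 := rabs_pos hv.
have hu2 := rabs_pos (rabsN hu); have hv2 := rabs_pos (rabsN hv).
have eD (w z : J -> R) : (\esum_(j in [set: J]) (Num.max (w j) 0 + Num.max (z j) 0)%:E =
   \esum_(j in [set: J]) (Num.max (w j) 0)%:E + \esum_(j in [set: J]) (Num.max (z j) 0)%:E)%E.
  by under eq_esum do rewrite EFinD; rewrite esumD// => j _; rewrite lee_fin.
rewrite rsumB//; try by move=> j; rewrite addr_ge0.
- rewrite !eD /rsum !fineD ?esum_fin_num//; ring.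
- by rewrite eD lte_add_pinfty.
- by rewrite eD lte_add_pinfty.
Qed.

Lemma rsumN u : rsum (fun j => - u j) = - rsum u.
Proof.
rewrite /rsum opprB; congr (_ - fine _); apply: eq_esum => j _.
by rewrite opprK.
Qed.

(** The missing inequality is [esumZ_le] applied to the inverse of c. *)
Lemma esumZ (c : R) u : 0 <= c -> (forall j, 0 <= u j) ->
  (\esum_(j in [set: J]) (c * u j)%:E = c%:E * \esum_(j in [set: J]) (u j)%:E)%E.
Proof.
rewrite le_eqVlt => /predU1P[<- u0|c0 u0].
  by rewrite mul0e esum1// => j _; rewrite mul0r.
apply/eqP; rewrite eq_le (esumZ_le _ (ltW c0))/=.
have /= h := @esumZ_le R J c^-1 (fun j => c * u j).
set S := (\esum_(j in [set: J]) (c * u j)%:E)%E.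
rewrite (_ : S = (c%:E * (c^-1%:E * S))%E); last first.
  by rewrite muleA -EFinM divff ?gt_eqF// mul1e.
apply: lee_wpmul2l; first by rewrite lee_fin ltW.
apply: le_trans (h _); last by rewrite invr_ge0 ltW.
by apply: le_esum => j _; rewrite lee_fin mulKf ?gt_eqF.
Qed.

(** For infinite x both sides are 0 by the default value of [fine], so [rsumZ] covers divergent
    families as well. *)
Lemma fineMl_ge0 (c : R) (x : \bar R) : 0 <= c -> fine (c%:E * x) = c * fine x.
Proof.
rewrite le_eqVlt => /predU1P[<-|c0]; first by rewrite mul0e mul0r.
by case: x => [r//||]; rewrite ?gt0_muley ?gt0_muleNy ?lte_fin//= mulr0.
Qed.

Lemma rsumZ c u : rsum (fun j => c * u j) = c * rsum u.
Proof.
wlog c0 : c / 0 <= c => [h|].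
  have [|c0] := leP 0 c; first exact: h.
  have e : (fun j => c * u j) = (fun j => - (- c * u j)).
    by apply/funext => j; rewrite mulNr opprK.
  by rewrite e rsumN h ?oppr_ge0 ?ltW// mulNr opprK.
have m0 (a : R) : 0 <= Num.max a 0 by rewrite le_max lexx orbT.
have e (w : J -> R) : fine (\esum_(j in [set: J]) (Num.max (c * w j) 0)%:E)%E =
  c * fine (\esum_(j in [set: J]) (Num.max (w j) 0)%:E)%E.
  have -> : (\esum_(j in [set: J]) (Num.max (c * w j) 0)%:E =
     \esum_(j in [set: J]) (c * Num.max (w j) 0)%:E)%E.
    by apply: eq_esum => j _; rewrite maxr_pMr// mulr0.
  by rewrite esumZ// fineMl_ge0.
rewrite /rsum mulrBr -!e; congr (_ - fine _); apply: eq_esum => j _.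
by rewrite mulrN.
Qed.

Lemma rsum_ge0E u : (forall j, 0 <= u j) ->
  rsum u = fine (\esum_(j in [set: J]) (u j)%:E)%E.
Proof.
move=> u0; rewrite /rsum [X in _ - fine X]esum1 ?subr0.
  by congr fine; apply: eq_esum => j _; rewrite max_l.
by move=> j _; rewrite max_r// oppr_le0.
Qed.

Lemma esum_single j0 u : 0 <= u j0 -> (forall j, j != j0 -> u j = 0) ->
  (\esum_(j in [set: J]) (u j)%:E = (u j0)%:E)%E.
Proof.
move=> u0 uz; transitivity (\esum_(j in [set j0]) (u j)%:E)%E; last first.
  by apply: (@esum_set1 _ _ j0 (fun j => (u j)%:E)); rewrite lee_fin.
rewrite [RHS]esum_mkcond.
apply: eq_esum => j _; rewrite in_set1 /=.
by case: (eqVneq j j0) => [//|/uz->].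
Qed.

Lemma rsum_single j0 u : (forall j, j != j0 -> u j = 0) -> rsum u = u j0.
Proof.
move=> uz; rewrite /rsum (max_pos_neg (u j0)).
have e (w : J -> R) : (forall j, j != j0 -> w j = 0) ->
   fine (\esum_(j in [set: J]) (Num.max (w j) 0)%:E)%E = Num.max (w j0) 0.
  move=> wz; rewrite (@esum_single j0)//; first by rewrite le_max lexx orbT.
  by move=> j /wz ->; rewrite maxxx.
by rewrite e// e// => j /uz ->; rewrite oppr0.
Qed.

Lemma reindex_rsum (J' : choiceType) (e : J' -> J) u : bijective e ->
  rsum u = rsum (fun j => u (e j)).
Proof.
move=> be; have bij : set_bij [set: J'] [set: J] e.
  split=> // [x y _ _|y _]; first exact: (bij_inj be).
  by case: be => e' _ e'K; exists (e' y).
by rewrite /rsum !(reindex_esum setT _ _ _ bij).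
Qed.

End RealSums.

(** * Square summable families *)

Section ComplexSums.
Variables (R : realType) (J : choiceType).
Implicit Types u v : J -> R[i].
Local Notation Re := (@complex.Re R).
Local Notation Im := (@complex.Im R).

Definition cabs u := rabs (fun j => Re (u j)) /\ rabs (fun j => Im (u j)).

Lemma normcE2 (z : R[i]) : normc z ^+ 2 = Re z ^+ 2 + Im z ^+ 2.
Proof. by case: z => a b; rewrite /normc sqr_sqrtr// addr_ge0 ?sqr_ge0. Qed.

Lemma normc_conj (z : R[i]) : normc z^* = normc z.
Proof. by case: z => a b; rewrite /normc/= sqrrN. Qed.

Lemma normc_Re (z : R[i]) : `|Re z| <= normc z.
Proof.
rewrite -ler_sqr ?nnegrE ?normc_ge0// normcE2 real_normK ?num_real//.
by rewrite lerDl sqr_ge0.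
Qed.

Lemma normc_Im (z : R[i]) : `|Im z| <= normc z.
Proof.
rewrite -ler_sqr ?nnegrE ?normc_ge0// normcE2 real_normK ?num_real//.
by rewrite lerDr sqr_ge0.
Qed.

Lemma normc_real (a : R) : normc (a%:C)%C = `|a|.
Proof. by rewrite /normc/= expr0n/= addr0 sqrtr_sqr. Qed.

Lemma mulcJ (z : R[i]) : z * z^* = ((normc z ^+ 2)%:C)%C.
Proof. by rewrite normcE2; case: z => a b; apply/eqP; rewrite eq_complex/=; apply/andP; split; apply/eqP; ring. Qed.

Lemma cabs_le u (v : J -> R) : (forall j, normc (u j) <= v j) ->
  (\esum_(j in [set: J]) (v j)%:E < +oo)%E -> cabs u.
Proof.
move=> uv fv; split; apply: rabs_le fv => j; apply: le_trans (uv j).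
- exact: normc_Re.
- exact: normc_Im.
Qed.

Lemma csumD u v : cabs u -> cabs v -> csum (fun j => u j + v j) = csum u + csum v.
Proof.
move=> [u1 u2] [v1 v2]; rewrite /csum.
have -> : (fun j => Re (u j + v j)) = (fun j => Re (u j) + Re (v j)).
  by apply/funext => j; case: (u j) (v j) => ? ? [].
have -> : (fun j => Im (u j + v j)) = (fun j => Im (u j) + Im (v j)).
  by apply/funext => j; case: (u j) (v j) => ? ? [].
by rewrite !rsumD.
Qed.

Lemma csumZ a u : cabs u -> csum (fun j => a * u j) = a * csum u.
Proof.
move=> [u1 u2]; rewrite /csum; case: a => a b.
have -> : (fun j => Re (Complex a b * u j)) = (fun j => a * Re (u j) + (- b) * Im (u j)).
  by apply/funext => j; case: (u j) => ? ?; rewrite /= mulNr.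
have -> : (fun j => Im (Complex a b * u j)) = (fun j => a * Im (u j) + b * Re (u j)).
  by apply/funext => j; case: (u j).
rewrite !rsumD ?rsumZ; try exact: rabsZ.
by apply/eqP; rewrite eq_complex/= mulNr !eqxx.
Qed.

Lemma csumJ u : csum (fun j => (u j)^*) = (csum u)^*.
Proof.
rewrite /csum.
have -> : (fun j => Re (u j)^*) = (fun j => Re (u j)).
  by apply/funext => j; case: (u j).
have -> : (fun j => Im (u j)^*) = (fun j => - Im (u j)).
  by apply/funext => j; case: (u j).
by rewrite rsumN.
Qed.

Lemma csum_single j0 u : (forall j, j != j0 -> u j = 0) -> csum u = u j0.
Proof.
move=> uz; rewrite /csum (@rsum_single _ _ j0); last by move=> j /uz ->.
by rewrite (@rsum_single _ _ j0); [case: (u j0) | move=> j /uz ->].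
Qed.

Lemma reindex_csum (J' : choiceType) (e : J' -> J) u : bijective e ->
  csum u = csum (fun j => u (e j)).
Proof.
by move=> be; rewrite /csum (reindex_rsum _ be) (reindex_rsum (fun j => Im _) be).
Qed.

End ComplexSums.

(** * The Hilbert space structure of l2 *)

Section InnerProduct.
Variables (R : realType) (J : choiceType).
Local Notation H := (ell2 R J).
Implicit Types (x y z : H) (a b : R[i]).
Local Notation "<| x , y |>" := (ell2_inner x y).
Local Notation Re := (@complex.Re R).
Local Notation Im := (@complex.Im R).

Lemma sqsum_lty x : (sqsum x < +oo)%E.
Proof. by rewrite -ge0_fin_numE ?sqsum_ge0 ?sqsum_fin. Qed.

Lemma inner_cabs x y : cabs (fun j => x j * (y j)^*).
Proof.
apply: (@cabs_le _ _ _ (fun j => normc (x j) ^+ 2 + normc (y j) ^+ 2)) => [j|].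
  rewrite normcM normc_conj; set p := normc _; set q := normc _.
  have p0 : 0 <= p by exact: normc_ge0.
  have q0 : 0 <= q by exact: normc_ge0.
  have := sqr_ge0 (p - q); rewrite sqrrB.
  have := mulr_ge0 p0 q0; lra.
under eq_esum do rewrite EFinD.
rewrite esumD; try by move=> j _; rewrite lee_fin sqr_ge0.
by apply: lte_add_pinfty; exact: sqsum_lty.
Qed.

Lemma innerD x y z : <| x + y, z |> = <| x, z |> + <| y, z |>.
Proof.
rewrite /ell2_inner -csumD; try exact: inner_cabs.
by congr csum; apply/funext => j; rewrite -mulrDl.
Qed.

Lemma innerZ a x z : <| a *: x, z |> = a * <| x, z |>.
Proof.
rewrite /ell2_inner -csumZ; last exact: inner_cabs.
by congr csum; apply/funext => j; rewrite mulrA.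
Qed.

Lemma innerC x y : <| y, x |> = (<| x, y |>)^*.
Proof.
rewrite /ell2_inner -csumJ; congr csum; apply/funext => j.
by rewrite rmorphM/= conjCK mulrC.
Qed.

Lemma innerDr x y z : <| z, x + y |> = <| z, x |> + <| z, y |>.
Proof. by rewrite innerC innerD rmorphD/= -!innerC. Qed.

Lemma innerZr a x z : <| z, a *: x |> = a^* * <| z, x |>.
Proof. by rewrite innerC innerZ rmorphM/= -innerC. Qed.

Lemma innerNl x z : <| - x, z |> = - <| x, z |>.
Proof. by rewrite -scaleN1r innerZ mulN1r. Qed.

Lemma innerNr x z : <| z, - x |> = - <| z, x |>.
Proof. by rewrite innerC innerNl rmorphN/= -innerC. Qed.

Lemma innerBl x y z : <| x - y, z |> = <| x, z |> - <| y, z |>.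
Proof. by rewrite innerD innerNl. Qed.

Lemma innerBr x y z : <| z, x - y |> = <| z, x |> - <| z, y |>.
Proof. by rewrite innerDr innerNr. Qed.

Lemma inner0l z : <| 0, z |> = 0.
Proof. by rewrite -(scale0r (0 : H)) innerZ mul0r. Qed.

Lemma inner0r z : <| z, 0 |> = 0.
Proof. by rewrite innerC inner0l conjC0. Qed.

Lemma inner_suml (I : Type) (r : seq I) (F : I -> H) z :
  <| \sum_(i <- r) F i, z |> = \sum_(i <- r) <| F i, z |>.
Proof. by elim/big_rec2: _ => [|i a w _ <-]; rewrite ?inner0l ?innerD. Qed.

Lemma inner_sumr (I : Type) (r : seq I) (F : I -> H) z :
  <| z, \sum_(i <- r) F i |> = \sum_(i <- r) <| z, F i |>.
Proof. by elim/big_rec2: _ => [|i a w _ <-]; rewrite ?inner0r ?innerDr. Qed.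

Lemma inner_norm x : <| x, x |> = ((ell2_norm x ^+ 2)%:C)%C.
Proof.
have h : (fun j => x j * (x j)^*) = (fun j => ((normc (x j) ^+ 2)%:C)%C).
  by apply/funext => j; rewrite mulcJ.
rewrite /ell2_inner h /csum /= rsum_ge0E; last by move=> j; rewrite sqr_ge0.
have -> : rsum (fun _ : J => 0) = 0 :> R.
  by rewrite rsum_ge0E// esum1.
by rewrite -/(sqsum x) -ell2_normE.
Qed.

Lemma ell2_norm_sq x : ell2_norm x ^+ 2 = Re <| x, x |>.
Proof. by rewrite inner_norm. Qed.

Lemma sqsum_coord x j : ((normc (x j) ^+ 2)%:E <= sqsum x)%E.
Proof.
apply: ereal_sup_ubound; exists [set j]; first by split.
by rewrite fsbig_set1.
Qed.

Lemma coord_le_norm x j : normc (x j) <= ell2_norm x.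
Proof.
rewrite -ler_sqr ?nnegrE ?normc_ge0 ?ell2_norm_ge0//.
by rewrite -lee_fin ell2_normE sqsum_coord.
Qed.

Lemma ell2P x y : (forall j, x j = y j) -> x = y.
Proof. by move=> xy; apply/val_inj/funext. Qed.

Lemma norm0_eq0 x : ell2_norm x = 0 -> x = 0.
Proof.
move=> x0; apply: ell2P => j; apply: eq0_normc; apply/eqP.
by rewrite eq_le normc_ge0 andbT -x0 coord_le_norm.
Qed.

Lemma ell2_norm0 : ell2_norm (0 : H) = 0.
Proof. by rewrite /ell2_norm (sqsum0 R J) sqrtr0. Qed.

Lemma normB_sq x y : ell2_norm (x - y) ^+ 2 =
  ell2_norm x ^+ 2 - 2 * Re <| x, y |> + ell2_norm y ^+ 2.
Proof.
rewrite !ell2_norm_sq innerBl !innerBr (innerC x y).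
by case: <| x, x |> <| x, y |> <| y, y |> => a b [c d] [e f] /=; ring.
Qed.

Lemma normD_sq x y : ell2_norm (x + y) ^+ 2 =
  ell2_norm x ^+ 2 + 2 * Re <| x, y |> + ell2_norm y ^+ 2.
Proof.
rewrite !ell2_norm_sq innerD !innerDr (innerC x y).
by case: <| x, x |> <| x, y |> <| y, y |> => a b [c d] [e f] /=; ring.
Qed.

Lemma parallelogram x y : ell2_norm (x - y) ^+ 2 =
  2 * ell2_norm x ^+ 2 + 2 * ell2_norm y ^+ 2 - ell2_norm (x + y) ^+ 2.
Proof. by rewrite normB_sq normD_sq; ring. Qed.

Lemma normZ a x : ell2_norm (a *: x) = normc a * ell2_norm x.
Proof.
apply/eqP; rewrite -(@eqrXn2 _ 2) ?mulr_ge0 ?ell2_norm_ge0 ?normc_ge0//.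
apply/eqP; rewrite exprMn ell2_norm_sq innerZ innerZr inner_norm mulrA mulcJ.
by rewrite -rmorphM.
Qed.

Lemma normN x : ell2_norm (- x) = ell2_norm x.
Proof.
by rewrite -scaleN1r normZ normcN normc1 mul1r.
Qed.

Lemma normBC x y : ell2_norm (x - y) = ell2_norm (y - x).
Proof. by rewrite -normN opprB. Qed.

Lemma cauchy_schwarz x y : normc <| x, y |> <= ell2_norm x * ell2_norm y.
Proof.
have [y0|y0] := eqVneq (ell2_norm y) 0.
  by rewrite (norm0_eq0 y0) inner0r normc0 ell2_norm0 mulr0.
have yp : 0 < ell2_norm y by rewrite lt_neqAle eq_sym y0 ell2_norm_ge0.
rewrite -ler_sqr ?nnegrE ?normc_ge0 ?mulr_ge0 ?ell2_norm_ge0// exprMn.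
set a := <| x, y |>; set n := ell2_norm y in yp *.
(* With this t, [(t * a) *: y] is the orthogonal projection of x on the line of y; the inequality is
   nonnegativity of the squared distance. *)
pose t : R := n ^- 2.
have := sqr_ge0 (ell2_norm (x - ((t%:C)%C * a) *: y)).
rewrite normB_sq normZ innerZr -/a normcM normc_real -/n.
have -> : ((t%:C)%C * a)^* * a = ((t * normc a ^+ 2)%:C)%C.
  have tr : ((t%:C)%C : R[i])^* = (t%:C)%C by apply/eqP; rewrite eq_complex /= oppr0 !eqxx.
  by rewrite rmorphM/= tr -mulrA (mulrC _ a) mulcJ -rmorphM.
have t0 : 0 <= t by rewrite invr_ge0 sqr_ge0.
have tn : t * n ^+ 2 = 1 by rewrite mulVf ?expf_neq0 ?gt_eqF.
rewrite (ger0_norm t0); move: (normc a) => q /=.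
have -> : (t * q * n) ^+ 2 = t * q ^+ 2.
  by transitivity (t * (t * n ^+ 2) * q ^+ 2); [ring | rewrite tn mulr1].
move=> h; have {}h : t * q ^+ 2 <= ell2_norm x ^+ 2 by lra.
have := ler_wpM2r (sqr_ge0 n) h.
by rewrite mulrAC tn mul1r.
Qed.

Lemma ler_norm2D x y : ell2_norm (x + y) <= ell2_norm x + ell2_norm y.
Proof.
rewrite -ler_sqr ?nnegrE ?addr_ge0 ?ell2_norm_ge0//.
rewrite normD_sq sqrrD; suff : Re <| x, y |> <= ell2_norm x * ell2_norm y by lra.
apply: (le_trans (ler_norm _)); apply: (le_trans (normc_Re _)).
exact: cauchy_schwarz.
Qed.

Lemma ler_norm2B x y : ell2_norm (x - y) <= ell2_norm x + ell2_norm y.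
Proof. by rewrite -(normN y) ler_norm2D. Qed.

Lemma ler_dist2D x y z : ell2_norm (x - y) <= ell2_norm (x - z) + ell2_norm (z - y).
Proof. by rewrite -[x - y](subrKA z) ler_norm2D. Qed.

Lemma ler_norm2_sum (I : Type) (r : seq I) (F : I -> H) :
  ell2_norm (\sum_(i <- r) F i) <= \sum_(i <- r) ell2_norm (F i).
Proof.
elim/big_rec2: _ => [|i a w _ h]; first by rewrite ell2_norm0.
by rewrite (le_trans (ler_norm2D _ _))// lerD2l.
Qed.

Lemma delta_summable (j : J) : (fun k => (k == j)%:R) \in @square_summable R J.
Proof.
rewrite inE /sqsum (@esum_single _ _ j) ?ltry ?sqr_ge0// => k /negbTE ->.
by rewrite normc0 expr0n.
Qed.

Definition delta (j : J) : H := Ell2 (delta_summable j).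

Lemma deltaE j k : delta j k = (k == j)%:R. Proof. by []. Qed.

Lemma inner_delta x j : <| x, delta j |> = x j.
Proof.
rewrite /ell2_inner (@csum_single _ _ j) => [|k /negbTE kj].
  by rewrite deltaE eqxx conjC1 mulr1.
by rewrite deltaE kj conjC0 mulr0.
Qed.

Lemma inner_deltal x j : <| delta j, x |> = (x j)^*.
Proof. by rewrite innerC inner_delta. Qed.

Lemma norm_delta j : ell2_norm (delta j) = 1.
Proof.
apply/eqP; rewrite -(@eqrXn2 _ 2) ?ell2_norm_ge0// expr1n.
by rewrite ell2_norm_sq inner_delta deltaE eqxx.
Qed.

Lemma norm_sq_ge_sum x (F : {fset J}) :
  \sum_(j <- F) normc (x j) ^+ 2 <= ell2_norm x ^+ 2.
Proof.
rewrite -lee_fin ell2_normE; apply: ereal_sup_ubound.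
exists [set` F]; first by split.
by rewrite fsbig_finite//= set_fsetK sumEFin.
Qed.

Lemma sqsum_le_fset (f : J -> R[i]) (M : R) :
  (forall F : {fset J}, \sum_(j <- F) normc (f j) ^+ 2 <= M) ->
  (sqsum f <= M%:E)%E.
Proof.
move=> h; apply: ge_ereal_sup => _ [A [finA _] <-].
by rewrite fsbig_finite//= sumEFin lee_fin h.
Qed.

Definition fin_part x (F : {fset J}) : H := \sum_(j <- F) x j *: delta j.

Lemma sum_deltaE (c : J -> R[i]) (F : {fset J}) k :
  (\sum_(j <- F) c j *: delta j : H) k = if k \in F then c k else 0.
Proof.
rewrite -inner_delta inner_suml.
under eq_bigr do rewrite innerZ inner_delta deltaE.
case: ifPn => kF.
  rewrite (big_fsetD1 k)//= eqxx mulr1 big1_fset ?addr0// => j.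
  by rewrite !inE eq_sym => /andP[/negbTE -> _]; rewrite mulr0.
by rewrite big1_fset// => j jF _; rewrite (_ : k == j = false) ?mulr0//;
  apply: contraNF kF => /eqP ->.
Qed.

Lemma norm_sum_delta (c : J -> R[i]) (F : {fset J}) :
  ell2_norm (\sum_(j <- F) c j *: delta j : H) ^+ 2 = \sum_(j <- F) normc (c j) ^+ 2.
Proof.
rewrite ell2_norm_sq inner_sumr.
transitivity (Re (\sum_(j <- F) ((normc (c j) ^+ 2)%:C)%C)); last first.
  by rewrite -rmorph_sum.
rewrite big_seq [in RHS]big_seq; congr (Re _); apply: eq_bigr => j jF.
by rewrite innerZr inner_delta sum_deltaE jF mulrC mulcJ.
Qed.

Lemma fin_part_approx x (e : R) : 0 < e ->
  exists F : {fset J}, ell2_norm (x - fin_part x F) < e.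
Proof.
move=> e0; have e20 : 0 < e ^+ 2 by rewrite exprn_gt0.
have : (sqsum x - (e ^+ 2)%:E < sqsum x)%E.
  by rewrite -ell2_normE -EFinB lte_fin ltrBlDr ltrDl.
move=> /ereal_sup_gt [_ [A [finA _]] <-]; rewrite fsbig_finite//= sumEFin.
move=> h; exists (fset_set A); set F := fset_set A in h *.
rewrite -ltr_sqr ?nnegrE ?ell2_norm_ge0 ?ltW// /fin_part normB_sq norm_sum_delta.
rewrite inner_sumr.
have -> : Re (\sum_(j <- F) <| x, x j *: delta j |>) =
   \sum_(j <- F) normc (x j) ^+ 2.
  transitivity (Re (\sum_(j <- F) ((normc (x j) ^+ 2)%:C)%C)); last first.
    by rewrite -rmorph_sum.
  by congr (Re _); apply: eq_bigr => j _; rewrite innerZr inner_delta mulrC mulcJ.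
move: h; rewrite -ell2_normE -EFinB lte_fin; lra.
Qed.

Lemma inner_eqP x y : (forall z, <| x, z |> = <| y, z |>) -> x = y.
Proof. by move=> h; apply: ell2P => j; rewrite -!inner_delta. Qed.

End InnerProduct.
Notation "<| x , y |>" := (ell2_inner x y).

Arguments normc : simpl never.
Arguments ell2_inner : simpl never.
Arguments ell2_norm : simpl never.
Arguments csum : simpl never.

(** * Bounded operators and ultralimits *)

Section Operators.
Variables (R : realType) (J : choiceType).
Local Notation H := (ell2 R J).
Local Notation B := (bop R J).
Implicit Types (x y z : H) (a b : R[i]) (S T : B).
Local Notation Re := (@complex.Re R).

Lemma bop_addE S T x : (S + T) x = S x + T x. Proof. by []. Qed.
Lemma bop_scaleE a T x : (a *: T) x = a *: T x. Proof. by []. Qed.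
Lemma bop_oppE T x : (- T) x = - T x. Proof. by []. Qed.
Lemma bop_mulE S T x : (S * T) x = S (T x). Proof. by []. Qed.
Lemma bop_oneE x : (1 : B) x = x. Proof. by []. Qed.
Lemma bop_zeroE x : (0 : B) x = 0. Proof. by []. Qed.

Lemma bopD T x y : T (x + y) = T x + T y.
Proof. by have := bop_linear T 1 x y; rewrite !scale1r. Qed.

Lemma bop0 T : T 0 = 0.
Proof. by apply: (@addrI _ (T 0)); rewrite -bopD !addr0. Qed.

Lemma bopZ T a x : T (a *: x) = a *: T x.
Proof. by have := bop_linear T a x 0; rewrite bop0 !addr0. Qed.

Lemma bopN T x : T (- x) = - T x.
Proof. by rewrite -scaleN1r bopZ scaleN1r. Qed.

Lemma bopB T x y : T (x - y) = T x - T y.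
Proof. by rewrite bopD bopN. Qed.

Lemma bop_sumE (I : Type) (r : seq I) (F : I -> B) x :
  (\sum_(i <- r) F i) x = \sum_(i <- r) F i x.
Proof. by elim/big_rec2: _ => [|i u v _ <-]. Qed.

Lemma bop_scaleAl a S T : (a *: S) * T = a *: (S * T).
Proof. exact: bop_eqP. Qed.

Lemma bop_scaleAr a S T : S * (a *: T) = a *: (S * T).
Proof. by apply: bop_eqP => x; rewrite !(bop_mulE, bop_scaleE) bopZ. Qed.

Lemma bop_bound T : exists2 M : R, 0 <= M & forall x, ell2_norm (T x) <= M * ell2_norm x.
Proof.
case: T => T /= /[1!inE] -[_ [M hM]]; exists `|M| => // x.
by rewrite (le_trans (hM x))// ler_wpM2r ?ell2_norm_ge0// ler_norm.
Qed.

Lemma opnorm_has_sup T :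
  has_sup [set ell2_norm (T x) | x in [set x | ell2_norm x <= 1]].
Proof.
split; first by exists (ell2_norm (T 0)); exists 0 => //=; rewrite ell2_norm0.
have [M M0 hM] := bop_bound T; exists M => _ [x /= x1 <-].
by rewrite (le_trans (hM x))// ler_piMr.
Qed.

Lemma opnorm_ge0 T : 0 <= opnorm T.
Proof.
apply: le_trans (ell2_norm_ge0 (T 0)) _; apply: sup_upper_bound.
  exact: opnorm_has_sup.
by exists 0 => //=; rewrite ell2_norm0.
Qed.

Lemma opnormP T x : ell2_norm (T x) <= opnorm T * ell2_norm x.
Proof.
have [x0|x0] := eqVneq (ell2_norm x) 0.
  by rewrite (norm0_eq0 x0) bop0 ell2_norm0 mulr0.
have xp : 0 < ell2_norm x by rewrite lt_neqAle eq_sym x0 ell2_norm_ge0.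
rewrite -ler_pdivrMr//; apply: sup_upper_bound; first exact: opnorm_has_sup.
have nn : normc (((ell2_norm x)^-1)%:C)%C = (ell2_norm x)^-1.
  by rewrite normc_real ger0_norm// invr_ge0 ltW.
exists ((((ell2_norm x)^-1)%:C)%C *: x) => /=.
  by rewrite normZ nn mulVf.
by rewrite bopZ normZ nn mulrC.
Qed.

Lemma opnorm_le T (M : R) : (forall x, ell2_norm (T x) <= M * ell2_norm x) ->
  0 <= M -> opnorm T <= M.
Proof.
move=> h M0; apply: ge_sup; first by case: (opnorm_has_sup T).
by move=> _ [x /= x1 <-]; rewrite (le_trans (h x))// ler_piMr.
Qed.

Definition sesquilinear (F : H -> H -> R[i]) :=
  (forall a x y z, F (a *: x + y) z = a * F x z + F y z) /\
  (forall a x y z, F z (a *: x + y) = a^* * F z x + F z y).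

Lemma small_eq0 (a : R[i]) (C : R) :
  (forall e : R, 0 < e -> normc a <= C * e) -> a = 0.
Proof.
move=> h; apply: eq0_normc; apply/eqP; rewrite eq_le normc_ge0 andbT leNgt.
apply/negP => a0; set n := normc a in h a0.
have D0 : 0 < `|C| + 1 by rewrite ltr_pwDr.
have := h (n / (2 * (`|C| + 1))) _; rewrite divr_gt0 ?mulr_gt0// => /(_ isT).
apply/negP; rewrite -ltNge.
apply: (@le_lt_trans _ _ ((`|C| + 1) * (n / (2 * (`|C| + 1))))).
  apply: ler_wpM2r; first by rewrite divr_ge0 ?mulr_ge0 ?ltW.
  by apply: (le_trans (ler_norm _)); rewrite lerDl.
rewrite [ltLHS](_ : _ = n / 2); last by field; rewrite gt_eqF.
lra.
Qed.

(** The Riesz representation, built by coordinates: [T x] has j-th coordinate [F x (delta j)], and F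
    is recovered from its values on point masses by density of the finite parts. *)
Lemma form_op (F : H -> H -> R[i]) (M : R) : 0 <= M -> sesquilinear F ->
  (forall x y, normc (F x y) <= M * (ell2_norm x * ell2_norm y)) ->
  exists2 T : B, forall x y, <| T x, y |> = F x y &
    forall x, ell2_norm (T x) <= M * ell2_norm x.
Proof.
move=> M0 [Fl Fr] FM.
have Fr0 z : F z 0 = 0.
  apply: (@addrI _ (F z 0)); have := Fr 1 0 0 z.
  by rewrite scale1r addr0 conjC1 mul1r => h; rewrite -h addr0.
have FrB x y z : F z (x - y) = F z x - F z y.
  by rewrite addrC -scaleN1r Fr rmorphN1 mulN1r addrC.
have Frsum z (c : J -> R[i]) (A : {fset J}) :
   F z (\sum_(j <- A) c j *: delta R j) = \sum_(j <- A) (c j)^* * F z (delta R j).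
  by elim/big_rec2: _ => [|i u v _ <-]; rewrite ?Fr0 ?Fr.
pose f x j := F x (delta R j).
(* Testing [F x] on the vector w of its own coordinates gives norm(w)^2 <= M norm(x) norm(w), and
   one factor cancels. *)
have fle x (A : {fset J}) : \sum_(j <- A) normc (f x j) ^+ 2 <= (M * ell2_norm x) ^+ 2.
  pose w : H := \sum_(j <- A) f x j *: delta R j.
  have e1 : F x w = ((\sum_(j <- A) normc (f x j) ^+ 2)%:C)%C.
    rewrite Frsum rmorph_sum; apply: eq_bigr => j _.
    by rewrite -/(f x j) mulrC mulcJ.
  have e2 : ell2_norm w ^+ 2 = \sum_(j <- A) normc (f x j) ^+ 2 by rewrite norm_sum_delta.
  have := FM x w; rewrite e1 -e2 normc_real ger0_norm ?sqr_ge0//.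
  have := ell2_norm_ge0 w; rewrite le_eqVlt => /predU1P[<- _|w0].
    by rewrite expr0n sqr_ge0.
  rewrite mulrA expr2 ler_pM2r// => h.
  by rewrite -expr2 ler_sqr ?nnegrE ?mulr_ge0 ?ell2_norm_ge0.
have fs x : f x \in @square_summable R J.
  by rewrite inE (le_lt_trans (sqsum_le_fset (fle x)))// ltry.
pose T x : H := Ell2 (fs x).
have TM x : ell2_norm (T x) <= M * ell2_norm x.
  rewrite -ler_sqr ?nnegrE ?mulr_ge0 ?ell2_norm_ge0// -lee_fin ell2_normE.
  exact: (sqsum_le_fset (fle x)).
have Tlin : linear T by move=> a x y; apply: ell2P => j; exact: Fl.
have Tb : T \in @bounded_operator R J by rewrite inE; split=> //; exists M.
exists (Bop Tb) => //= x y; apply/eqP; rewrite -subr_eq0; apply/eqP.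
apply: (@small_eq0 _ (2 * (M * ell2_norm x))) => e e0.
have [A hA] := fin_part_approx y e0.
have e1 : <| T x, fin_part y A |> = F x (fin_part y A).
  rewrite /fin_part inner_sumr Frsum; apply: eq_bigr => j _.
  by rewrite innerZr inner_delta.
rewrite (_ : _ - _ = <| T x, y - fin_part y A |> - F x (y - fin_part y A)); last first.
  by rewrite innerBr FrB e1; ring.
apply: (le_trans (le_normcD _ _)); rewrite normcN.
have h1 := cauchy_schwarz (T x) (y - fin_part y A).
have h2 := FM x (y - fin_part y A).
have h3 : M * ell2_norm x * ell2_norm (y - fin_part y A) <= M * ell2_norm x * e.
  by apply: ler_wpM2l; [rewrite mulr_ge0 ?ell2_norm_ge0 | exact: ltW].
have h4 : ell2_norm (T x) * ell2_norm (y - fin_part y A) <= 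
   M * ell2_norm x * ell2_norm (y - fin_part y A).
  by rewrite ler_wpM2r ?ell2_norm_ge0.
lra.
Qed.

Lemma adjoint_exists T : exists S, adjoint_of T S.
Proof.
have [M M0 hM] := bop_bound T.
have [|x y|S hS _] := @form_op (fun x y => <| x, T y |>) M M0.
- split=> a x y z; first by rewrite innerD innerZ.
  by rewrite bopD bopZ innerDr innerZr.
- rewrite (le_trans (cauchy_schwarz _ _))// mulrCA ler_wpM2l ?ell2_norm_ge0//.
exists S => x y; by rewrite innerC -hS -innerC.
Qed.

Definition adj T : B := projT1 (cid (adjoint_exists T)).

Lemma adjP T : adjoint_of T (adj T).
Proof. exact: (projT2 (cid (adjoint_exists T))). Qed.

Lemma adj_l T x y : <| T x, y |> = <| x, adj T y |>.
Proof. exact: adjP. Qed.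

Lemma adj_r T x y : <| x, T y |> = <| adj T x, y |>.
Proof. by rewrite innerC adj_l -innerC. Qed.

Lemma inner_eqrP x y : (forall z, <| z, x |> = <| z, y |>) -> x = y.
Proof. by move=> h; apply: inner_eqP => z; rewrite innerC h -innerC. Qed.

Lemma adjoint_unique T S S' : adjoint_of T S -> adjoint_of T S' -> S = S'.
Proof.
by move=> h h'; apply: bop_eqP => y; apply: inner_eqrP => z; rewrite -h -h'.
Qed.

Lemma adjE T S : adjoint_of T S -> adj T = S.
Proof. by apply: adjoint_unique; exact: adjP. Qed.

Lemma adjK T : adj (adj T) = T.
Proof. by apply: adjE => x y; rewrite adj_r. Qed.

Lemma adjM S T : adj (S * T) = adj T * adj S.
Proof. by apply: adjE => x y; rewrite !bop_mulE !adj_l. Qed.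

Lemma adjD S T : adj (S + T) = adj S + adj T.
Proof. by apply: adjE => x y; rewrite !bop_addE innerD innerDr !adj_l. Qed.

Lemma adjZ a T : adj (a *: T) = a^* *: adj T.
Proof. by apply: adjE => x y; rewrite !bop_scaleE innerZ innerZr conjCK adj_l. Qed.

Lemma adjN T : adj (- T) = - adj T.
Proof. by apply: adjE => x y; rewrite !bop_oppE innerNl innerNr adj_l. Qed.

Lemma adj1 : adj 1 = 1.
Proof. exact: adjE. Qed.

Lemma norm_adj T (M : R) : 0 <= M -> (forall x, ell2_norm (T x) <= M * ell2_norm x) ->
  forall x, ell2_norm (adj T x) <= M * ell2_norm x.
Proof.
move=> M0 h x; have := ell2_norm_ge0 (adj T x); rewrite le_eqVlt => /predU1P[<-|p].
  by rewrite mulr_ge0 ?ell2_norm_ge0.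
rewrite -(ler_pM2r p) -expr2 ell2_norm_sq -adj_l.
apply: (le_trans (ler_norm _)); apply: (le_trans (normc_Re _)).
apply: (le_trans (cauchy_schwarz _ _)).
have := h (adj T x); have := ell2_norm_ge0 x => x0 hh.
have := ler_wpM2r x0 hh; lra.
Qed.

Lemma bop_eq_delta S T : (forall j, S (delta R j) = T (delta R j)) -> S = T.
Proof.
move=> h; rewrite -[S]adjK -[T]adjK; congr adj; apply: bop_eqP => x.
by apply: ell2P => j; rewrite -!inner_delta -!adj_r h.
Qed.

End Operators.

(** * Limits along an ultrafilter *)

Section UltraLimits.
Variables (R : realType) (U : set_system nat).
Hypothesis UU : UltraFilter U.
#[local] Existing Instance UU.
Implicit Types (z w : nat -> R[i]) (l : R[i]) (e M : R).

(** An ultrafilter gives every bounded sequence a limit at once, so operators can be defined by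
    limits of forms that are automatically linear, with no extraction of subsequences. *)
Definition uconv z l := forall e, 0 < e -> U [set n | normc (z n - l) < e].

Lemma uconv_close z w l : uconv z l ->
  (forall e, 0 < e -> U [set n | normc (z n - w n) < e]) -> uconv w l.
Proof.
move=> zl zw e e0; have e20 : 0 < e / 2 by rewrite divr_gt0.
apply: (filterS _ (filterI (zl _ e20) (zw _ e20))) => n [/= h1 h2].
rewrite (_ : w n - l = (z n - l) - (z n - w n)); last by ring.
apply: (le_lt_trans (le_normcD _ _)); rewrite normcN.
by rewrite (splitr e) ltrD.
Qed.

Lemma uconv_cst l : uconv (fun=> l) l.
Proof.
move=> e e0; apply: (filterS _ filterT) => n _ /=.
by rewrite subrr normc0.
Qed.

Lemma uconv_unique z l l' : uconv z l -> uconv z l' -> l = l'.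
Proof.
move=> zl zl'; apply/eqP; rewrite -subr_eq0; apply/eqP.
apply: (@small_eq0 _ _ 2) => e e0.
have h : U ([set n | normc (z n - l) < e] `&` [set n | normc (z n - l') < e]).
  by apply: filterI; [exact: zl | exact: zl'].
have [n [/= h1 h2]] := filter_ex h.
rewrite (_ : l - l' = (z n - l') - (z n - l)); last by ring.
apply: (le_trans (le_normcD _ _)); rewrite normcN; lra.
Qed.

Lemma uconvD z w l l' : uconv z l -> uconv w l' -> uconv (fun n => z n + w n) (l + l').
Proof.
move=> zl wl e e0; have e20 : 0 < e / 2 by rewrite divr_gt0.
apply: (filterS _ (filterI (zl _ e20) (wl _ e20))) => n [/= h1 h2].
rewrite (_ : _ - _ = (z n - l) + (w n - l')); last by ring.
by apply: (le_lt_trans (le_normcD _ _)); rewrite (splitr e) ltrD.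
Qed.

Lemma uconvZ a z l : uconv z l -> uconv (fun n => a * z n) (a * l).
Proof.
move=> zl e e0; have D0 : 0 < normc a + 1 by rewrite ltr_wpDl ?normc_ge0.
have := zl _ (divr_gt0 e0 D0); apply: filterS => n /=.
rewrite ltr_pdivlMr// -mulrBr normcM => h; apply: le_lt_trans h.
by rewrite mulrC ler_wpM2l ?normc_ge0// lerDl.
Qed.

Lemma uconvJ z l : uconv z l -> uconv (fun n => (z n)^*) l^*.
Proof. by move=> zl e /zl; apply: filterS => n /=; rewrite -rmorphB/= normc_conj. Qed.

Lemma uconv_le z l M : uconv z l -> (forall n, normc (z n) <= M) -> normc l <= M.
Proof.
move=> zl zM; apply/ler_addgt0Pr => e e0.
have /filter_ex[n /= h] := zl _ e0.
rewrite (_ : l = z n - (z n - l)); last by ring.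
apply: (le_trans (le_normcD _ _)); rewrite normcN; apply: lerD => //; exact: ltW.
Qed.

(** The limit is the supremum of the levels that u reaches on a set of U. A level above it fails on
    a set of U, by the dichotomy of ultrafilters. *)
Lemma real_ulim (u : nat -> R) M : (forall n, `|u n| <= M) ->
  exists l : R, forall e, 0 < e -> U [set n | `|u n - l| < e].
Proof.
move=> uM; pose S := [set a | U [set n | a <= u n]].
have UN A : U A \/ U (~` A) by exact: in_ultra_setVsetC.
have S0 : S (- M).
  by apply: (filterS _ filterT) => n _ /=; have := uM n; rewrite ler_norml => /andP[].
have Sub : ubound S M.
  move=> a /filter_ex[n /= h]; apply: (le_trans h).
  by have := uM n; rewrite ler_norml => /andP[].
have hS : has_sup S by split; [exists (- M) | exists M].
exists (sup S) => e e0.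
have h1 : U [set n | u n < sup S + e].
  case: (UN [set n | sup S + e <= u n]) => h.
    have : sup S + e <= sup S by exact: sup_upper_bound.
    by rewrite gerDl leNgt e0.
  by apply: filterS h => n /= /negP; rewrite -ltNge.
have [a Sa ha] := sup_adherent e0 hS.
apply: (filterS _ (filterI h1 Sa)) => n [/= h2 h3].
by rewrite ltr_norml; apply/andP; split; lra.
Qed.

Lemma uconv_ex z M : (forall n, normc (z n) <= M) -> exists l, uconv z l.
Proof.
move=> zM.
have [a ha] := @real_ulim (fun n => complex.Re (z n)) M (fun n => le_trans (normc_Re _) (zM n)).
have [b hb] := @real_ulim (fun n => complex.Im (z n)) M (fun n => le_trans (normc_Im _) (zM n)).
exists (Complex a b) => e e0; have e20 : 0 < e / 2 by rewrite divr_gt0.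
apply: (filterS _ (filterI (ha _ e20) (hb _ e20))) => n [/= h1 h2].
have -> : z n - Complex a b = ((complex.Re (z n) - a)%:C)%C + 'i%C * ((complex.Im (z n) - b)%:C)%C.
  by case: (z n) => p q; apply/eqP; rewrite eq_complex /=; apply/andP; split; apply/eqP; ring.
apply: (le_lt_trans (le_normcD _ _)); rewrite normcM !normc_real.
rewrite (_ : normc 'i%C = 1) ?mul1r; last first.
  by rewrite /normc expr0n add0r expr1n sqrtr1.
by rewrite (splitr e) ltrD.
Qed.

Variable (J : choiceType).
Local Notation H := (ell2 R J).

Lemma form_ulim (F : nat -> H -> H -> R[i]) M : 0 <= M ->
  (forall n, sesquilinear (F n)) ->
  (forall n x y, normc (F n x y) <= M * (ell2_norm x * ell2_norm y)) ->
  exists2 T : bop R J, forall x y, uconv (fun n => F n x y) <| T x, y |> &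
    forall x, ell2_norm (T x) <= M * ell2_norm x.
Proof.
move=> M0 Fs FM.
have ex x y : exists l, uconv (fun n => F n x y) l by apply: (@uconv_ex _ (M * (ell2_norm x * ell2_norm y))) => n; exact: FM.
pose L x y := projT1 (cid (ex x y)).
have LP x y : uconv (fun n => F n x y) (L x y) := projT2 (cid (ex x y)).
have [|x y|T TL TM] := @form_op R J L M M0.
- split=> a x y z.
    apply: (uconv_unique (LP _ _)).
    under eq_fun do rewrite (Fs _).1.
    by apply: uconvD => //; apply: uconvZ.
  apply: (uconv_unique (LP _ _)).
  under eq_fun do rewrite (Fs _).2.
  by apply: uconvD => //; apply: uconvZ.
- exact: uconv_le (LP x y) (fun n => FM n x y).
by exists T => // x y; rewrite TL.
Qed.

Lemma wot_ulim (T : nat -> bop R J) M : 0 <= M ->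
  (forall n x, ell2_norm (T n x) <= M * ell2_norm x) ->
  exists2 S : bop R J, forall x y, uconv (fun n => <| T n x, y |>) <| S x, y |> &
    forall x, ell2_norm (S x) <= M * ell2_norm x.
Proof.
move=> M0 TM; apply: form_ulim => // [n|n x y].
  by split=> a x y z; [rewrite bopD bopZ innerD innerZ | rewrite innerDr innerZr].
apply: (le_trans (cauchy_schwarz _ _)).
by rewrite mulrA ler_wpM2r ?ell2_norm_ge0.
Qed.

Lemma wot_closed_ulim (N : set (bop R J)) (T : nat -> bop R J) (S : bop R J) : wot_closed N ->
  (forall n, N (T n)) ->
  (forall x y, uconv (fun n => <| T n x, y |>) <| S x, y |>) -> N S.
Proof.
move=> Nc NT TS; apply: Nc => s e e0.
suff /filter_ex[n hn] : U [set n | forall p, p \in s ->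
    normc <| (T n - S) p.1, p.2 |> < e] by exists (T n).
elim: s => [|p s IH]; first by apply: (filterS _ filterT).
apply: (filterS _ (filterI IH (TS p.1 p.2 _ e0))) => n [h1 h2] q.
rewrite inE => /predU1P[->|]; last exact: h1.
by rewrite bop_addE bop_oppE innerBl.
Qed.

End UltraLimits.

(** * The group von Neumann algebra *)

Ltac gsimpl :=
  rewrite ?(invgM, invgK, mulgA, mulgK, mulgVK, mulVg, mulgV, mul1g, mulg1, invg1).

Section Regular.
Variables (R : realType) (G : groupType).
Local Notation H := (ell2 R G).
Local Notation B := (bop R G).
Local Notation dl := (@delta R G).
Local Notation LG := (group_vna R G).
Implicit Types (x y : H) (S T : B) (g h k : G).

Lemma right_translate_sqsum g (f : G -> R[i]) : sqsum (fun h => f (h * g)%g) = sqsum f.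
Proof.
rewrite /sqsum [RHS](@reindex_esum R G G setT setT (fun h => (h * g)%g))//.
split=> // [x y _ _ /mulIg//|x _ /=].
by exists (x * g^-1)%g => //; rewrite mulgVK.
Qed.

Lemma right_translate_summable g x : (fun h => x (h * g)%g) \in @square_summable R G.
Proof. by rewrite inE right_translate_sqsum; exact: sqsum_lty. Qed.

Definition right_translate g x : H := Ell2 (right_translate_summable g x).

Lemma right_translate_norm g x : ell2_norm (right_translate g x) = ell2_norm x.
Proof. by rewrite /ell2_norm right_translate_sqsum. Qed.

Lemma right_translate_bounded g : right_translate g \in @bounded_operator R G.
Proof.
rewrite inE; split=> [a x y|]; first exact: ell2P.
by exists 1 => x; rewrite mul1r right_translate_norm.
Qed.

Definition right_regular g : B := Bop (right_translate_bounded g).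
Local Notation lam := (left_regular R).
Local Notation rho := right_regular.

Lemma lamE g x h : lam g x h = x (g^-1 * h)%g. Proof. by []. Qed.
Lemma rhoE g x h : rho g x h = x (h * g)%g. Proof. by []. Qed.

Lemma norm_rho g x : ell2_norm (rho g x) = ell2_norm x.
Proof. exact: right_translate_norm. Qed.

Lemma lam_delta g k : lam g (dl k) = dl (g * k)%g.
Proof.
apply: ell2P => h; rewrite lamE !deltaE; congr (nat_of_bool _)%:R.
by apply/eqP/eqP => [<-|->]; rewrite ?mulVKg ?mulKg.
Qed.

Lemma rho_delta g k : rho g (dl k) = dl (k * g^-1)%g.
Proof.
apply: ell2P => h; rewrite rhoE !deltaE; congr (nat_of_bool _)%:R.
by apply/eqP/eqP => [<-|->]; rewrite ?mulgK ?mulgVK.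
Qed.

Lemma delta_rho k : dl k = rho (k^-1)%g (dl 1%g).
Proof. by rewrite rho_delta invgK mul1g. Qed.

Lemma delta_lam k : dl k = lam k (dl 1%g).
Proof. by rewrite lam_delta mulg1. Qed.

Lemma lam_rho g h x : lam g (rho h x) = rho h (lam g x).
Proof. by apply: ell2P => k; rewrite lamE !rhoE lamE mulgA. Qed.

Lemma inner_rho g x y : <| rho g x, rho g y |> = <| x, y |>.
Proof.
rewrite /ell2_inner [RHS](@reindex_csum _ _ _ (fun h => h * g)%g)//.
by exists (fun h => h * g^-1)%g => h; rewrite ?mulgK ?mulgVK.
Qed.

Lemma group_vna_rho T : LG T -> forall g x, T (rho g x) = rho g (T x).
Proof.
move=> hT g x; have /(_ (rho g)) := hT; rewrite /commutant/= => /(_ _)/(congr1 (fun F : B => F x)).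
apply => _ [h _ <-]; apply: bop_eqP => z; exact/esym/lam_rho.
Qed.

Lemma rho_coef T : (forall g x, T (rho g x) = rho g (T x)) ->
  forall g h, T (dl g) h = T (dl 1%g) (h * g^-1)%g.
Proof. by move=> hT g h; rewrite [in LHS]delta_rho hT rhoE. Qed.

Lemma adj_coef T g h : adj T (dl h) g = (T (dl g) h)^*.
Proof. by rewrite -inner_delta -adj_r -inner_deltal. Qed.

(** The commutation theorem for the regular representations. The matrix of T depends on h g^-1 and
    that of S on g^-1 h, so both products are the same convolution of two functions on G. *)
Lemma rho_group_vna T : (forall g x, T (rho g x) = rho g (T x)) -> LG T.
Proof.
move=> hT S hS; apply: bop_eq_delta => g; apply: ell2P => h.
have lS k x : S (lam k x) = lam k (S x).
  have := hS (lam k); rewrite /= => /(_ _)/(congr1 (fun F : B => F x)).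
  by apply; exists k.
have Sc k l : S (dl k) l = S (dl 1%g) (k^-1 * l)%g by rewrite [in LHS]delta_lam lS lamE.
rewrite !bop_mulE -!inner_delta !(adj_l _ _ (dl h)) /ell2_inner.
have aE F k : (adj F (dl h) k)^* = F (dl k) h.
  by rewrite adj_coef conjCK.
(* The substitution k -> g k^-1 h exchanges the two convolution sums. *)
rewrite [LHS](@reindex_csum _ _ _ (fun k => g * k^-1 * h)%g); last first.
  by exists (fun k => h * k^-1 * g)%g => k; gsimpl.
congr csum; apply/funext => k; rewrite !aE.
rewrite Sc (Sc k) (rho_coef hT) (rho_coef hT g) mulrC.
by congr (T _ _ * S _ _); gsimpl.
Qed.

Lemma group_vnaP T : LG T <-> forall g x, T (rho g x) = rho g (T x).
Proof. by split; [exact: group_vna_rho | exact: rho_group_vna]. Qed.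

Lemma lam_group_vna g : LG (lam g).
Proof. by apply/group_vnaP => h x; rewrite lam_rho. Qed.

Lemma group_vna_lin a S T : LG S -> LG T -> LG (a *: S + T).
Proof.
move=> /group_vnaP hS /group_vnaP hT; apply/group_vnaP => g x.
by rewrite !bop_addE !bop_scaleE hS hT bopD bopZ.
Qed.

Lemma group_vna0 : LG 0.
Proof. by apply/group_vnaP => g x; rewrite !bop_zeroE bop0. Qed.

Lemma group_vnaZ a S : LG S -> LG (a *: S).
Proof. by move=> hS; rewrite -[_ *: _]addr0; apply: group_vna_lin => //; exact: group_vna0. Qed.

Lemma group_vnaD S T : LG S -> LG T -> LG (S + T).
Proof. by move=> hS hT; rewrite -(scale1r S); exact: group_vna_lin. Qed.

Lemma group_vnaB S T : LG S -> LG T -> LG (S - T).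
Proof. by move=> hS hT; rewrite addrC -scaleN1r; exact: group_vna_lin. Qed.

Lemma group_vnaM S T : LG S -> LG T -> LG (S * T).
Proof.
move=> /group_vnaP hS /group_vnaP hT; apply/group_vnaP => g x.
by rewrite !bop_mulE hT hS.
Qed.

Lemma rho_adj g : adj (rho g) = rho (g^-1)%g.
Proof.
apply: adjE => x y; rewrite -(inner_rho g x); congr (<| _, _ |>).
by apply: ell2P => h; rewrite !rhoE mulgK.
Qed.

Lemma lam_adj g : adj (lam g) = lam (g^-1)%g.
Proof.
apply: adjE => x y; rewrite /ell2_inner (@reindex_csum _ _ _ (fun h => g * h)%g).
  by congr csum; apply/funext => h; rewrite !lamE mulKg invgK.
by exists (fun h => g^-1 * h)%g => h; rewrite ?mulKg ?mulVKg.
Qed.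

Lemma group_vna_adj T : LG T -> LG (adj T).
Proof.
move=> /group_vnaP hT; apply/group_vnaP => g x; apply: inner_eqrP => z.
by rewrite -adj_l -[g]invgK -rho_adj -!adj_l hT.
Qed.

Lemma group_vna_sum (I : Type) (r : seq I) (F : I -> B) :
  (forall i, LG (F i)) -> LG (\sum_(i <- r) F i).
Proof.
move=> h; elim/big_rec: _ => [|i u _ hu]; first exact: group_vna0.
exact: group_vnaD.
Qed.

Lemma group_vna_coef T : LG T -> forall g h, T (dl g) h = T (dl 1%g) (h * g^-1)%g.
Proof. by move=> /group_vnaP; exact: rho_coef. Qed.

Lemma group_vna_coord T x h : LG T ->
  T x h = csum (fun k => x k * T (dl 1%g) (h * k^-1)%g).
Proof.
move=> hT; rewrite -inner_delta adj_l /ell2_inner; congr csum.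
by apply/funext => k; rewrite adj_coef conjCK group_vna_coef.
Qed.

Lemma group_vna_traceE S T : LG T ->
  <| T (S (dl 1%g)), dl 1%g |> = csum (fun k => S (dl 1%g) k * T (dl 1%g) (k^-1)%g).
Proof.
move=> hT; rewrite inner_delta (group_vna_coord _ _ hT); congr csum.
by apply/funext => k; rewrite mul1g.
Qed.

(** The vector state at the identity is a trace: the convolution sum is symmetric under k ->
    k^-1. *)
Lemma trace_comm S T : LG S -> LG T ->
  <| T (S (dl 1%g)), dl 1%g |> = <| S (T (dl 1%g)), dl 1%g |>.
Proof.
move=> hS hT; rewrite !group_vna_traceE//.
rewrite (@reindex_csum _ _ _ (fun k => k^-1)%g); last by exists (fun k => k^-1)%g => k; rewrite invgK.
by congr csum; apply/funext => k; rewrite invgK mulrC.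
Qed.

Lemma norm_adj_trace T : LG T -> ell2_norm (adj T (dl 1%g)) = ell2_norm (T (dl 1%g)).
Proof.
move=> hT; apply/eqP; rewrite -(@eqrXn2 _ 2) ?ell2_norm_ge0// !ell2_norm_sq.
apply/eqP; rewrite -adj_l [in RHS]adj_r trace_comm//; exact: group_vna_adj.
Qed.

Lemma isometry_of_adj S : adj S * S = 1 -> forall x, ell2_norm (S x) = ell2_norm x.
Proof.
move=> h x; apply/eqP; rewrite -(@eqrXn2 _ 2) ?ell2_norm_ge0// !ell2_norm_sq adj_l.
by rewrite -bop_mulE h bop_oneE.
Qed.

(** Traciality makes the 2-norm invariant under adjoints, which turns multiplication by a unitary on
    the right into multiplication by an isometry on the left. The point k is moved to 1 by a right
    translation, which T and S commute with. *)
Lemma norm_trace_unitary T S k : LG T -> LG S -> S * adj S = 1 ->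
  ell2_norm (T (S (dl k))) = ell2_norm (T (dl 1%g)).
Proof.
move=> hT hS uu; rewrite delta_rho !(group_vna_rho hS, group_vna_rho hT) norm_rho.
rewrite -bop_mulE -norm_adj_trace; last exact: group_vnaM.
by rewrite adjM bop_mulE isometry_of_adj ?adjK// norm_adj_trace.
Qed.

Lemma separating S T : LG S -> LG T -> S (dl 1%g) = T (dl 1%g) -> S = T.
Proof.
move=> hS hT ST; apply: bop_eq_delta => k; apply: ell2P => h.
by rewrite (group_vna_coef hS) (group_vna_coef hT) ST.
Qed.

End Regular.

(** * Unitaries of a von Neumann algebra *)

Lemma nat_ultrafilter : exists2 U : set_system nat, UltraFilter U &
  forall n, U [set m | (n <= m)%N].
Proof.
have [U [UU Uoo]] := ultraFilterLemma (eventually_filter : ProperFilter \oo).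
by exists U => // n; apply: Uoo; exists n.
Qed.

Section VonNeumann.
Variables (R : realType) (J : choiceType) (N : set (bop R J)).
Hypothesis hN : von_neumann_algebra N.
Local Notation H := (ell2 R J).
Local Notation B := (bop R J).
Implicit Types (S T v : B) (x y : H).

Lemma vna0 : N 0.
Proof. by have := vna_lin hN (-1) (vna_one hN) (vna_one hN); rewrite scaleN1r addNr. Qed.

Lemma vnaZ a T : N T -> N (a *: T).
Proof. by move=> hT; rewrite -[_ *: _]addr0; apply: (vna_lin hN) => //; exact: vna0. Qed.

Lemma vnaD S T : N S -> N T -> N (S + T).
Proof. by move=> hS hT; rewrite -(scale1r S); exact: (vna_lin hN). Qed.

Lemma vnaB S T : N S -> N T -> N (S - T).
Proof. by move=> hS hT; rewrite addrC -scaleN1r; exact: (vna_lin hN). Qed.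

Lemma vnaA T : N T -> N (adj T).
Proof. by move=> /(vna_adj hN)[S hS /adjE ->]. Qed.

Lemma vnaX T n : N T -> N (T ^+ n).
Proof.
move=> hT; elim: n => [|n IH]; first by rewrite expr0; exact: (vna_one hN).
by rewrite exprS; apply: (vna_mul hN).
Qed.

Definition unitary v := v * adj v = 1 /\ adj v * v = 1.

Lemma halfD T : 2^-1 *: (T + T) = T.
Proof. by rewrite -mulr2n -[T *+ 2]scaler_nat scalerA mulVf ?scale1r. Qed.

Lemma projP (p : B) : projection p <-> p * p = p /\ adj p = p.
Proof. by split=> -[h1 h2]; split=> //; [exact: adjE | rewrite -{2}h2; exact: adjP]. Qed.

Lemma proj_norm (p : B) x : projection p -> ell2_norm (p x) <= ell2_norm x.
Proof.
move=> /projP[pp pa]; have := ell2_norm_ge0 (p x); rewrite le_eqVlt => /predU1P[<-|h].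
  exact: ell2_norm_ge0.
rewrite -(ler_pM2r h) -expr2 ell2_norm_sq adj_l pa -bop_mulE pp.
rewrite (le_trans (ler_norm _))// (le_trans (normc_Re _))//.
exact: cauchy_schwarz.
Qed.

(* The Cayley transform (1+ia)/(1-ia) is a unitary of N from which a can be
   recovered. *)
Section Cayley.
Variables (U : set_system nat).
Hypothesis UU : UltraFilter U.
Hypothesis Uoo : forall n, U [set m | (n <= m)%N].
#[local] Existing Instance UU.

Lemma norm_pow (T : B) (c : R) : 0 <= c ->
  (forall x, ell2_norm (T x) <= c * ell2_norm x) ->
  forall n x, ell2_norm ((T ^+ n) x) <= c ^+ n * ell2_norm x.
Proof.
move=> c0 h; elim=> [|n IH] x; first by rewrite !expr0 mul1r.
rewrite exprS bop_mulE (le_trans (h _))// exprS -mulrA.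
exact: ler_wpM2l.
Qed.

(** The geometric series is summed as a weak ultralimit of its partial sums, so that membership in N
    is an instance of weak closedness; the remainder [b ^+ n] vanishes because c < 1. *)
Lemma neumann (b : B) (c : R) : N b -> 0 <= c -> c < 1 ->
  (forall x, ell2_norm (b x) <= c * ell2_norm x) ->
  exists r, [/\ N r, (1 - b) * r = 1 & r * (1 - b) = 1].
Proof.
move=> Nb c0 c1 bc; have bn := norm_pow c0 bc.
pose S n : B := \sum_(k < n) b ^+ k.
have cg n : \sum_(k < n) c ^+ k <= (1 - c)^-1.
  rewrite -[leRHS]mul1r ler_pdivlMr ?subr_gt0// mulrC -opprB mulNr -subrX1 opprB.
  by rewrite lerBlDr lerDl exprn_ge0.
have Sb n x : ell2_norm (S n x) <= (1 - c)^-1 * ell2_norm x.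
  rewrite /S bop_sumE (le_trans (ler_norm2_sum _ _))//.
  apply: (@le_trans _ _ (\sum_(k < n) c ^+ k * ell2_norm x)).
    by apply: ler_sum => k _; exact: bn.
  rewrite -mulr_suml.
  by apply: ler_wpM2r (cg n); exact: ell2_norm_ge0.
have [|r rS _] := wot_ulim UU _ Sb; first by rewrite invr_ge0 subr_ge0 ltW.
have SN n : N (S n).
  rewrite /S; elim/big_rec: _ => [|i u _ hu]; first exact: vna0.
  by apply: vnaD => //; exact: vnaX.
have Nr : N r := wot_closed_ulim UU (vna_wot hN) SN rS.
have bsmall x y e : 0 < e -> U [set n | normc <| (b ^+ n) x, y |> < e].
  move=> e0.
  have : (fun n => c ^+ n * (ell2_norm x * ell2_norm y)) @ \oo --> 0 * (ell2_norm x * ell2_norm y).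
    by apply: cvgM; [apply: cvg_expr; rewrite ger0_norm | exact: cvg_cst].
  rewrite mul0r => /cvgrPdist_lt/(_ _ e0)[n0 _ hn0].
  apply: (filterS _ (Uoo n0)) => n /= hn.
  apply: (le_lt_trans (cauchy_schwarz _ _)).
  have := hn0 n hn; rewrite /= sub0r normrN ger0_norm; last first.
    by rewrite !mulr_ge0 ?exprn_ge0 ?ell2_norm_ge0.
  by apply: le_lt_trans; rewrite mulrA; apply: ler_wpM2r (bn n x); exact: ell2_norm_ge0.
have near_cst (l : R[i]) (z : nat -> R[i]) :
    (forall e, 0 < e -> U [set n | normc (z n) < e]) -> uconv U (fun n => l - z n) l.
  move=> hz; apply: (uconv_close UU (uconv_cst UU _)) => e e0.
  by apply: filterS (hz _ e0) => n /=; rewrite opprB addrC subrK.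
exists r; split=> //; apply: bop_eqP => x; apply: inner_eqP => y.
- apply: (@uconv_unique R U UU (fun n => <| (1 - b) (S n x), y |>)).
    rewrite bop_mulE adj_l; under eq_fun do rewrite adj_l.
    exact: rS.
  have -> : (fun n => <| (1 - b) (S n x), y |>) = (fun n => <| x, y |> - <| (b ^+ n) x, y |>).
    apply/funext => n; rewrite -innerBl -bop_mulE.
    have -> : (1 - b) * S n = 1 - b ^+ n by rewrite -opprB mulNr -subrX1 opprB.
    by rewrite bop_addE bop_oppE.
  exact: (near_cst <| x, y |> (fun n => <| (b ^+ n) x, y |>) (bsmall x y)).
- apply: (@uconv_unique R U UU (fun n => <| S n ((1 - b) x), y |>)).
    by rewrite bop_mulE; exact: rS.
  have -> : (fun n => <| S n ((1 - b) x), y |>) = (fun n => <| x, y |> - <| (b ^+ n) x, y |>).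
    apply/funext => n; rewrite -innerBl -bop_mulE.
    have -> : S n * (1 - b) = 1 - b ^+ n.
      have cSb : S n * b = b * S n.
        by rewrite /S mulr_sumr mulr_suml; apply: eq_bigr => i _; rewrite -exprS -exprSr.
      rewrite mulrBr mulr1 cSb -[X in X - _]mul1r -mulrBl.
      by rewrite -opprB mulNr -subrX1 opprB.
    by rewrite bop_addE bop_oppE.
  exact: (near_cst <| x, y |> (fun n => <| (b ^+ n) x, y |>) (bsmall x y)).
Qed.

Lemma comm_inv (T A r : B) : A * r = 1 -> r * A = 1 -> T * r = r * T -> T * A = A * T.
Proof.
by move=> Ar rA Tr; rewrite -[in RHS](mulr1 T) -rA (mulrA T) Tr !mulrA Ar mul1r.
Qed.

Lemma inv_comm (T A r : B) : A * r = 1 -> r * A = 1 -> T * A = A * T -> T * r = r * T.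
Proof.
by move=> Ar rA TA; rewrite -[in RHS](mulr1 T) -Ar (mulrA T) TA !mulrA rA mul1r.
Qed.

Lemma commute_selfadjoint (T a : B) (c : R) : N a -> adj a = a -> 0 <= c -> c < 1 ->
  (forall x, ell2_norm (a x) <= c * ell2_norm x) ->
  (forall v, N v -> unitary v -> T * v = v * T) -> T * a = a * T.
Proof.
move=> Na aa c0 c1 ac hT.
pose b : B := 'i%C *: a.
have ab : adj b = - b.
  by rewrite /b adjZ aa -scaleNr; congr (_ *: _); apply/eqP; rewrite eq_complex /= oppr0 !eqxx.
have bc x : ell2_norm (b x) <= c * ell2_norm x.
  rewrite /b bop_scaleE normZ (_ : normc 'i%C = 1) ?mul1r//.
  by rewrite /normc expr0n add0r expr1n sqrtr1.
have [r [Nr Ar rA]] := neumann (vnaZ _ Na) c0 c1 bc.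
have Ar' : (1 + b) * adj r = 1.
  by move/(congr1 (@adj R J)): rA; rewrite adjM adj1 adjD adjN adj1 ab opprK.
have rA' : adj r * (1 + b) = 1.
  by move/(congr1 (@adj R J)): Ar; rewrite adjM adj1 adjD adjN adj1 ab opprK.
have cA : (1 - b) * (1 + b) = (1 + b) * (1 - b).
  apply: commrD; first exact: commr1.
  by apply: commr_sym; apply: commrB; [exact: commr1 | exact: commr_refl].
have cr : r * adj r = adj r * r.
  apply: (inv_comm Ar' rA'); apply/esym/(inv_comm Ar rA); exact/esym.
pose v := (1 + b) * r.
have va : adj v = adj r * (1 - b) by rewrite adjM adjD adj1 ab.
have Nv : N v.
  by apply: (vna_mul hN) => //; apply: vnaD; [exact: (vna_one hN) | exact: vnaZ].
have uv : unitary v.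
  split; rewrite va /v.
    by rewrite mulrA -(mulrA _ r) cr mulrA Ar' mul1r.
  by rewrite mulrA -(mulrA (adj r)) cA mulrA rA' mul1r.
(* Since (1 + b) + (1 - b) = 2, the inverse r is affine in the unitary v; whatever commutes with v
   then commutes with r, with 1 - b and with a. *)
have rv : r = 2^-1 *: (v + 1).
  rewrite /v -[X in _ + X]Ar -mulrDl addrACA subrr addr0 mulrDl mul1r.
  by rewrite halfD.
have Tb : T * (1 - b) = (1 - b) * T.
  apply: (comm_inv Ar rA); rewrite rv bop_scaleAl bop_scaleAr.
  by rewrite mulrDr mulrDl mulr1 mul1r hT.
have {}Tb : T * b = b * T.
  by move: Tb; rewrite mulrBr mulrBl mulr1 mul1r => /addrI/oppr_inj.
have -> : a = (- 'i%C) *: b.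
  by rewrite /b scalerA mulNr -expr2 sqr_i opprK scale1r.
by rewrite bop_scaleAl bop_scaleAr Tb.
Qed.

Lemma commute_unitaries (T : B) :
  (forall v, N v -> unitary v -> T * v = v * T) -> commutant N T.
Proof.
move=> hT a Na; have [M M0 aM] := bop_bound a.
have aM' := norm_adj M0 aM.
have D0 : 0 < 2 * (M + 1) by rewrite mulr_gt0// ltr_pwDr.
(* The selfadjoint operators built from a and its adjoint have norm at most 2M; after scaling by t
   the bound is M / (M + 1), below the radius 1 required by the Neumann series. *)
pose t : R[i] := ((2 * (M + 1))^-1)%:C%C.
have tn : normc t = (2 * (M + 1))^-1 by rewrite normc_real ger0_norm ?invr_ge0 ?ltW.
have tJ : t^* = t by apply/eqP; rewrite eq_complex /= oppr0 !eqxx.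
have t0 : t != 0.
  by apply/negP => /eqP t0; move: tn; rewrite t0 normc0 => /esym/eqP;
    rewrite invr_eq0 gt_eqF.
have c1 : M / (M + 1) < 1 by rewrite ltr_pdivrMr ?mul1r ?ltrDl// ltr_pwDr.
have c0 : 0 <= M / (M + 1) by rewrite divr_ge0// addr_ge0.
have bd (w : B) : (forall x, ell2_norm (w x) <= 2 * M * ell2_norm x) ->
   forall x, ell2_norm ((t *: w) x) <= M / (M + 1) * ell2_norm x.
  move=> h x; rewrite bop_scaleE normZ tn.
  apply: (le_trans (ler_wpM2l _ (h x))); first by rewrite invr_ge0 ltW.
  rewrite mulrA ler_wpM2r ?ell2_norm_ge0//.
  rewrite (_ : (2 * (M + 1))^-1 * (2 * M) = M / (M + 1))//.
  by field; rewrite gt_eqF// ltr_pwDr.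
have h1 : T * (a + adj a) = (a + adj a) * T.
  apply: (@scalerI _ _ t t0); rewrite -bop_scaleAr -bop_scaleAl.
  apply: (commute_selfadjoint _ _ c0 c1) => //.
  - by apply: vnaZ; apply: vnaD => //; exact: vnaA.
  - by rewrite adjZ tJ adjD adjK addrC.
  - apply: bd => x; rewrite bop_addE (le_trans (ler_norm2D _ _))//.
    have := aM x; have := aM' x; lra.
have h2 : T * ('i%C *: (a - adj a)) = ('i%C *: (a - adj a)) * T.
  apply: (@scalerI _ _ t t0); rewrite -bop_scaleAr -bop_scaleAl.
  apply: (commute_selfadjoint _ _ c0 c1) => //.
  - by apply: vnaZ; apply: vnaZ; apply: vnaB => //; exact: vnaA.
  - rewrite !adjZ tJ adjD adjN adjK; congr (_ *: _).
    rewrite -[RHS]opprK -scalerN opprB -scaleNr; congr (_ *: _).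
    by apply/eqP; rewrite eq_complex /= oppr0 !eqxx.
  - apply: bd => x; rewrite bop_scaleE normZ (_ : normc 'i%C = 1) ?mul1r; last first.
      by rewrite /normc expr0n add0r expr1n sqrtr1.
    rewrite bop_addE bop_oppE (le_trans (ler_norm2B _ _))//.
    have := aM x; have := aM' x; lra.
have -> : a = 2^-1 *: ((a + adj a) + (- 'i%C) *: ('i%C *: (a - adj a))).
  rewrite scalerA mulNr -expr2 sqr_i opprK scale1r addrACA subrr addr0.
  by rewrite halfD.
by rewrite bop_scaleAl bop_scaleAr mulrDr mulrDl h1 (bop_scaleAr (- 'i%C)) (bop_scaleAl (- 'i%C)) h2.
Qed.

End Cayley.
End VonNeumann.

(** * Conditional expectation onto a relative commutant *)

Lemma normc_half (R : realType) : normc (2^-1 : R[i]) = 2^-1.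
Proof. by rewrite normcV (normcMn 1 2) normc1. Qed.

(** The arithmetic of the two triangle inequalities in [conditional_expectation]. Already 36 would
    do in place of 100. *)
Lemma square_bound (R : realFieldType) (a b c c' w : R) :
  0 <= a -> 0 <= b -> 0 <= c -> c <= a + c' -> c' <= b + a ->
  a ^+ 2 <= 4 * w -> b ^+ 2 <= 4 * w -> c ^+ 2 <= 100 * w.
Proof.
move=> a0 b0 c0 t1 t2 aw bw.
have : c ^+ 2 <= (2 * a + b) ^+ 2 by rewrite ler_sqr ?nnegrE//; lra.
have := sqr_ge0 (a - b).
have -> : (a - b) ^+ 2 = a ^+ 2 - 2 * (a * b) + b ^+ 2 by ring.
have -> : (2 * a + b) ^+ 2 = 4 * a ^+ 2 + 4 * (a * b) + b ^+ 2 by ring.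
have := sqr_ge0 a; lra.
Qed.

Section ConditionalExpectation.
Variables (R : realType) (G : groupType) (N : set (bop R G)).
Hypothesis hN : von_neumann_algebra N.
Local Notation LG := (group_vna R G).
Hypothesis NLG : N `<=` LG.
Variables (U : set_system nat).
Hypothesis UU : UltraFilter U.
Hypothesis Uoo : forall n, U [set m | (n <= m)%N].
#[local] Existing Instance UU.
Local Notation H := (ell2 R G).
Local Notation B := (bop R G).
Local Notation d1 := (@delta R G 1%g).
Local Notation Q := (commutant N `&` LG).
Implicit Types (T v y z q : B).

Lemma relcomm_adj q : Q q -> Q (adj q).
Proof.
move=> [qN qL]; split; last exact: group_vna_adj.
move=> S NS; have := qN (adj S) (vnaA hN NS) => /(congr1 (@adj R G)).
by rewrite !adjM adjK.
Qed.

Lemma relcomm_lin a q q' : Q q -> Q q' -> Q (a *: q + q').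
Proof.
move=> [qN qL] [q'N q'L]; split; last exact: group_vna_lin.
by move=> S NS; rewrite mulrDl mulrDr bop_scaleAl bop_scaleAr (qN _ NS) (q'N _ NS).
Qed.

(** Midpoints replace general convex combinations: they are all that the parallelogram law asks for,
    and every property of the hull is an induction on two rules. *)
Inductive unitary_hull (T : B) : B -> Prop :=
| unitary_hull_refl : unitary_hull T T
| unitary_hull_conj y v : unitary_hull T y -> N v -> unitary v ->
    unitary_hull T (v * y * adj v)
| unitary_hull_mid y z : unitary_hull T y -> unitary_hull T z ->
    unitary_hull T (2^-1 *: (y + z)).

Lemma unitary_hull_group_vna T y : LG T -> unitary_hull T y -> LG y.
Proof.
move=> hT; elim=> [//|{}y v _ hy /NLG hv _|{}y z _ hy _ hz].
  by apply: group_vnaM; [exact: group_vnaM | exact: group_vna_adj].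
by apply: group_vnaZ; exact: group_vnaD.
Qed.

Lemma unitary_isometry v x : unitary v -> ell2_norm (v x) = ell2_norm x.
Proof. by move=> [_ h]; exact: isometry_of_adj. Qed.

Lemma unitary_adj v : unitary v -> unitary (adj v).
Proof. by move=> [h1 h2]; split; rewrite adjK. Qed.

Lemma unitary_hull_norm T y (M : R) : (forall x, ell2_norm (T x) <= M * ell2_norm x) ->
  unitary_hull T y -> forall x, ell2_norm (y x) <= M * ell2_norm x.
Proof.
move=> hT; elim=> [//|{}y v _ hy _ uv|{}y z _ hy _ hz] x.
  rewrite !bop_mulE unitary_isometry// (le_trans (hy _))//.
  by rewrite unitary_isometry//; exact: unitary_adj.
rewrite bop_scaleE normZ bop_addE.
rewrite normc_half; have := ler_norm2D (y x) (z x); have := hy x; have := hz x.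
lra.
Qed.

Lemma unitary_hull_inner T y q : LG T -> unitary_hull T y -> Q q ->
  <| y d1, q d1 |> = <| T d1, q d1 |>.
Proof.
move=> hT hy hq; have [aN aL] := relcomm_adj hq.
elim: hy => [//|{}y v hy IH Nv uv|{}y z hy IHy hz IHz].
  have yL := unitary_hull_group_vna hT hy.
  have vL := NLG Nv; have avL := group_vna_adj vL.
  rewrite -IH -[q]adjK -!adj_l -!bop_mulE.
  rewrite (_ : adj q * (v * y * adj v) = (adj q * v * y) * adj v); last by rewrite !mulrA.
  rewrite bop_mulE trace_comm//; last by apply: group_vnaM => //; exact: group_vnaM.
  rewrite -bop_mulE (aN _ Nv) !mulrA (proj2 uv) mul1r//.
rewrite bop_scaleE bop_addE innerZ innerD IHy IHz.
by rewrite mulrDr !(mulrC 2^-1) -splitr.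
Qed.

(** Weak lower semicontinuity of the norm, obtained by pairing the sequence with its own limit w. *)
Lemma norm_weak_limit (z : nat -> H) (w : H) (C : R) : 0 <= C ->
  (forall x, uconv U (fun n => <| z n, x |>) <| w, x |>) ->
  U [set n | ell2_norm (z n) <= C] -> ell2_norm w <= C.
Proof.
move=> C0 zw hC; have := ell2_norm_ge0 w; rewrite le_eqVlt => /predU1P[<-//|w0].
rewrite -(ler_pM2r w0) -expr2; apply/ler_addgt0Pr => e e0.
have h : U ([set n | ell2_norm (z n) <= C] `&` [set n | normc (<| z n, w |> - <| w, w |>) < e]).
  by apply: filterI => //; exact: zw.
have [n [/= h1 h2]] := filter_ex h.
have h3 := cauchy_schwarz (z n) w.
have h4 : normc <| w, w |> = ell2_norm w ^+ 2.
  by rewrite inner_norm normc_real ger0_norm ?sqr_ge0.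
have h5 : ell2_norm w ^+ 2 <= normc <| z n, w |> + normc (<| z n, w |> - <| w, w |>).
  have := le_normcD <| z n, w |> (- (<| z n, w |> - <| w, w |>)).
  by rewrite normcN opprB addrC subrK h4.
have h6 : ell2_norm (z n) * ell2_norm w <= C * ell2_norm w by apply: ler_wpM2r => //; exact: ltW.
lra.
Qed.

Lemma small_seq_eq0 (x : R) : 0 <= x -> (forall n, x ^+ 2 <= 100 / n.+1%:R) -> x = 0.
Proof.
move=> x0 h; apply/eqP; rewrite -sqrf_eq0; apply/eqP.
apply/eqP; rewrite eq_le sqr_ge0 andbT leNgt; apply/negP => xp.
have := archi_boundP (divr_ge0 (ler0n R 100) (ltW xp)).
set n := Num.bound _ => hn; have := h n.
rewrite ler_pdivlMr ?ltr0n// leNgt => /negP; apply.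
rewrite ltr_pdivrMr// in hn; apply: (lt_le_trans hn).
by rewrite mulrC; apply: ler_wpM2l; [exact: ltW | rewrite ler_nat].
Qed.

(* The trace-preserving expectation of T onto Q, as the element of least
   2-norm in the closed hull of the unitary conjugates of T. *)
Lemma conditional_expectation T : LG T -> exists y,
  [/\ Q y, forall M, (forall x, ell2_norm (T x) <= M * ell2_norm x) ->
           forall x, ell2_norm (y x) <= M * ell2_norm x &
      forall q, Q q -> <| y d1, q d1 |> = <| T d1, q d1 |>].
Proof.
move=> hT; have [M M0 TM] := bop_bound T.
pose A : set R := [set ell2_norm (y d1) ^+ 2 | y in unitary_hull T].
have A0 : A !=set0 by exists (ell2_norm (T d1) ^+ 2); exists T => //; exact: unitary_hull_refl.
have Alb : has_inf A by split=> //; exists 0 => _ [y _ <-]; rewrite sqr_ge0.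
pose d := inf A.
have dle y : unitary_hull T y -> d <= ell2_norm (y d1) ^+ 2.
  by move=> hy; apply: ge_inf; [case: Alb | exists y].
have ex n : exists y, unitary_hull T y /\ ell2_norm (y d1) ^+ 2 < d + n.+1%:R^-1.
  have [|_ [y hy <-] h] := @inf_adherent _ A (n.+1%:R^-1) _ Alb; first by rewrite invr_gt0.
  by exists y.
pose y n := projT1 (cid (ex n)).
have yh n : unitary_hull T (y n) := (projT2 (cid (ex n))).1.
have yd n : ell2_norm (y n d1) ^+ 2 < d + n.+1%:R^-1 := (projT2 (cid (ex n))).2.
have yL n := unitary_hull_group_vna hT (yh n).
(* Two almost minimal elements are close: their midpoint is in the hull, so its norm is at least the
   infimum, and the parallelogram law bounds the difference. *)
have par z z' (e : R) : unitary_hull T z -> unitary_hull T z' ->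
    ell2_norm (z d1) ^+ 2 <= d + e -> ell2_norm (z' d1) ^+ 2 <= d + e ->
    ell2_norm (z d1 - z' d1) ^+ 2 <= 4 * e.
  move=> hz hz' ez ez'.
  have := dle _ (unitary_hull_mid hz hz').
  have -> : ell2_norm ((2^-1 *: (z + z')) d1) = 2^-1 * ell2_norm (z d1 + z' d1).
    by rewrite -normc_half -normZ.
  rewrite (parallelogram (z d1) (z' d1)); move: (ell2_norm (z d1 + z' d1)) => p.
  have -> : (2^-1 * p) ^+ 2 = p ^+ 2 / 4 by field.
  lra.
have yc n m : (n <= m)%N -> ell2_norm (y m d1 - y n d1) ^+ 2 <= 4 / n.+1%:R.
  move=> nm; apply: par => //; last exact/ltW.
  by apply: (le_trans (ltW (yd m))); rewrite lerD2l lef_pV2 ?posrE// ler_nat.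
have yM n := unitary_hull_norm TM (yh n).
have [Y yY YM] := wot_ulim UU M0 yM.
have YL : LG Y.
  apply/group_vnaP => g x; apply: inner_eqP => w.
  apply: (uconv_unique UU (yY _ _)).
  under eq_fun do rewrite (group_vna_rho (yL _)) adj_l.
  by rewrite adj_l; exact: yY.
have Yn n : ell2_norm (Y d1 - y n d1) ^+ 2 <= 4 / n.+1%:R.
  have c0 : 0 <= 4 / n.+1%:R :> R by rewrite divr_ge0.
  rewrite -[leRHS](sqr_sqrtr c0) ler_sqr ?nnegrE ?ell2_norm_ge0 ?sqrtr_ge0//.
  apply: (@norm_weak_limit (fun m => y m d1 - y n d1)); first exact: sqrtr_ge0.
    move=> x; under eq_fun do rewrite innerBl.
    by rewrite innerBl; apply: uconvD => //; exact: uconv_cst.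
  apply: filterS (Uoo n) => m /= nm.
  by rewrite -ler_sqr ?nnegrE ?ell2_norm_ge0 ?sqrtr_ge0// (sqr_sqrtr c0) yc.
(* Conjugation by v preserves the 2-norm, so the conjugate of [y n] is again almost minimal and
   hence close to [y n]; both are within the same distance of the conjugate of Y and of Y. *)
have conjY v : N v -> unitary v -> v * Y * adj v = Y.
  move=> Nv uv; have vL := NLG Nv; have avL := group_vna_adj vL.
  have cL z : LG z -> LG (v * z * adj v) by move=> hz; do 2?apply: group_vnaM.
  apply: (separating (cL _ YL) YL); apply/eqP; rewrite -subr_eq0; apply/eqP.
  apply: norm0_eq0; apply: small_seq_eq0 => [|n]; first exact: ell2_norm_ge0.
  have e1 : ell2_norm ((v * Y * adj v) d1 - (v * y n * adj v) d1) = ell2_norm (Y d1 - y n d1).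
    rewrite !bop_mulE -bopB unitary_isometry//.
    have := norm_trace_unitary 1%g (group_vnaB YL (yL n)) avL.
    by rewrite adjK => /(_ (proj2 uv)).
  have e2 : ell2_norm ((v * y n * adj v) d1 - y n d1) ^+ 2 <= 4 / n.+1%:R.
    have yv := norm_trace_unitary 1%g (yL n) avL.
    apply: par => //; first exact: unitary_hull_conj; last exact/ltW.
    rewrite !bop_mulE unitary_isometry// yv ?adjK; first exact/ltW.
    exact: (proj2 uv).
  have e3 := Yn n.
  have t1 := ler_dist2D ((v * Y * adj v) d1) (Y d1) ((v * y n * adj v) d1).
  have t2 := ler_dist2D ((v * y n * adj v) d1) (Y d1) (y n d1).
  rewrite e1 in t1; rewrite (normBC (y n d1)) in t2.
  exact: (square_bound (ell2_norm_ge0 _) (ell2_norm_ge0 _) (ell2_norm_ge0 _) t1 t2 e3 e2).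
have YN : commutant N Y.
  apply: (commute_unitaries hN UU Uoo) => v Nv uv.
  by rewrite -[in LHS](conjY v Nv uv) -!mulrA (proj2 uv) mulr1.
exists Y; split=> [//|M' TM'|q hq].
  have M'0 : 0 <= M'.
    have := TM' d1; rewrite norm_delta mulr1; apply: le_trans; exact: ell2_norm_ge0.
  move=> x; apply: (@norm_weak_limit (fun n => y n x)).
  - by rewrite mulr_ge0 ?ell2_norm_ge0.
  - by move=> w; exact: yY.
  - by apply: (filterS _ filterT) => n _ /=; exact: unitary_hull_norm.
apply: (uconv_unique UU (yY _ _)).
under eq_fun do rewrite (unitary_hull_inner hT (yh _) hq).
exact: uconv_cst.
Qed.

Lemma relcomm_separating y z : Q y -> Q z ->
  (forall q, Q q -> <| y d1, q d1 |> = <| z d1, q d1 |>) -> y = z.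
Proof.
move=> hy hz h; apply: separating; [exact: hy.2 | exact: hz.2 |].
apply/eqP; rewrite -subr_eq0; apply/eqP; apply: norm0_eq0; apply/eqP.
rewrite -sqrf_eq0 ell2_norm_sq.
have hq : Q (-1 *: z + y) by exact: relcomm_lin.
have -> : y d1 - z d1 = (-1 *: z + y) d1 by rewrite bop_addE bop_scaleE scaleN1r addrC.
by rewrite {1}bop_addE bop_scaleE scaleN1r innerD innerNl h// addNr.
Qed.

End ConditionalExpectation.

(** * Symmetries of a diffuse algebra tending weakly to zero *)

Section Diffuse.
Variables (R : realType) (G : groupType) (N : set (bop R G)).
Hypothesis hN : von_neumann_algebra N.
Local Notation LG := (group_vna R G).
Hypothesis NLG : N `<=` LG.
Hypothesis dN : diffuse N.
Local Notation H := (ell2 R G).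
Local Notation B := (bop R G).
Local Notation d1 := (@delta R G 1%g).
Local Notation Re := (@complex.Re R).
Implicit Types (p q r u v : B).

(** On a projection this is the canonical trace. *)
Definition sqtr p : R := ell2_norm (p d1) ^+ 2.

Definition subprojection r q := [/\ N q, projection q & r * q = q].

Lemma adj0 : adj (0 : B) = 0.
Proof. by apply: adjE => x y; rewrite !bop_zeroE inner0l inner0r. Qed.

Lemma projection0 : projection (0 : B).
Proof. by apply/projP; split; [rewrite mul0r | exact: adj0]. Qed.

Lemma projection1 : projection (1 : B).
Proof. by apply/projP; split; [rewrite mul1r | exact: adj1]. Qed.

Lemma subproj_comm r q : projection r -> projection q -> r * q = q -> q * r = q.
Proof.
by move=> /projP[_ ra] /projP[_ qa] /(congr1 (@adj R G)); rewrite adjM ra qa.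
Qed.

Lemma subprojB r q : projection r -> projection q -> r * q = q ->
  projection (r - q) /\ sqtr r = sqtr q + sqtr (r - q).
Proof.
move=> hr hq rq; have qr := subproj_comm hr hq rq.
have [rr ra] := (projP r).1 hr; have [qq qa] := (projP q).1 hq.
split.
  apply/projP; split; last by rewrite adjD adjN ra qa.
  by rewrite mulrBl !mulrBr rr rq qr qq subrr subr0.
have -> : sqtr r = ell2_norm (q d1 + (r - q) d1) ^+ 2.
  by rewrite -bop_addE addrC subrK.
rewrite normD_sq (_ : <| q d1, (r - q) d1 |> = 0) ?mulr0 ?addr0//.
by rewrite adj_l qa -bop_mulE mulrBr qr qq subrr bop_zeroE inner0r.
Qed.

Lemma sqtr_ge0 p : 0 <= sqtr p. Proof. exact: sqr_ge0. Qed.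

Lemma sqtr_gt0 p : N p -> p <> 0 -> 0 < sqtr p.
Proof.
move=> Np p0; rewrite lt_neqAle sqtr_ge0 andbT eq_sym; apply/negP => /eqP h; apply: p0.
apply: (separating (NLG Np)); first exact: group_vna0.
by rewrite bop_zeroE; apply: norm0_eq0; apply/eqP; rewrite -sqrf_eq0; exact/eqP.
Qed.

Lemma sqtr1 : sqtr 1 = 1.
Proof. by rewrite /sqtr bop_oneE norm_delta expr1n. Qed.

(** A projection that is not minimal splits into two nonzero pieces whose traces add up; the smaller
    one has at most half. *)
Lemma subprojection_half r : N r -> projection r -> r <> 0 ->
  exists q, [/\ subprojection r q, q <> 0 & sqtr q <= sqtr r / 2].
Proof.
move=> Nr hr r0.
have [q [Nq hq rq q0 qr]] : exists q, [/\ N q, projection q, r * q = q, q <> 0 & q <> r].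
  apply: contrapT => h; apply: (dN (p := r)); split=> // q Nq hq rq.
  have [->|q0] := pselect (q = 0); first by left.
  by right; apply: contrapT => qr; apply: h; exists q.
have [hrq tq] := subprojB hr hq rq.
have [le|lt] := leP (sqtr q) (sqtr r / 2); first by exists q; split.
exists (r - q); split.
- split=> //; first exact: vnaB.
  by rewrite mulrBr rq ((projP r).1 hr).1.
- by move=> /eqP; rewrite subr_eq0 eq_sym => /eqP.
- by move: tq lt; lra.
Qed.

Lemma subprojection_small r (e : R) : N r -> projection r -> r <> 0 -> 0 < e ->
  exists q, [/\ subprojection r q, q <> 0 & sqtr q <= e].
Proof.
move=> Nr hr r0 e0.
have key n : exists q, [/\ subprojection r q, q <> 0 & sqtr q <= sqtr r / 2 ^+ n].
  elim: n => [|n [q [[Nq hq rq] q0 tq]]].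
    by exists r; split=> //; [split=> //; exact: ((projP r).1 hr).1 | rewrite expr0 divr1].
  have [q' [[Nq' hq' qq'] q'0 tq']] := subprojection_half Nq hq q0.
  exists q'; split=> //; first by split=> //; rewrite -qq' mulrA rq.
  apply: (le_trans tq'); rewrite exprSr invfM mulrA.
  by rewrite ler_wpM2r.
have [n hn] : exists n, sqtr r / 2 ^+ n <= e.
  exists (Num.bound (sqtr r / e)).
  have := archi_boundP (divr_ge0 (sqtr_ge0 r) (ltW e0)).
  set n := Num.bound _ => hb; rewrite ler_pdivrMr ?exprn_gt0//.
  rewrite ltr_pdivrMr// in hb; apply: (le_trans (ltW hb)); rewrite mulrC.
  apply: ler_wpM2l; first exact: ltW.
  by rewrite -natrX ler_nat ltnW// ltn_expl.
have [q [h1 h2 h3]] := key n; exists q; split=> //; exact: le_trans hn.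
Qed.

Lemma normcD_sq (z w : R[i]) :
  normc (z + w) ^+ 2 = normc z ^+ 2 + normc w ^+ 2 + 2 * Re (z * w^*).
Proof. by rewrite !normcE2; case: z w => a b [c d] /=; ring. Qed.

Lemma ler_sum_const (I : Type) (s : seq I) (f : I -> R) (c : R) :
  (forall i, f i <= c) -> \sum_(i <- s) f i <= (size s)%:R * c.
Proof.
move=> h; elim: s => [|i s IH]; first by rewrite big_nil mul0r.
by rewrite big_cons /= -natr1 mulrDl mul1r addrC lerD.
Qed.

Variables (F : seq G) (e : R).
Hypothesis e0 : 0 < e.

(** A symmetry of the corner cut out by 1 - r, with coefficients on F small in proportion to the
    trace of that corner. It is extended piece by piece until r = 0. *)
Let partial_symmetry r := exists v, [/\ N v, adj v = v, v * v = 1 - r, v * r = 0 &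
  \sum_(g <- F) normc (v d1 g) ^+ 2 <= (size F)%:R * e * (1 - sqtr r)].

(** The coefficient is the inner product of the images under q of two point masses, both of squared
    norm [sqtr q]. Its square is thus at most e times the trace when the trace is at most e, which
    is the proportionality asked of a partial symmetry. *)
Lemma proj_coef q g : N q -> projection q -> normc (q d1 g) <= sqtr q.
Proof.
move=> Nq /projP[qq qa]; rewrite -inner_delta -{1}qq bop_mulE adj_l qa.
apply: (le_trans (cauchy_schwarz _ _)).
by rewrite (delta_rho R g) (group_vna_rho (NLG Nq)) norm_rho.
Qed.

(* The sign of q is chosen so that the cross term does not increase the sum. *)
Lemma partial_symmetry_step r q : projection r -> partial_symmetry r ->
  subprojection r q -> sqtr q <= e -> partial_symmetry (r - q).
Proof.
move=> hr [v [Nv va vv vr vF]] [Nq hq rq] qe.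
have qr := subproj_comm hr hq rq.
have [qq qa] := (projP q).1 hq.
have vq : v * q = 0 by rewrite -rq mulrA vr mul0r.
have qv : q * v = 0.
  by move/(congr1 (@adj R G)): vq; rewrite adjM va qa => ->; exact: adj0.
have [_ tq] := subprojB hr hq rq.
pose c := \sum_(g <- F) Re (v d1 g * (q d1 g)^*).
have [s [ss sJ sc]] : exists s : R[i], [/\ s * s = 1, s^* = s &
    \sum_(g <- F) Re (v d1 g * (s * q d1 g)^*) <= 0].
  have [c0|c0] := leP c 0.
    exists 1; split; rewrite ?mul1r ?conjC1//.
    by under eq_bigr do rewrite mul1r.
  exists (-1); split; rewrite ?mulrNN ?mul1r ?rmorphN1//.
  have -> : \sum_(g <- F) Re (v d1 g * (-1 * q d1 g)^*) = - c.
    rewrite /c -sumrN; apply: eq_bigr => g _.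
    by rewrite mulN1r; case: (v d1 g) (q d1 g) => a b [a' b'] /=; ring.
  by rewrite oppr_le0 ltW.
exists (v + s *: q); split.
- by apply: vnaD => //; exact: vnaZ.
- by rewrite adjD adjZ va qa sJ.
- rewrite mulrDl !mulrDr bop_scaleAl !bop_scaleAr !bop_scaleAl vv vq qv qq scalerA ss scale1r.
  by rewrite !scaler0 addr0 add0r opprB [RHS]addrCA [RHS]addrC.
- rewrite mulrBr !mulrDl bop_scaleAl vr vq bop_scaleAl qr qq.
  by rewrite !add0r subrr.
- have -> : \sum_(g <- F) normc ((v + s *: q) d1 g) ^+ 2 =
     \sum_(g <- F) normc (v d1 g) ^+ 2 + \sum_(g <- F) normc (q d1 g) ^+ 2 +
     2 * \sum_(g <- F) Re (v d1 g * (s * q d1 g)^*).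
    rewrite mulr_sumr -!big_split /=; apply: eq_bigr => g _.
    rewrite normcD_sq; congr (_ + _ + _).
    have s1 : normc s = 1.
      apply/eqP; rewrite -(@eqrXn2 _ 2) ?normc_ge0// expr1n; apply/eqP.
      by have := mulcJ s; rewrite sJ ss => /(congr1 (@complex.Re R)).
    by rewrite normcM s1 mul1r.
  have qF : \sum_(g <- F) normc (q d1 g) ^+ 2 <= (size F)%:R * e * sqtr q.
    rewrite -mulrA; apply: ler_sum_const => g.
    apply: (@le_trans _ _ (sqtr q ^+ 2)).
      by rewrite ler_sqr ?nnegrE ?normc_ge0 ?sqtr_ge0// proj_coef.
    by rewrite expr2 ler_wpM2r ?sqtr_ge0.
  have -> : (size F)%:R * e * (1 - sqtr (r - q)) =
     (size F)%:R * e * (1 - sqtr r) + (size F)%:R * e * sqtr q by rewrite tq; ring.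
  by move: vF qF sc; lra.
Qed.

Lemma partial_symmetry1 : partial_symmetry 1.
Proof.
exists 0; split.
- exact: vna0.
- exact: adj0.
- by rewrite mul0r subrr.
- by rewrite mul0r.
- rewrite sqtr1 subrr mulr0 big1// => g _.
  by rewrite bop_zeroE (_ : (0 : H) g = 0)// normc0 expr0n.
Qed.

(** The supremum of the admissible traces need not be attained, whence the factor 2; when it is 0
    the zero projection serves. *)
Lemma greedy_subprojection r : exists q, [/\ subprojection r q, sqtr q <= e &
  forall q', subprojection r q' -> sqtr q' <= e -> sqtr q' <= 2 * sqtr q].
Proof.
pose A : set R := [set sqtr q | q in [set q | subprojection r q /\ sqtr q <= e]].
have s00 : subprojection r 0 by split; [exact: vna0 | exact: projection0 | rewrite mulr0].
have t0 : sqtr 0 = 0 by rewrite /sqtr bop_zeroE ell2_norm0 expr0n.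
have A0 : A 0 by exists 0 => //; split=> //; rewrite t0 ltW.
have hA : has_sup A by split; [exists 0 | exists e => _ [q [_ ?] <-]].
have Aub q : subprojection r q -> sqtr q <= e -> sqtr q <= sup A.
  by move=> h1 h2; apply: sup_upper_bound => //; exists q.
have sA0 : 0 <= sup A by exact: sup_upper_bound.
move: sA0; rewrite le_eqVlt => /predU1P[sA|sA].
  exists 0; split=> [//||q' h1 h2]; first by rewrite t0 ltW.
  by rewrite t0 mulr0 sA; exact: Aub.
have [_ [q [h1 h2] <-] hq] := sup_adherent (divr_gt0 sA (ltr0n R 2)) hA.
exists q; split=> // q' h1' h2'; have := Aub _ h1' h2'; move: hq; lra.
Qed.

Variables (U : set_system nat).
Hypothesis UU : UltraFilter U.
Hypothesis Uoo : forall n, U [set m | (n <= m)%N].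
#[local] Existing Instance UU.

(** For fixed n the relation [P n * P m = P m] holds for all large m and passes to the limit Y; then
    [Y * Y] is the limit of [P n * Y = Y]. *)
Lemma decreasing_projections_limit (P : nat -> B) :
  (forall n, N (P n)) -> (forall n, projection (P n)) ->
  (forall n m, (n <= m)%N -> P n * P m = P m) ->
  exists Y, [/\ N Y, projection Y, forall n, P n * Y = Y &
    forall x y, uconv U (fun n => <| P n x, y |>) <| Y x, y |>].
Proof.
move=> NP hP dP.
have [|Y PY _] := wot_ulim UU (T := P) ler01.
  by move=> n x; rewrite mul1r; exact: proj_norm.
have PaE n : adj (P n) = P n := ((projP _).1 (hP n)).2.
have PYn n : P n * Y = Y.
  apply: bop_eqP => x; apply: inner_eqP => y; rewrite bop_mulE adj_l.
  apply: (uconv_unique UU (PY _ _)).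
  apply: (uconv_close UU (PY x y)) => d d0; apply: filterS (Uoo n) => m /= nm.
  by rewrite -adj_l -bop_mulE dP// subrr normc0.
exists Y; split=> //; first exact: (wot_closed_ulim UU (vna_wot hN) NP PY).
apply/projP; split.
  apply: bop_eqP => x; apply: inner_eqP => y; rewrite bop_mulE.
  apply: (uconv_unique UU (PY _ _)).
  by under eq_fun do rewrite -bop_mulE PYn; exact: uconv_cst.
apply: adjE => x y; rewrite [RHS]innerC; apply: (uconv_unique UU (PY x y)).
by under eq_fun do rewrite adj_l PaE innerC; apply: uconvJ; exact: PY.
Qed.

Lemma diffuse_small_symmetry : exists u, [/\ N u, adj u = u, u * u = 1 &
  \sum_(g <- F) normc (u d1 g) ^+ 2 <= (size F)%:R * e].
Proof.
pose qf r := projT1 (cid (greedy_subprojection r)).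
have qfP r : [/\ subprojection r (qf r), sqtr (qf r) <= e &
  forall q', subprojection r q' -> sqtr q' <= e -> sqtr q' <= 2 * sqtr (qf r)]
  := projT2 (cid (greedy_subprojection r)).
pose P n : B := iter n (fun r => r - qf r) 1.
have PS n : P n.+1 = P n - qf (P n) by [].
have NP n : N (P n).
  elim: n => [|n IH]; first exact: (vna_one hN).
  by rewrite PS; apply: vnaB => //; case: (qfP (P n)) => -[].
have hP n : projection (P n).
  elim: n => [|n IH]; first exact: projection1.
  by rewrite PS; case: (qfP (P n)) => -[_ hq rq] _ _; exact: (subprojB IH hq rq).1.
have sP n : partial_symmetry (P n).
  elim: n => [|n IH]; first exact: partial_symmetry1.
  by rewrite PS; case: (qfP (P n)) => h1 h2 _; exact: partial_symmetry_step.
have dP n m : (n <= m)%N -> P n * P m = P m.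
  elim: m => [|m IH]; first by rewrite leqn0 => /eqP ->; rewrite mul1r.
  rewrite leq_eqVlt => /predU1P[->|]; first exact: ((projP _).1 (hP _)).1.
  rewrite ltnS => /IH h; rewrite PS mulrBr h; congr (_ - _).
  by case: (qfP (P m)) => -[_ _ rq] _ _; rewrite -{1}rq mulrA h rq.
(* Otherwise the remainders decrease to a nonzero projection Y. A small nonzero q below Y is a
   candidate at every stage, so each greedy choice removes at least half its trace, and the total
   trace 1 is exceeded. *)
have [n hn] : exists n, sqtr (P n) <= e.
  apply: contrapT => hno; have big n : e < sqtr (P n).
    by rewrite ltNge; apply/negP => h; apply: hno; exists n.
  have [Y [NY hY PY Ylim]] := decreasing_projections_limit NP hP dP.
  have Y0 : Y <> 0.
    move=> Y0; have := Ylim d1 d1 _ e0; rewrite Y0 bop_zeroE inner0l.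
    move=> h; have [n /=] := filter_ex h.
    rewrite subr0 ltNge => /negP; apply.
    have [pp pa] := (projP _).1 (hP n).
    rewrite -pp bop_mulE adj_l pa inner_norm normc_real ger0_norm ?sqr_ge0//.
    exact/ltW/big.
  have [q [[Nq hq Yq] q0 qe]] := subprojection_small NY hY Y0 e0.
  have tq := sqtr_gt0 Nq q0.
  have dec n : sqtr (P n) <= 1 - n%:R * (sqtr q / 2).
    elim: n => [|n IH]; first by rewrite mul0r subr0 sqtr1.
    have [[Nn hqn rqn] _ /(_ q)] := qfP (P n).
    have sq : subprojection (P n) q by split=> //; rewrite -Yq mulrA PY.
    move=> /(_ sq qe) h; have := (subprojB (hP n) hqn rqn).2.
    rewrite -PS -natr1 mulrDl mul1r; move: IH h; lra.
  have q20 : 0 < sqtr q / 2 by rewrite divr_gt0.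
  have := archi_boundP (divr_ge0 (ler01 : 0 <= 1 :> R) (ltW q20)).
  set n := Num.bound _; rewrite ltr_pdivrMr// => hn.
  by have := dec n; have := sqtr_ge0 (P n); lra.
(* The remainder is now small enough to be taken whole as the last piece. *)
have := partial_symmetry_step (hP n) (sP n) (_ : subprojection (P n) (P n)) hn.
rewrite subrr => -[|u [Nu ua uu _ uF]].
  by split=> //; exact: ((projP _).1 (hP n)).1.
exists u; split=> //; first by rewrite uu subr0.
apply: (le_trans uF); rewrite -[leRHS]mulr1; apply: ler_wpM2l.
  by rewrite mulr_ge0// ltW.
by rewrite gerBl sqtr_ge0.
Qed.

End Diffuse.

Lemma diffuse_symmetry (R : realType) (G : groupType) (N : set (bop R G)) :
  von_neumann_algebra N -> N `<=` group_vna R G -> diffuse N ->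
  forall (F : seq G) (e : R), 0 < e -> exists u, [/\ N u, adj u = u, u * u = 1 &
    forall g, g \in F -> normc (u (delta R 1%g) g) <= e].
Proof.
move=> hN NLG dN F e e0; have [U UU Uoo] := nat_ultrafilter.
have s0 : 0 < (size F).+1%:R :> R by rewrite ltr0n.
have [u [Nu ua uu uF]] :=
  diffuse_small_symmetry hN NLG dN F (divr_gt0 (exprn_gt0 2 e0) s0) UU Uoo.
have e0' := ltW e0.
exists u; split=> // g gF; rewrite -ler_sqr ?nnegrE ?normc_ge0//.
apply: (@le_trans _ _ (\sum_(g <- F) normc (u (delta R 1%g) g) ^+ 2)).
  rewrite (big_rem g)//= lerDl; apply: sumr_ge0 => h _; exact: sqr_ge0.
apply: (le_trans uF); rewrite mulrCA; apply: ler_piMr; first by rewrite exprn_ge0// ltW.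
by rewrite ler_pdivrMr// mul1r ler_nat.
Qed.

(** * Amplifications *)

Lemma esum_pair (R : realType) (A C : choiceType) (f : A -> C -> \bar R) :
  (forall a c, (0 <= f a c)%E) ->
  (\esum_(p in [set: A * C]) f p.1 p.2 =
   \esum_(a in [set: A]) \esum_(c in [set: C]) f a c)%E.
Proof.
move=> f0; rewrite (@esum_esum _ _ _ setT (fun=> setT))//.
by congr esum; apply/seteqP; split.
Qed.

Lemma norm_fin_part (R : realType) (J : choiceType) (x : ell2 R J) (F : {fset J}) :
  ell2_norm (fin_part x F) <= ell2_norm x.
Proof.
rewrite -ler_sqr ?nnegrE ?ell2_norm_ge0// /fin_part norm_sum_delta.
exact: norm_sq_ge_sum.
Qed.

(** The norm is the supremum over finite parts, and on a finite set of coordinates a uniform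
    approximation is an approximation in norm. *)
Lemma norm_le_pointwise (R : realType) (J : choiceType) (x : ell2 R J) (C : R) :
  0 <= C ->
  (forall (A : {fset J}) (e : R), 0 < e -> exists2 y : ell2 R J, ell2_norm y <= C &
     forall q, normc (x q - y q) <= e) -> ell2_norm x <= C.
Proof.
move=> C0 h.
have key (A : {fset J}) : ell2_norm (fin_part x A) <= C.
  apply/ler_addgt0Pr => e e0; have s0 : 0 < (size A).+1%:R :> R by rewrite ltr0n.
  have [y yC xy] := h A _ (divr_gt0 e0 s0).
  have -> : fin_part x A = fin_part y A + fin_part (x - y) A.
    rewrite /fin_part -big_split; apply: eq_bigr => j _ /=.
    by rewrite -scalerDl addrC subrK.
  apply: (le_trans (ler_norm2D _ _)); apply: lerD.
    exact: (le_trans (norm_fin_part _ _)).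
  apply: (le_trans (ler_norm2_sum _ _)).
  apply: (@le_trans _ _ ((size A)%:R * (e / (size A).+1%:R))).
    by apply: ler_sum_const => j; rewrite normZ norm_delta mulr1; exact: xy.
  rewrite mulrCA; apply: ler_piMr; first exact: ltW.
  by rewrite ler_pdivrMr// mul1r ler_nat.
rewrite -ler_sqr ?nnegrE ?ell2_norm_ge0// -lee_fin ell2_normE.
apply: sqsum_le_fset => A; rewrite -norm_sum_delta ler_sqr ?nnegrE ?ell2_norm_ge0//.
exact: key.
Qed.

Lemma norm_le_sqsum (R : realType) (J J' : choiceType) (x : ell2 R J) (y : ell2 R J')
  (M : R) : 0 <= M -> (sqsum x <= (M ^+ 2)%:E * sqsum y)%E ->
  ell2_norm x <= M * ell2_norm y.
Proof.
move=> M0 h; rewrite -ler_sqr ?nnegrE ?mulr_ge0 ?ell2_norm_ge0//.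
by rewrite -lee_fin exprMn (EFinM (M ^+ 2)) !ell2_normE.
Qed.

Section Amplification.
Variables (R : realType) (K G : choiceType).
Local Notation H := (ell2 R G).
Local Notation W := (ell2 R (K * G)%type).
Implicit Types (z w : W) (T S : bop R G).

Lemma sqsum_pair (f : K * G -> R[i]) :
  sqsum f = (\esum_(k in [set: K]) sqsum (fun g => f (k, g)))%E.
Proof.
rewrite /sqsum -(@esum_pair _ _ _ (fun k g => (normc (f (k, g)) ^+ 2)%:E)).
  by apply: eq_esum => -[].
by move=> k g; rewrite lee_fin sqr_ge0.
Qed.

Lemma slice_summable z k : (fun g => z (k, g)) \in @square_summable R G.
Proof.
rewrite inE; apply: le_lt_trans (sqsum_lty z); rewrite sqsum_pair.
apply: ereal_sup_ubound; exists [set k]; first by split.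
by rewrite fsbig_set1.
Qed.

Definition slice z k : H := Ell2 (slice_summable z k).

Lemma sqsum_slice z : sqsum z = (\esum_(k in [set: K]) (ell2_norm (slice z k) ^+ 2)%:E)%E.
Proof. by rewrite sqsum_pair; apply: eq_esum => k _; rewrite ell2_normE. Qed.

Lemma amp_sqsum T z (M : R) : (forall x, ell2_norm (T x) <= M * ell2_norm x) ->
  (sqsum (fun p : K * G => T (slice z p.1) p.2) <= (M ^+ 2)%:E * sqsum z)%E.
Proof.
move=> hM; rewrite sqsum_pair [in leRHS]sqsum_slice -esumZ ?sqr_ge0//; last first.
  by move=> k; rewrite sqr_ge0.
apply: le_esum => k _ /=; rewrite -(ell2_normE (T (slice z k))) lee_fin -exprMn.
by rewrite ler_sqr ?nnegrE ?ell2_norm_ge0 ?(le_trans _ (hM _)) ?ell2_norm_ge0.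
Qed.

Lemma amp_summable T z : (fun p : K * G => T (slice z p.1) p.2) \in @square_summable R (K * G)%type.
Proof.
have [M M0 hM] := bop_bound T; rewrite inE; apply: (le_lt_trans (amp_sqsum z hM)).
by apply: lte_mul_pinfty; rewrite ?lee_fin ?sqr_ge0// sqsum_lty.
Qed.

(** The operator 1 tensor T on the tensor product of l2(K) and l2(G), applied slice by slice. *)
Definition amp T z : W := Ell2 (amp_summable T z).

Lemma ampE T z k g : amp T z (k, g) = T (slice z k) g. Proof. by []. Qed.

Lemma amp_norm T z (M : R) : 0 <= M -> (forall x, ell2_norm (T x) <= M * ell2_norm x) ->
  ell2_norm (amp T z) <= M * ell2_norm z.
Proof.
by move=> M0 hM; apply: norm_le_sqsum => //; exact: amp_sqsum.
Qed.

Lemma slice_lin a z w k : slice (a *: z + w) k = a *: slice z k + slice w k.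
Proof. exact: ell2P. Qed.

Lemma ampD T z w : amp T (z + w) = amp T z + amp T w.
Proof.
apply: ell2P => -[k g]; rewrite ampE -[z]scale1r slice_lin scale1r bopD.
by rewrite scale1r.
Qed.

Lemma ampZ T a z : amp T (a *: z) = a *: amp T z.
Proof.
apply: ell2P => -[k g]; rewrite ampE (_ : slice _ k = a *: slice z k) ?bopZ//.
exact: ell2P.
Qed.

Lemma ampB T z w : amp T (z - w) = amp T z - amp T w.
Proof. by rewrite ampD -scaleN1r ampZ scaleN1r. Qed.

Lemma amp_lin a S T z : amp (a *: S + T) z = a *: amp S z + amp T z.
Proof. exact: ell2P. Qed.

Variables (e e' : K -> K).
Hypotheses (eK : cancel e e') (e'K : cancel e' e).

Let e_bij : bijective (fun p : K * G => (e p.1, p.2)).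
Proof. by exists (fun p => (e' p.1, p.2)) => -[k g] /=; rewrite ?eK ?e'K. Qed.

Lemma shift_sqsum (f : K * G -> R[i]) : sqsum (fun p => f (e p.1, p.2)) = sqsum f.
Proof.
rewrite /sqsum [RHS](@reindex_esum R _ _ setT setT (fun p : K * G => (e p.1, p.2)))//.
split=> // [x y _ _|y _]; first exact: (bij_inj e_bij).
by exists (e' y.1, y.2) => //=; rewrite e'K; case: y.
Qed.

Lemma shift_summable z : (fun p : K * G => z (e p.1, p.2)) \in @square_summable R (K * G)%type.
Proof. by rewrite inE shift_sqsum; exact: sqsum_lty. Qed.

Definition shift z : W := Ell2 (shift_summable z).

Lemma norm_shift z : ell2_norm (shift z) = ell2_norm z.
Proof. by rewrite /ell2_norm shift_sqsum. Qed.

Lemma inner_shift z w : <| shift z, shift w |> = <| z, w |>.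
Proof. by rewrite /ell2_inner [RHS](reindex_csum _ e_bij). Qed.

Lemma amp_shift T z : amp T (shift z) = shift (amp T z).
Proof.
apply: ell2P => -[k g]; rewrite ampE (_ : slice (shift z) k = slice z (e k))//.
exact: ell2P.
Qed.

End Amplification.

(** * Maps from l2(G) to an amplification defined by an array *)

Section Field.
Variables (R : realType) (G : groupType) (I : choiceType).
Local Notation H := (ell2 R G).
Local Notation W := (ell2 R ((I * G) * G)%type).

(* The coordinate ((i, h), a) carries the value at (i, a, a h), so that an
   operator on the last coordinate moves along the G-orbit of (i, a, g). *)
Lemma sqsum_field (Z : I -> G -> G -> R[i]) :
  sqsum (fun q : (I * G) * G => Z q.1.1 q.2 (q.2 * q.1.2)%g) =
  (\esum_(g in [set: G]) \esum_(p in [set: I * G]) (normc (Z p.1 p.2 g) ^+ 2)%:E)%E.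
Proof.
rewrite -(@esum_pair _ _ _ (fun g p => (normc (Z p.1 p.2 g) ^+ 2)%:E)); last first.
  by move=> g p; rewrite lee_fin sqr_ge0.
rewrite /sqsum (@reindex_esum R (G * (I * G))%type _ setT setT
  (fun x => ((x.2.1, (x.2.2)^-1 * x.1)%g, x.2.2))).
  by apply: eq_esum => -[g [i a]] _ /=; rewrite mulVKg.
split=> // [[g [i a]] [g' [i' a']] _ _ /= [-> + aa]|[[i h] a] _ /=].
  by rewrite aa => /mulgI ->.
by exists ((a * h)%g, (i, a)) => //=; rewrite mulKg.
Qed.

Lemma normcMr (c : R[i]) (r : R) : normc (c * (r%:C)%C) ^+ 2 = normc c ^+ 2 * r ^+ 2.
Proof. by rewrite normcM normc_real exprMn real_normK ?num_real. Qed.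

Lemma sqsum_field_le (c : G -> R[i]) (r : I -> G -> G -> R) (d : R) : 0 <= d ->
  (forall g, (\esum_(p in [set: I * G]) (r p.1 p.2 g ^+ 2)%:E <= d%:E)%E) ->
  (sqsum (fun q : (I * G) * G =>
     (c (q.2 * q.1.2)%g * ((r q.1.1 q.2 (q.2 * q.1.2)%g)%:C)%C)%R) <= d%:E * sqsum c)%E.
Proof.
move=> d0 hr; rewrite (sqsum_field (fun i a g => c g * ((r i a g)%:C)%C)).
rewrite /sqsum -esumZ//; last by move=> g; rewrite sqr_ge0.
apply: le_esum => g _; under eq_esum do rewrite normcMr.
rewrite esumZ ?sqr_ge0//; last by move=> p; rewrite sqr_ge0.
by rewrite (mulrC d) (EFinM (normc (c g) ^+ 2)); apply: lee_wpmul2l => //; rewrite lee_fin sqr_ge0.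
Qed.

Variable f : I -> G -> G -> R.
Hypothesis f1 : forall g, (\esum_(p in [set: I * G]) (f p.1 p.2 g ^+ 2)%:E <= 1)%E.

Lemma field_summable (x : H) :
  (fun q : (I * G) * G => x (q.2 * q.1.2)%g * ((f q.1.1 q.2 (q.2 * q.1.2)%g)%:C)%C)
    \in @square_summable R ((I * G) * G)%type.
Proof.
rewrite inE; apply: (le_lt_trans (sqsum_field_le _ ler01 f1)).
by rewrite mul1e sqsum_lty.
Qed.

Definition field (x : H) : W := Ell2 (field_summable x).

Lemma fieldE x i h a : field x ((i, h), a) = x (a * h)%g * ((f i a (a * h)%g)%:C)%C.
Proof. by []. Qed.

Lemma norm_field x : ell2_norm (field x) <= ell2_norm x.
Proof.
rewrite -ler_sqr ?nnegrE ?ell2_norm_ge0// -lee_fin !ell2_normE.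
by rewrite -[leRHS]mul1e; exact: sqsum_field_le.
Qed.

Lemma field_lin a x y : field (a *: x + y) = a *: field x + field y.
Proof. by apply: ell2P => q; rewrite /= mulrDl -mulrA. Qed.

Definition Ishift (s : G) (p : I * G) : I * G := (p.1, (p.2 * s)%g).

Lemma IshiftK s : cancel (Ishift s) (Ishift s^-1%g).
Proof. by case=> i h; rewrite /Ishift /= mulgK. Qed.

Lemma IshiftVK s : cancel (Ishift s^-1%g) (Ishift s).
Proof. by case=> i h; rewrite /Ishift /= mulgVK. Qed.

(** As (a h) s = a (h s), right translation of x becomes the shift of the coordinate h, with a
    untouched; the only error is the change of the last argument of f from g to g s. *)
Lemma field_right s (e : R) x : 0 <= e ->
  (forall g, (\esum_(p in [set: I * G])
     ((f p.1 p.2 g - f p.1 p.2 (g * s)%g) ^+ 2)%:E <= (e ^+ 2)%:E)%E) ->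
  ell2_norm (field (right_regular R s x) - shift (IshiftK s) (IshiftVK s) (field x)) <= e * ell2_norm x.
Proof.
move=> e0 h; apply: norm_le_sqsum => //; rewrite -(right_translate_sqsum s x).
apply: le_trans (sqsum_field_le _ (r := fun i a g => f i a g - f i a (g * s)%g) (sqr_ge0 e) h); apply: le_esum => -[[i b] a] _.
rewrite lee_fin le_eqVlt; apply/orP; left; apply/eqP; congr (normc _ ^+ 2).
transitivity (x (a * b * s)%g * ((f i a (a * b)%g)%:C)%C -
              x (a * (b * s))%g * ((f i a (a * (b * s))%g)%:C)%C); first by [].
by rewrite mulgA -mulrBr -rmorphB.
Qed.

(** As s^-1 (a h) = (s^-1 a) h, left translation of x acts on the last coordinate alone, as an
    amplified operator does; f changes by the diagonal translation of its two arguments. *)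
Lemma field_left s (e : R) x : 0 <= e ->
  (forall g, (\esum_(p in [set: I * G])
     ((f p.1 p.2 g - f p.1 (s^-1 * p.2)%g (s^-1 * g)%g) ^+ 2)%:E <= (e ^+ 2)%:E)%E) ->
  ell2_norm (field (left_regular R s x) - amp (left_regular R s) (field x)) <= e * ell2_norm x.
Proof.
move=> e0 h; apply: norm_le_sqsum => //; rewrite -(sqsum_translate s x).
apply: le_trans (sqsum_field_le _
  (r := fun i a g => f i a g - f i (s^-1 * a)%g (s^-1 * g)%g) (sqr_ge0 e) h); apply: le_esum => -[[i b] a] _.
rewrite lee_fin le_eqVlt; apply/orP; left; apply/eqP; congr (normc _ ^+ 2).
transitivity (x (s^-1 * (a * b))%g * ((f i a (a * b)%g)%:C)%C -
  x (s^-1 * a * b)%g * ((f i (s^-1 * a)%g (s^-1 * a * b)%g)%:C)%C); first by [].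
by rewrite -mulgA -mulrBr -rmorphB.
Qed.

(** The norm lost at g is at most b g times the mass of x there: small by b outside F, small by the
    mass of x inside F. *)
Lemma norm_field_lower (b : G -> R) (F : {fset G}) (d e : R) (x : H) : 0 <= d ->
  (forall g, b g <= 1) ->
  (forall g, ((1 - b g)%:E <= \esum_(p in [set: I * G]) (f p.1 p.2 g ^+ 2)%:E)%E) ->
  (forall g, g \notin F -> b g <= d) ->
  \sum_(g <- F) normc (x g) ^+ 2 <= e ->
  ell2_norm x ^+ 2 <= ell2_norm (field x) ^+ 2 + (d * ell2_norm x ^+ 2 + e).
Proof.
move=> d0 b1 fb bF xF.
pose S g := fine (\esum_(p in [set: I * G]) (f p.1 p.2 g ^+ 2)%:E)%E.
have SE g : (\esum_(p in [set: I * G]) (f p.1 p.2 g ^+ 2)%:E)%E = (S g)%:E.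
  by rewrite fineK// ge0_fin_numE ?(le_lt_trans (f1 g)) ?ltry// esum_ge0// => p _;
    rewrite lee_fin sqr_ge0.
have S0 g : 0 <= S g by rewrite -lee_fin -SE esum_ge0// => p _; rewrite lee_fin sqr_ge0.
have hx : (\esum_(g in [set: G]) (if g \in F then normc (x g) ^+ 2 else 0)%:E =
          (\sum_(g <- F) normc (x g) ^+ 2)%:E)%E.
  transitivity (\esum_(g in [set` F]) (normc (x g) ^+ 2)%:E)%E.
    by rewrite [RHS]esum_mkcond; apply: eq_esum => g _; rewrite mem_setE; case: ifP.
  rewrite esum_fset ?finite_fset//; last by move=> g _; rewrite lee_fin sqr_ge0.
  by rewrite fsbig_finite ?finite_fset//= set_fsetK sumEFin.
apply: (@le_trans _ _ (ell2_norm (field x) ^+ 2 +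
   (d * ell2_norm x ^+ 2 + \sum_(g <- F) normc (x g) ^+ 2))); last by rewrite !lerD2l.
rewrite -lee_fin !EFinD (EFinM d) -hx !ell2_normE.
rewrite (sqsum_field (fun i a g => x g * ((f i a g)%:C)%C)).
have -> : (\esum_(g in [set: G]) \esum_(p in [set: I * G])
     (normc (x g * ((f p.1 p.2 g)%:C)%C)%R ^+ 2)%:E =
   \esum_(g in [set: G]) (normc (x g) ^+ 2 * S g)%:E)%E.
  apply: eq_esum => g _; under eq_esum do rewrite normcMr.
  by rewrite esumZ ?sqr_ge0 ?SE// => p; rewrite sqr_ge0.
rewrite /sqsum -esumZ//; last by move=> g; rewrite sqr_ge0.
have p0 g : 0 <= (if g \in F then normc (x g) ^+ 2 else 0) by case: ifP; rewrite ?sqr_ge0.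
rewrite -[X in (_ <= _ + X)%E]esumD; [|by move=> g _; rewrite lee_fin mulr_ge0 ?sqr_ge0|
  by move=> g _; rewrite lee_fin].
rewrite -esumD; [|by move=> g _; rewrite lee_fin mulr_ge0 ?sqr_ge0|
  by move=> g _; rewrite -EFinD lee_fin; apply: addr_ge0 => //; rewrite mulr_ge0 ?sqr_ge0].
apply: le_esum => g _; rewrite -!EFinD lee_fin.
have hb : 1 - b g <= S g by rewrite -lee_fin -SE.
have n0 : 0 <= normc (x g) ^+ 2 by rewrite sqr_ge0.
have := b1 g; case: ifPn => [_|/bF]; nra.
Qed.
End Field.

Section FiniteSums.
Variables (R : realType) (J : choiceType).
Implicit Types u v : J -> R[i].

Lemma cabsD u v : cabs u -> cabs v -> cabs (fun j => u j + v j).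
Proof.
move=> [u1 u2] [v1 v2]; split.
  have -> : (fun j => complex.Re (u j + v j)) = (fun j => complex.Re (u j) + complex.Re (v j)).
    by apply/funext => j; case: (u j) (v j) => ? ? [].
  exact: rabsD.
have -> : (fun j => complex.Im (u j + v j)) = (fun j => complex.Im (u j) + complex.Im (v j)).
  by apply/funext => j; case: (u j) (v j) => ? ? [].
exact: rabsD.
Qed.

Lemma cabs0 : cabs (fun _ : J => 0 : R[i]).
Proof. by split; rewrite /rabs esum1 ?ltry// => j _; rewrite normr0. Qed.

Lemma csum0 : csum (fun _ : J => 0 : R[i]) = 0.
Proof.
transitivity (0 * csum (fun _ : J => 0 : R[i])); last by rewrite mul0r.
by rewrite -csumZ ?mulr0//; exact: cabs0.
Qed.

Lemma csum_sum (I : Type) (r : seq I) (u : I -> J -> R[i]) :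
  (forall i, cabs (u i)) ->
  cabs (fun j => \sum_(i <- r) u i j) /\
  csum (fun j => \sum_(i <- r) u i j) = \sum_(i <- r) csum (u i).
Proof.
move=> hu; elim: r => [|i r [IH1 IH2]].
  have -> : (fun j => \sum_(i <- [::]) u i j) = (fun _ => 0).
    by apply/funext => j; rewrite big_nil.
  split; first exact: cabs0.
  by rewrite big_nil csum0.
have -> : (fun j => \sum_(i0 <- i :: r) u i0 j) =
          (fun j => u i j + \sum_(i0 <- r) u i0 j).
  by apply/funext => j; rewrite big_cons.
by split; [exact: cabsD | rewrite big_cons -IH2; exact: csumD].
Qed.

Lemma ell2_sumE (I : Type) (r : seq I) (x : I -> ell2 R J) j :
  (\sum_(i <- r) x i) j = \sum_(i <- r) x i j.
Proof. by elim/big_rec2: _ => [|i a b _ <-]. Qed.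

End FiniteSums.

(** * Two-norm estimates from Gram domination *)

Section TraceBound.
Variables (R : realType) (G : groupType) (I : choiceType).
Local Notation H := (ell2 R G).
Local Notation LG := (group_vna R G).
Local Notation dl := (@delta R G).
Local Notation lam := (left_regular R).
Local Notation Re := (@complex.Re R).
Local Notation Im := (@complex.Im R).
Variables (f : I -> G -> G -> R) (k : G -> G -> R).

(** The kernel k does not depend on g. This uniformity allows the inequality to be summed over g,
    with coefficients that do depend on g. *)
Definition gram_bound := forall g (F : seq G) (c : G -> R),
  (\esum_(p in [set: I * G])
     ((\sum_(s <- F) c s * f p.1 (s^-1 * p.2)%g (s^-1 * g)%g) ^+ 2)%:E <=
   (\sum_(s <- F) \sum_(t <- F) c s * c t * k s t)%:E)%E.

Hypothesis fk : gram_bound.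
Hypothesis k1 : forall s, k s s = 1.

Lemma gram_bound_field g : (\esum_(p in [set: I * G]) (f p.1 p.2 g ^+ 2)%:E <= 1)%E.
Proof.
have := fk g [:: 1%g] (fun=> 1); rewrite !big_seq1 k1 !mulr1; apply: le_trans.
by apply: le_esum => p _; rewrite big_seq1 invg1 !mul1g mul1r.
Qed.
Local Notation field := (field gram_bound_field).

Let form (F : seq G) (c : G -> R[i]) := \sum_(s <- F) \sum_(t <- F) Re (c s * (c t)^*) * k s t.

(** The array is real, so real and imaginary parts of the coefficients separate, each governed by
    the real bound. *)
Lemma gram_bound_complex g (F : seq G) (c : G -> R[i]) :
  (\esum_(p in [set: I * G])
     (normc (\sum_(s <- F) c s * ((f p.1 (s^-1 * p.2)%g (s^-1 * g)%g)%:C)%C)%R ^+ 2)%:E <=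
   (form F c)%:E)%E.
Proof.
have e (z : G -> R) : normc (\sum_(s <- F) c s * ((z s)%:C)%C) ^+ 2 =
    (\sum_(s <- F) Re (c s) * z s) ^+ 2 + (\sum_(s <- F) Im (c s) * z s) ^+ 2.
  rewrite normcE2 !raddf_sum /=; congr (_ ^+ 2 + _ ^+ 2); apply: eq_bigr => s _.
    by case: (c s) => a b /=; ring.
  by case: (c s) => a b /=; ring.
under eq_esum do rewrite e EFinD.
rewrite esumD; try by move=> p _; rewrite lee_fin sqr_ge0.
have -> : form F c = \sum_(s <- F) \sum_(t <- F) Re (c s) * Re (c t) * k s t +
                     \sum_(s <- F) \sum_(t <- F) Im (c s) * Im (c t) * k s t.
  rewrite -big_split; apply: eq_bigr => s _; rewrite -big_split; apply: eq_bigr => t _ /=.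
  by rewrite -mulrDl; case: (c s) (c t) => a b [a' b'] /=; congr (_ * _); ring.
by rewrite EFinD; apply: leeD; exact: fk.
Qed.

Definition trunc (z : bop R G) (F : {fset G}) : bop R G :=
  \sum_(s <- F) z (dl 1%g) s *: lam s.

Lemma trunc_group_vna z F : LG (trunc z F).
Proof. by apply: group_vna_sum => s; apply: group_vnaZ; exact: lam_group_vna. Qed.

Lemma trunc_delta z F : trunc z F (dl 1%g) = fin_part (z (dl 1%g)) F.
Proof.
rewrite /trunc bop_sumE; apply: eq_bigr => s _.
by rewrite bop_scaleE lam_delta mulg1.
Qed.

(** Translating l to 1, this is tr(u* lam(t^-1 s) u), which equals tr(lam(t^-1 s)) by traciality and
    u u* = 1. *)
Lemma lam_orthonormal u s t l : LG u -> u * adj u = 1 ->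
  <| lam s (u (dl l)), lam t (u (dl l)) |> = (s == t)%:R.
Proof.
move=> hu uu; rewrite delta_rho (group_vna_rho hu) !lam_rho inner_rho.
rewrite [LHS]adj_r lam_adj [LHS]adj_r -(bop_mulE (adj u)) -(bop_mulE (adj u * _)).
have hL : LG (adj u * lam t^-1 * lam s).
  by apply: group_vnaM; [apply: group_vnaM; [exact: group_vna_adj|exact: lam_group_vna]|exact: lam_group_vna].
rewrite trace_comm// -bop_mulE !mulrA uu mul1r bop_mulE !lam_delta inner_delta deltaE.
congr (nat_of_bool _)%:R; rewrite mulg1.
by apply/eqP/eqP => [/esym/(congr1 (fun x => t * x)%g)|->]; gsimpl.
Qed.

Lemma amp_truncE z F (w : ell2 R ((I * G) * G)%type) i h a :
  amp (trunc z F) w ((i, h), a) = \sum_(s <- F) z (dl 1%g) s * w ((i, h), (s^-1 * a)%g).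
Proof.
by rewrite ampE /trunc bop_sumE ell2_sumE; apply: eq_bigr.
Qed.

(** At each g the Gram bound is applied with the coefficients [X s g]. Summation over g turns it
    into the sum of k(s,t) <X s, X t>; by orthonormality only the diagonal survives, where k is 1,
    and it is the sum of the squared coefficients of z on F. *)
Lemma trunc_bound z F u l : LG u -> u * adj u = 1 ->
  ell2_norm (amp (trunc z F) (field (u (dl l)))) <= ell2_norm (z (dl 1%g)).
Proof.
move=> hu uu; set zh := z (dl 1%g); set eta := u (dl l).
pose X s : H := zh s *: lam s eta.
have ReM (r : R) (w : R[i]) : Re ((r%:C)%C * w) = r * Re w by case: w => a b /=; ring.
have step1 : (sqsum (amp (trunc z F) (field eta)) <=
   \esum_(g in [set: G]) (form F (fun s => X s g))%:E)%E.
  pose Z i a g : R[i] := \sum_(s <- F) X s g * ((f i (s^-1 * a)%g (s^-1 * g)%g)%:C)%C.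
  have -> : sqsum (amp (trunc z F) (field eta)) =
     sqsum (fun q : (I * G) * G => Z q.1.1 q.2 (q.2 * q.1.2)%g).
    congr sqsum; apply/funext => -[[i h] a]; rewrite amp_truncE.
    by apply: eq_bigr => s _; rewrite fieldE -mulgA mulrA.
  rewrite sqsum_field; apply: le_esum => g _; exact: gram_bound_complex.
have formE g : form F (fun s => X s g) =
    Re (\sum_(s <- F) \sum_(t <- F) ((k s t)%:C)%C * (X s g * (X t g)^*)).
  rewrite raddf_sum; apply: eq_bigr => s _; rewrite raddf_sum; apply: eq_bigr => t _.
  by rewrite mulrC; exact/esym/ReM.
have form0 g : 0 <= form F (fun s => X s g).
  rewrite -lee_fin; apply: le_trans (gram_bound_complex g F _).
  by apply: esum_ge0 => p _; rewrite lee_fin sqr_ge0.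
have c2 s t : cabs (fun g => ((k s t)%:C)%C * (X s g * (X t g)^*)).
  have := inner_cabs (((k s t)%:C)%C *: X s) (X t).
  by rewrite (_ : (fun j => _) = (fun g => ((k s t)%:C)%C * (X s g * (X t g)^*)))//;
    apply/funext => g; rewrite mulrA.
have c1 s := csum_sum F (c2 s).
have [c0 cE] := csum_sum F (fun s => (c1 s).1).
have sumE : csum (fun g => \sum_(s <- F) \sum_(t <- F) ((k s t)%:C)%C * (X s g * (X t g)^*)) =
   ((\sum_(s <- F) normc (zh s) ^+ 2)%:C)%C.
  rewrite cE rmorph_sum; rewrite big_seq [RHS]big_seq; apply: eq_bigr => s sF.
  rewrite (c1 s).2.
  have e t : csum (fun g => ((k s t)%:C)%C * (X s g * (X t g)^*)) =
     ((k s t)%:C)%C * (zh s * (zh t)^* * (s == t)%:R).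
    rewrite csumZ; last exact: inner_cabs.
    by rewrite -[csum _]/(<| X s, X t |>) innerZ innerZr lam_orthonormal// -(mulrA (zh s)).
  rewrite (big_fsetD1 s)//= e eqxx mulr1 k1 mul1r mulcJ big1_fset ?addr0// => t.
  by rewrite !inE => /andP[/negbTE ts _] _; rewrite e eq_sym ts !mulr0.
rewrite -ler_sqr ?nnegrE ?ell2_norm_ge0//.
apply: le_trans (norm_sq_ge_sum zh F).
rewrite -lee_fin ell2_normE; apply: (le_trans step1).
have rE : rsum (fun g => form F (fun s => X s g)) = \sum_(s <- F) normc (zh s) ^+ 2.
  by rewrite (funext formE); exact: (congr1 (@complex.Re R) sumE).
have fin : (\esum_(g in [set: G]) (form F (fun s => X s g))%:E)%E \is a fin_num.
  apply: esum_fin_num => //; have := c0.1; rewrite /rabs.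
  by under eq_esum do rewrite -formE ger0_norm//.
by rewrite -(fineK fin) lee_fin -rsum_ge0E// rE.
Qed.

Lemma slice_norm (w : ell2 R ((I * G) * G)%type) p : ell2_norm (slice w p) <= ell2_norm w.
Proof.
rewrite -ler_sqr ?nnegrE ?ell2_norm_ge0// -lee_fin [leRHS]ell2_normE sqsum_slice.
apply: ereal_sup_ubound; exists [set p]; first by split.
by rewrite fsbig_set1.
Qed.

(** The bound for truncations does not involve F, so it passes to z as soon as the truncations
    converge coordinatewise. *)
Lemma trace_bound z u l : LG z -> LG u -> u * adj u = 1 ->
  ell2_norm (amp z (field (u (dl l)))) <= ell2_norm (z (dl 1%g)).
Proof.
move=> hz hu uu; set w := field _.
apply: norm_le_pointwise; first exact: ell2_norm_ge0.
move=> A e e0; have D0 : 0 < ell2_norm w + 1 by rewrite ltr_wpDl ?ell2_norm_ge0.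
have [F hF] := fin_part_approx (z (dl 1%g)) (divr_gt0 e0 D0).
exists (amp (trunc z F) w); first exact: trunc_bound.
move=> [p a].
(* Moving [z - trunc z F] to the point mass at a by the adjoint leaves its 2-norm, which the choice
   of F makes small uniformly in p and a. *)
rewrite (_ : _ - _ = (z - trunc z F) (slice w p) a)//.
have hD : LG (z - trunc z F) by apply: group_vnaB => //; exact: trunc_group_vna.
rewrite -inner_delta adj_l; apply: (le_trans (cauchy_schwarz _ _)).
rewrite (delta_rho R a) (group_vna_rho (group_vna_adj hD)) norm_rho norm_adj_trace//.
rewrite bop_addE bop_oppE trunc_delta.
apply: (@le_trans _ _ ((ell2_norm w + 1) * (e / (ell2_norm w + 1)))); last first.
  by rewrite mulrCA divff ?mulr1// gt_eqF.
apply: ler_pM; rewrite ?ell2_norm_ge0//; last exact: ltW.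
by apply: (le_trans (slice_norm _ _)); rewrite lerDl.
Qed.

End TraceBound.

(** * Solidity from equivariant arrays *)

(* Maps g |-> f(., g) from G to l2(I x G) which are almost unit vectors at
   infinity, almost right invariant and almost left equivariant, and whose
   Gram kernels are dominated by a fixed normalized kernel k. *)
Definition equivariant_array (R : realType) (G : groupType) (I : choiceType) :=
  forall (S : seq G) (e : R), 0 < e ->
  exists (f : I -> G -> G -> R) (k : G -> G -> R) (b : G -> R),
  [/\ gram_bound f k, forall s, k s s = 1,
      [/\ forall g, b g <= 1,
          forall g, ((1 - b g)%:E <= \esum_(p in [set: I * G]) (f p.1 p.2 g ^+ 2)%:E)%E &
          forall d, 0 < d -> exists F : {fset G}, forall g, g \notin F -> b g <= d],
      forall s, s \in S -> forall g, (\esum_(p in [set: I * G])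
        ((f p.1 p.2 g - f p.1 (s^-1 * p.2)%g (s^-1 * g)%g) ^+ 2)%:E <= (e ^+ 2)%:E)%E &
      forall s, s \in S -> forall g, (\esum_(p in [set: I * G])
        ((f p.1 p.2 g - f p.1 p.2 (g * s)%g) ^+ 2)%:E <= (e ^+ 2)%:E)%E].

Section Solidity.
Variables (R : realType) (G : groupType) (I : choiceType).
Hypothesis arr : equivariant_array R G I.
Variable (N : set (bop R G)).
Hypothesis hN : von_neumann_algebra N.
Local Notation LG := (group_vna R G).
Hypothesis NLG : N `<=` LG.
Hypothesis dN : diffuse N.
Local Notation H := (ell2 R G).
Local Notation W := (ell2 R ((I * G) * G)%type).
Local Notation dl := (@delta R G).
Local Notation lam := (left_regular R).
Local Notation rho := (right_regular R).
Local Notation Q := (commutant N `&` LG).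
Local Notation sh s := (shift (@IshiftK G I s) (@IshiftVK G I s)).

(** In the last clause the Fourier tail of z off F is counted twice, once for the amplified operator
    and once inside V, and each retained coefficient costs e times its modulus. Point masses suffice
    since weak limits are compared by matrix coefficients. *)
Definition approximate_intertwiner (S : seq G) (e : R) (V : H -> W) :=
  [/\ forall a x y, V (a *: x + y) = a *: V x + V y,
      forall x, ell2_norm (V x) <= ell2_norm x,
      forall s x, s \in S -> ell2_norm (V (rho s x) - sh s (V x)) <= e * ell2_norm x,
      forall l, l \in S -> 1 - ell2_norm (V (dl l)) ^+ 2 <= 2 * e &
      forall z (F : {fset G}) l, Q z -> {subset F <= S} ->
        ell2_norm (amp z (V (dl l)) - V (z (dl l))) <=
        2 * ell2_norm (z (dl 1%g) - fin_part (z (dl 1%g)) F) +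
        (\sum_(s <- F) normc (z (dl 1%g) s)) * e].

Lemma amp_trunc (K : choiceType) (z : bop R G) (F : {fset G}) (w : ell2 R (K * G)%type) :
  amp (trunc z F) w = \sum_(s <- F) z (dl 1%g) s *: amp (lam s) w.
Proof.
apply: ell2P => -[p a]; rewrite ampE /trunc bop_sumE !ell2_sumE.
by apply: eq_bigr.
Qed.

Lemma amp_addl (K : choiceType) (S T : bop R G) (w : ell2 R (K * G)%type) :
  amp (S + T) w = amp S w + amp T w.
Proof. exact: ell2P. Qed.

Lemma approximate_intertwiner_exists (S : seq G) (e : R) : 0 < e ->
  exists V, approximate_intertwiner S e V.
Proof.
move=> e0.
have aux (p q1 q2 q3 d s : R) : p <= q1 + q2 -> q1 <= d -> q2 <= s -> q3 <= d ->
  p + q3 <= 2 * d + s by lra.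
have [f [k [b [fk k1 [b1 fb b0] fl fr]]]] := arr S e0.
have [F hF] := b0 _ e0.
have s0 : 0 < (size F).+1%:R :> R by rewrite ltr0n.
(* Capping d by 1 gives d^2 <= d, so the mass on F, at most (size F) d^2, is at most e. *)
pose d : R := Num.min 1 (e / (size F).+1%:R).
have d0 : 0 < d by rewrite lt_min ltr01 divr_gt0.
(* The coefficient of [u (dl l)] at g is that of [u (dl 1)] at g l^-1, hence the set of
   quotients. *)
have [u [Nu ua uu hu]] :=
  diffuse_symmetry hN NLG dN [seq (g * l^-1)%g | g <- F, l <- S] d0.
have uL := NLG Nu; have uu' : u * adj u = 1 by rewrite ua.
have uiso x : ell2_norm (u x) = ell2_norm x.
  by apply: isometry_of_adj; rewrite ua.
pose f1 := gram_bound_field fk k1.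
pose V x : W := field f1 (u x).
exists V; split.
- by move=> a x y; rewrite /V bopD bopZ field_lin.
- by move=> x; rewrite /V (le_trans (norm_field _ _))// uiso.
- move=> s x sS; rewrite /V (group_vna_rho uL) -(uiso x).
  by apply: field_right (ltW e0) _ => g; exact: fr.
- move=> l lS.
  have xF : \sum_(g <- F) normc (u (dl l) g) ^+ 2 <= e.
    apply: (@le_trans _ _ ((size F)%:R * (d * d))).
      rewrite big_seq_cond -big_seq_cond.
      apply: (@le_trans _ _ (\sum_(g <- F) d ^+ 2)); last first.
        by rewrite -expr2; apply: ler_sum_const.
      rewrite big_seq [leRHS]big_seq; apply: ler_sum => g gF.
      have d0' := ltW d0; rewrite ler_sqr ?nnegrE ?normc_ge0//.
      rewrite (group_vna_coef uL); apply: hu; apply/allpairsP; exists (g, l) => //=.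
    have d1 : d <= 1 by rewrite ge_min lexx.
    have d2 : d <= e / (size F).+1%:R by rewrite ge_min lexx orbT.
    apply: (@le_trans _ _ ((size F)%:R * (e / (size F).+1%:R))).
      apply: ler_wpM2l => //; apply: le_trans d2; apply: ler_piMr => //; exact: ltW.
    rewrite mulrCA; apply: ler_piMr; first exact: ltW.
    by rewrite ler_pdivrMr// mul1r ler_nat.
  (* One e comes from outside F, where b is at most e, the other from the mass of [u (dl l)] on
     F. *)
  have := norm_field_lower f1 (ltW e0) b1 fb hF xF.
  by rewrite uiso norm_delta expr1n mulr1 -/(V (dl l)); lra.
- move=> z A l [zN zL] AS.
  pose eta := u (dl l); pose D : bop R G := z - trunc z A.
  have DL : LG D by apply: group_vnaB => //; exact: trunc_group_vna.
  have De : ell2_norm (D (dl 1%g)) = ell2_norm (z (dl 1%g) - fin_part (z (dl 1%g)) A).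
    by rewrite /D bop_addE bop_oppE trunc_delta.
  have -> : amp z (V (dl l)) - V (z (dl l)) = amp D (field f1 eta) +
     (amp (trunc z A) (field f1 eta) - field f1 (trunc z A eta)) - field f1 (D eta).
    have e1 : amp z (V (dl l)) = amp D (field f1 eta) + amp (trunc z A) (field f1 eta).
      by rewrite -amp_addl /D subrK.
    have e2 : V (z (dl l)) = field f1 (D eta) + field f1 (trunc z A eta).
      (* Here z commuting with N enters: u z = z u moves z from inside u to the outside, where it
         can be compared with the amplification. *)
      rewrite /V -[u (z _)]bop_mulE -(zN _ Nu) bop_mulE -/eta.
      rewrite -[field f1 (D eta)]scale1r -field_lin scale1r.
      by rewrite -bop_addE /D subrK.
    by rewrite e1 e2 opprD addrA; rewrite -!addrA; congr (_ + (_ + _)); rewrite addrC.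
  apply: (le_trans (ler_norm2B _ _)).
  have h1 : ell2_norm (amp D (field f1 eta)) <= ell2_norm (D (dl 1%g)).
    exact: trace_bound.
  have h3 : ell2_norm (field f1 (D eta)) <= ell2_norm (D (dl 1%g)).
    by rewrite (le_trans (norm_field _ _))// /eta norm_trace_unitary.
  have h2 : ell2_norm (amp (trunc z A) (field f1 eta) - field f1 (trunc z A eta)) <=
     (\sum_(s <- A) normc (z (dl 1%g) s)) * e.
    have -> : amp (trunc z A) (field f1 eta) - field f1 (trunc z A eta) =
      \sum_(s <- A) z (dl 1%g) s *: (amp (lam s) (field f1 eta) - field f1 (lam s eta)).
      rewrite amp_trunc /trunc bop_sumE.
      have -> : field f1 (\sum_(s <- A) (z (dl 1%g) s *: lam s) eta) =
         \sum_(s <- A) z (dl 1%g) s *: field f1 (lam s eta).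
        elim/big_rec2: _ => [|s v w _ <-]; last by rewrite -field_lin.
        by apply: ell2P => q; rewrite /= mul0r.
      by rewrite -sumrB; apply: eq_bigr => s _; rewrite scalerBr.
    apply: (le_trans (ler_norm2_sum _ _)); rewrite mulr_suml.
    rewrite big_seq [leRHS]big_seq; apply: ler_sum => s sA.
    rewrite normZ; apply: ler_wpM2l; first exact: normc_ge0.
    rewrite normBC -[leRHS]mulr1 -(norm_delta R l) -(uiso (dl l)).
    by apply: field_left (ltW e0) _ => g; apply: fl; exact: AS.
  have h4 := ler_norm2D (amp D (field f1 eta))
    (amp (trunc z A) (field f1 eta) - field f1 (trunc z A eta)).
  rewrite -De; exact: (aux _ _ _ _ _ _ h4 h1 h2 h3).
Qed.

(** With S = V* V, a contraction, norm(S d - d)^2 <= 2 (norm(d)^2 - norm(V d)^2): the norm that V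
    loses at d alone controls the form against every w. *)
Lemma contraction_defect (V : H -> W) (w d : H) :
  (forall a x y, V (a *: x + y) = a *: V x + V y) ->
  (forall x, ell2_norm (V x) <= ell2_norm x) ->
  normc (<| V w, V d |> - <| w, d |>) <=
  ell2_norm w * Num.sqrt (2 * (ell2_norm d ^+ 2 - ell2_norm (V d) ^+ 2)).
Proof.
move=> Vl Vc.
have [|x y|S SV Sc] := @form_op R G (fun x y => <| V x, V y |>) 1 ler01.
- by split=> a x y z; rewrite Vl ?innerD ?innerZ ?innerDr ?innerZr.
- rewrite mul1r (le_trans (cauchy_schwarz _ _))//.
  by apply: ler_pM; rewrite ?ell2_norm_ge0.
have -> : <| V w, V d |> - <| w, d |> = <| w, S d - d |>.
  by rewrite innerBr innerC -SV -innerC.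
apply: (le_trans (cauchy_schwarz _ _)); apply: ler_wpM2l; first exact: ell2_norm_ge0.
have Sd : ell2_norm (S d) ^+ 2 <= ell2_norm d ^+ 2.
  by rewrite ler_sqr ?nnegrE ?ell2_norm_ge0//; have := Sc d; rewrite mul1r.
have Vd : ell2_norm (V d) ^+ 2 <= ell2_norm d ^+ 2.
  by rewrite ler_sqr ?nnegrE ?ell2_norm_ge0.
have c0 : 0 <= 2 * (ell2_norm d ^+ 2 - ell2_norm (V d) ^+ 2) by rewrite mulr_ge0// subr_ge0.
rewrite -ler_sqr ?nnegrE ?ell2_norm_ge0 ?sqrtr_ge0// (sqr_sqrtr c0).
by rewrite normB_sq SV inner_norm /=; move: Sd Vd; lra.
Qed.

Variable en : nat -> G.
Hypothesis en_surj : forall g, exists n, en n = g.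
Variables (U : set_system nat).
Hypothesis UU : UltraFilter U.
Hypothesis Uoo : forall n, U [set m | (n <= m)%N].
#[local] Existing Instance UU.

Let Sn n := [seq en i | i <- iota 0 n.+1].

Let Sn_mem g : exists n0, forall n, (n0 <= n)%N -> g \in Sn n.
Proof.
have [n0 <-] := en_surj g; exists n0 => n nn; apply/mapP; exists n0 => //.
by rewrite mem_iota add0n ltnS.
Qed.

Let Sn_sub (F : {fset G}) : exists n0, forall n, (n0 <= n)%N -> {subset F <= Sn n}.
Proof.
suff [n0 h] : exists n0, forall n, (n0 <= n)%N -> {subset (F : seq G) <= Sn n} by exists n0.
elim: (F : seq G) => [|g s [n0 IH]]; first by exists 0%N.
have [n1 hn1] := Sn_mem g; exists (maxn n0 n1) => n; rewrite geq_max => /andP[h0 h1] x.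
by rewrite inE => /predU1P[->|/IH]; [exact: hn1 | apply].
Qed.

Let small_inv (c e : R) : 0 <= c -> 0 < e -> exists n0, forall n, (n0 <= n)%N ->
  c * n.+1%:R^-1 < e.
Proof.
move=> c0 e0; exists (Num.bound (c / e)) => n hn.
have := archi_boundP (divr_ge0 c0 (ltW e0)); rewrite ltr_pdivrMr// => h.
rewrite ltr_pdivrMr ?ltr0n// mulrC; apply: (lt_le_trans h).
apply: ler_wpM2r; first exact: ltW.
by rewrite ler_nat ltnW// ltnS.
Qed.

Lemma intertwining_map : exists Phi : bop R G -> bop R G,
  [/\ linear Phi, forall T, LG (Phi T), forall T, Q T -> Phi T = T &
      forall T, opnorm (Phi T) <= opnorm T].
Proof.
have en0 n : 0 < n.+1%:R^-1 :> R by rewrite invr_gt0.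
pose V n := projT1 (cid (approximate_intertwiner_exists (Sn n) (en0 n))).
have hV n : approximate_intertwiner (Sn n) n.+1%:R^-1 (V n) :=
  projT2 (cid (approximate_intertwiner_exists (Sn n) (en0 n))).
have Vl n : forall a x y, V n (a *: x + y) = a *: V n x + V n y by case: (hV n).
have Vc n : forall x, ell2_norm (V n x) <= ell2_norm x by case: (hV n).
have ampV n T x : ell2_norm (amp T (V n x)) <= opnorm T * ell2_norm x.
  apply: (le_trans (amp_norm _ (opnorm_ge0 T) (opnormP T))).
  by apply: ler_wpM2l (Vc _ _); exact: opnorm_ge0.
have ex T : exists P : bop R G,
    (forall x y, uconv U (fun n => <| amp T (V n x), V n y |>) <| P x, y |>) /\
    forall x, ell2_norm (P x) <= opnorm T * ell2_norm x.
  have [||P h1 h2] := form_ulim UU (F := fun n x y => <| amp T (V n x), V n y |>) (opnorm_ge0 T).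
  - move=> n; split=> a x y z; first by rewrite Vl ampD ampZ innerD innerZ.
    by rewrite Vl innerDr innerZr.
  - move=> n x y; apply: (le_trans (cauchy_schwarz _ _)); rewrite mulrA.
    by apply: ler_pM; rewrite ?ell2_norm_ge0.
  by exists P.
pose Phi T := projT1 (cid (ex T)).
have PhiV T := (projT2 (cid (ex T))).1 : forall x y, uconv U _ <| Phi T x, y |>.
have Phin T := (projT2 (cid (ex T))).2 : forall x, ell2_norm (Phi T x) <= _.
exists Phi; split.
- move=> a S T; apply: bop_eqP => x; apply: inner_eqP => y.
  apply: (uconv_unique UU (PhiV _ _ _)).
  under eq_fun do rewrite amp_lin innerD innerZ.
  rewrite bop_addE bop_scaleE innerD innerZ.
  by apply: uconvD; [apply: uconvZ|].
- move=> T.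
  (* The form is asymptotically invariant under right translation: [rho s] becomes a shift of the
     amplification up to the error of V, and an amplified T commutes with shifts. *)
  have key s x y : <| Phi T (rho s x), rho s y |> = <| Phi T x, y |>.
    apply: (uconv_unique UU (PhiV _ _ _)); apply: (uconv_close UU (PhiV T x y)) => e e0.
    have C0 : 0 <= 2 * (opnorm T * (ell2_norm x * ell2_norm y)).
      by rewrite !mulr_ge0 ?opnorm_ge0 ?ell2_norm_ge0.
    have [n0 hn0] := small_inv C0 e0; have [n1 hn1] := Sn_mem s.
    apply: (filterS _ (filterI (Uoo n0) (Uoo n1))) => n [/= h0 h1].
    apply: le_lt_trans (hn0 n h0).
    have [_ _ hr _ _] := hV n.
    have rx := hr s x (hn1 n h1); have ry := hr s y (hn1 n h1).
    rewrite -(inner_shift (@IshiftK G I s) (@IshiftVK G I s)) -amp_shift.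
    set vx := V n (rho s x) in rx *; set vy := V n (rho s y) in ry *.
    set wx := sh s (V n x) in rx *; set wy := sh s (V n y) in ry *.
    rewrite (_ : <| amp T wx, wy |> - <| amp T vx, vy |> =
       - (<| amp T (vx - wx), vy |> + <| amp T wx, vy - wy |>)); last first.
      by rewrite ampB innerBl innerBr; ring.
    rewrite normcN; apply: (le_trans (le_normcD _ _)).
    have vyn : ell2_norm vy <= ell2_norm y by rewrite -(norm_rho s y); exact: Vc.
    have wxn : ell2_norm (amp T wx) <= opnorm T * ell2_norm x.
      by rewrite /wx amp_shift norm_shift.
    have c1 : normc <| amp T (vx - wx), vy |> <= opnorm T * (n.+1%:R^-1 * ell2_norm x) * ell2_norm y.
      apply: (le_trans (cauchy_schwarz _ _)); apply: ler_pM; rewrite ?ell2_norm_ge0//.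
      apply: (le_trans (amp_norm _ (opnorm_ge0 T) (opnormP T))).
      by apply: ler_wpM2l => //; exact: opnorm_ge0.
    have c2 : normc <| amp T wx, vy - wy |> <= opnorm T * ell2_norm x * (n.+1%:R^-1 * ell2_norm y).
      by apply: (le_trans (cauchy_schwarz _ _)); apply: ler_pM; rewrite ?ell2_norm_ge0.
    apply: (le_trans (lerD c1 c2)); rewrite le_eqVlt; apply/orP; left; apply/eqP; ring.
  apply/group_vnaP => s x; apply: inner_eqP => w.
  have -> : w = rho s (rho s^-1%g w) by apply: ell2P => h; rewrite !rhoE mulgK.
  by rewrite key inner_rho.
- move=> T hT; apply: bop_eq_delta => l; apply: ell2P => m.
  rewrite -!inner_delta; apply: (uconv_unique UU (PhiV _ _ _)).
  (* First for the vectors [V n (T (dl l))], since V is asymptotically isometric at the point mass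
     of m; the amplified T is then interchanged with V. *)
  have lim1 : uconv U (fun n => <| V n (T (dl l)), V n (dl m) |>) <| T (dl l), dl m |>.
    move=> e e0; pose c := ell2_norm (T (dl l)).
    have c0 : 0 <= c by exact: ell2_norm_ge0.
    have q0 : 0 < (e / (c + 1)) ^+ 2 by rewrite exprn_gt0// divr_gt0// ltr_wpDl.
    have [n0 hn0] := small_inv (ler0n R 4) q0; have [n1 hn1] := Sn_mem m.
    apply: (filterS _ (filterI (Uoo n0) (Uoo n1))) => n [/= h0 h1].
    apply: (le_lt_trans (contraction_defect _ _ (Vl n) (Vc n))).
    have [_ _ _ /(_ m (hn1 n h1)) hm _] := hV n.
    have ec0 : 0 <= e / (c + 1) by rewrite divr_ge0 ?addr_ge0// ltW.
    have hs : Num.sqrt (2 * (ell2_norm (dl m) ^+ 2 - ell2_norm (V n (dl m)) ^+ 2)) <= e / (c + 1).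
      rewrite -[leRHS](ger0_norm ec0) -sqrtr_sqr; apply: ler_wsqrtr.
      rewrite norm_delta expr1n; apply: (le_trans _ (ltW (hn0 n h0))).
      by apply: (le_trans (ler_wpM2l (ler0n R 2) hm)); rewrite mulrA -natrM.
    apply: (le_lt_trans (ler_wpM2l c0 hs)).
    have cp : 0 < c + 1 by rewrite ltr_wpDl.
    by rewrite mulrA ltr_pdivrMr// mulrC ltr_pM2l// ltrDl.
  (* The tail off F contributes twice e/4 and the retained coefficients e/4, in total less than
     e. *)
  apply: (uconv_close UU lim1) => e e0; have e20 : 0 < e / 4 by rewrite divr_gt0.
  have [F hF] := fin_part_approx (T (dl 1%g)) e20.
  have c0 : 0 <= \sum_(s <- F) normc (T (dl 1%g) s) by apply: sumr_ge0 => s _; exact: normc_ge0.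
  have [n0 hn0] := small_inv c0 e20; have [n1 hn1] := Sn_sub F.
  apply: (filterS _ (filterI (Uoo n0) (Uoo n1))) => n [/= h0 h1].
  have [_ _ _ _ /(_ T F l hT (hn1 n h1)) hT'] := hV n.
  rewrite -innerBl; apply: (le_lt_trans (cauchy_schwarz _ _)).
  have vm : ell2_norm (V n (dl m)) <= 1 by rewrite -(norm_delta R m); exact: Vc.
  apply: (@le_lt_trans _ _ (ell2_norm (V n (T (dl l)) - amp T (V n (dl l))))).
    by apply: ler_piMr => //; exact: ell2_norm_ge0.
  rewrite normBC; apply: (le_lt_trans hT').
  apply: (@lt_le_trans _ _ (2 * (e / 4) + e / 4)); last lra.
  by apply: ltrD; [rewrite ltr_pM2l | exact: hn0].
- by move=> T; apply: opnorm_le => //; exact: opnorm_ge0.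
Qed.

Lemma relcomm_injective : injective_vna Q.
Proof.
have [Phi [Phil PhiL PhiQ Phin]] := intertwining_map.
have ex T := conditional_expectation hN NLG UU Uoo (PhiL T).
pose E T := projT1 (cid (ex T)).
have hE T := projT2 (cid (ex T)) : [/\ Q (E T), _ & _].
(* The values of E are chosen one at a time; linearity comes from the fact that an element of Q is
   determined by its inner products with Q. *)
have Elin : linear E.
  move=> a S T; have [QST _ iST] := hE (a *: S + T).
  have [QS _ iS] := hE S; have [QT _ iT] := hE T.
  apply: (@relcomm_separating R G N) => //; first exact: relcomm_lin.
  move=> q hq; rewrite iST// Phil bop_addE bop_scaleE innerD innerZ.
  by rewrite bop_addE bop_scaleE innerD innerZ iS// iT.
pose EL : {linear bop R G -> bop R G} := HB.pack E (GRing.isLinear.Build _ _ _ _ E Elin).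
exists EL; split=> [T|T QT|T].
- by case: (hE T).
- have [h1 _ h3] := hE T; apply: (@relcomm_separating R G N) => // q hq.
  by rewrite [LHS](h3 q hq) PhiQ.
- apply: le_trans (Phin T); apply: opnorm_le; last exact: opnorm_ge0.
  by case: (hE T) => _ h _; apply: h; exact: opnormP.
Qed.

End Solidity.

Lemma array_solid (R : realType) (G : groupType) (I : choiceType) :
  countable [set: G] -> equivariant_array R G I -> solid (group_vna R G).
Proof.
move=> cG arr N hN NLG dN; have [U UU Uoo] := nat_ultrafilter.
have [en en_surj] : exists en : nat -> G, forall g, exists n, en n = g.
  move: cG => /countable_injP[code code_inj].
  have ex n : exists g : G, forall h, code h = n -> h = g.
    have [[g <-]|no] := pselect (exists g, code g = n).
      by exists g => h /code_inj; apply; rewrite inE.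
    by exists 1%g => h hn; case: no; exists h.
  exists (fun n => projT1 (cid (ex n))) => g; exists (code g).
  exact/esym/(projT2 (cid (ex (code g)))).
exact: (relcomm_injective arr hN NLG dN en_surj UU Uoo).
Qed.

(** * Free groups *)

Section Bijections.
Variable T : Type.

(** Permutation groups are the test groups for the universal property: over suitable sets they yield
    both generation by the basis and uniqueness of reduced words. *)
Record biject := Biject { biject_fun :> T -> T; _ : bijective biject_fun }.

HB.instance Definition _ := gen_eqMixin biject.
HB.instance Definition _ := gen_choiceMixin biject.

Lemma biject_eq (f g : biject) : f =1 g -> f = g.
Proof.
case: f g => f hf [g hg] /= /funext fg; subst g; congr Biject.
exact: Prop_irrelevance.
Qed.

Lemma biject_bij (f : biject) : bijective f. Proof. by case: f. Qed.

Lemma biject_inv_ex (f : biject) : exists g : T -> T, cancel f g /\ cancel g f.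
Proof. by have [g fK gK] := biject_bij f; exists g. Qed.

Definition biject_inv_fun (f : biject) : T -> T := projT1 (cid (biject_inv_ex f)).

Lemma biject_funK (f : biject) : cancel f (biject_inv_fun f).
Proof. exact: (projT2 (cid (biject_inv_ex f))).1. Qed.

Lemma biject_invK (f : biject) : cancel (biject_inv_fun f) f.
Proof. exact: (projT2 (cid (biject_inv_ex f))).2. Qed.

Lemma id_bijective : bijective (@id T). Proof. by exists id. Qed.

Definition biject_one : biject := Biject id_bijective.
Definition biject_mul (f g : biject) : biject := Biject (bij_comp (biject_bij f) (biject_bij g)).
Definition biject_inv (f : biject) : biject :=
  Biject (Bijective (biject_invK f) (biject_funK f)).

Lemma biject_mulA : associative biject_mul. Proof. by move=> f g h; exact: biject_eq. Qed.
Lemma biject_mul1 : left_id biject_one biject_mul. Proof. by move=> f; exact: biject_eq. Qed.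
Lemma biject_mulr1 : right_id biject_one biject_mul. Proof. by move=> f; exact: biject_eq. Qed.
Lemma biject_mulV : left_inverse biject_one biject_inv biject_mul.
Proof. by move=> f; apply: biject_eq => x /=; rewrite biject_funK. Qed.
Lemma biject_mulrV : right_inverse biject_one biject_inv biject_mul.
Proof. by move=> f; apply: biject_eq => x /=; rewrite biject_invK. Qed.

HB.instance Definition _ := isGroup.Build biject
  biject_mulA biject_mul1 biject_mulr1 biject_mulV biject_mulrV.

Lemma biject_mulE (f g : biject) x : (f * g)%g x = f (g x). Proof. by []. Qed.
Lemma biject_oneE x : (1 : biject)%g x = x. Proof. by []. Qed.

End Bijections.

Definition free_basis (F : groupType) (B : set F) := forall (H : groupType) (f : F -> H),
  exists2 phi : {multiplicative F -> H}, forall b, B b -> phi b = f b &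
    forall psi : {multiplicative F -> H}, (forall b, B b -> psi b = f b) -> psi =1 phi.

Section FreeGroup.
Variables (F : groupType) (B : set F).
Hypothesis hB : free_basis B.

(** * Generation of a free group by its basis *)

Section Generation.
Variable P : F -> Prop.
Hypotheses (PM : forall b x, B b -> P x -> P (b * x)%g)
  (PV : forall b x, B b -> P x -> P (b^-1 * x)%g).

Local Notation T := ((F -> Prop) * bool)%type.

(** Two copies of the power set of F: translation acts on the copy marked [true] and is trivial on
    the other. *)
Let left (g : F) (t : T) : T := if t.2 then (fun x => t.1 (g^-1 * x)%g, true) else t.

Let leftK g : cancel (left g) (left g^-1).
Proof.
by rewrite /left => -[A []] //=; congr pair; apply/funext => x; rewrite mulVKg.
Qed.

Let left_biject (g : F) : biject T.
Proof.
apply: (@Biject _ (left g)); exists (left g^-1); first exact: leftK.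
by move=> t; rewrite -{1}[g]invgK leftK.
Defined.

Let left_mul g h : left_biject (g * h) = (left_biject g * left_biject h)%g.
Proof.
apply: biject_eq => -[A []] //=; congr pair; apply/funext => x /=.
by rewrite invgM mulgA.
Qed.

(** This exchanges the two copies of P and fixes everything else. Conjugation by it leaves alone the
    translations that fix P, in particular those by B, and alters any translation that moves P. *)
Let swap (t : T) : T := if `[< t.1 = P >] then (t.1, ~~ t.2) else t.

Let swapK : involutive swap.
Proof.
move=> [A c]; rewrite /swap /=; case: (pselect (A = P)) => AP.
  by rewrite asboolT//= asboolT//= negbK.
by rewrite asboolF//= asboolF.
Qed.

Let swap_biject : biject T.
Proof. by apply: (@Biject _ swap); exists swap; exact: swapK. Defined.

Let left_hom : {multiplicative F -> biject T} :=
  HB.pack left_biject (isMultiplicative.Build _ _ left_biject left_mul).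

Let conj_mul : {morph (fun g => swap_biject * left_biject g * swap_biject)%g : g h / (g * h)%g}.
Proof.
move=> g h /=; rewrite left_mul; apply: biject_eq => t.
by rewrite !biject_mulE /= swapK.
Qed.

Let conj_hom : {multiplicative F -> biject T} :=
  HB.pack (fun g => swap_biject * left_biject g * swap_biject)%g
    (isMultiplicative.Build _ _ _ conj_mul).

Let left_P b : B b -> left b (P, true) = (P, true).
Proof.
move=> Bb; congr pair; apply/funext => x; apply/propext; split => /= [h|h].
  by rewrite -(mulVKg b x); exact: PM.
exact: PV.
Qed.

(* Both homomorphisms agree on B, hence everywhere; evaluating them at
   (P, true) shows that every element of F stabilizes P. *)
Lemma free_basis_stable g : P = (fun x => P (g^-1 * x)%g).
Proof.
have [phi h1 h2] := hB left_biject.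
have e1 := h2 left_hom (fun b _ => erefl).
have agree b : B b -> conj_hom b = left_biject b.
  move=> Bb; apply: biject_eq => t; rewrite /= -[RHS]swapK; congr swap.
  have lP := left_P Bb; have lP1 : (fun x => P (b^-1 * x)%g) = P := congr1 fst lP.
  move: t => [A c]; rewrite /swap.
  have [->|nA] := pselect (A = P).
    rewrite /= asboolT//; case: c => /=.
      by rewrite /left /= lP1 asboolT.
    by rewrite lP /= asboolT.
  rewrite /= asboolF//; case: c => /=; last by rewrite asboolF.
  rewrite asboolF// => AP; apply: nA; apply/funext => x.
  have := congr1 (fun A => A (b * x)%g) AP; rewrite /= mulKg => ->.
  by have := congr1 (fun t : T => t.1 (b * x)%g) lP; rewrite /= mulKg.
have e2 := h2 conj_hom agree.
have : left_biject g (P, true) = conj_hom g (P, true).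
  by rewrite (e2 g) -(e1 g).
by rewrite /= /swap /= asboolT//= asboolT//= => -[].
Qed.

Lemma free_basis_ind g : P 1%g -> P g.
Proof.
by move=> P1; have := congr1 (fun A => A g) (free_basis_stable g); rewrite /= mulVg => ->.
Qed.

End Generation.

(** * Reduced words *)

Definition letter := (F * bool)%type.
Implicit Types (w : seq letter) (l : letter).

Definition linv l : letter := (l.1, ~~ l.2).

Lemma linvK : involutive linv. Proof. by case=> b c; rewrite /linv /= negbK. Qed.

Definition reduced w := sorted (fun l l' => l' != linv l) w.

Definition lval l : F := if l.2 then l.1 else l.1^-1%g.

Definition ev w : F := foldr (fun l x => lval l * x)%g 1%g w.

Definition step l w : seq letter :=
  if w is l' :: w' then if l' == linv l then w' else l :: w else [:: l].

Lemma reduced_tail l w : reduced (l :: w) -> reduced w.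
Proof. exact: path_sorted. Qed.

Lemma reduced_step l w : reduced w -> reduced (step l w).
Proof.
case: w => [|l' w] //= h; case: ifPn => [_|n]; first exact: path_sorted h.
by rewrite /reduced /= n.
Qed.

(** When the first letter of w cancels with l, reducedness says that the next letter is not l, so
    [linv l] is put back instead of cancelling again. *)
Lemma stepK l w : reduced w -> step (linv l) (step l w) = w.
Proof.
case: w => [|l' w] /=; first by rewrite linvK eqxx.
case: ifPn => [/eqP ->|n h /=]; last by rewrite linvK eqxx.
by case: w => [|l'' w] //= /andP[/negbTE -> _].
Qed.

Lemma ev_step l w : ev (step l w) = (lval l * ev w)%g.
Proof.
case: w => [|l' w] //=; case: ifPn => [/eqP ->|//] /=.
by case: l => b [] /=; rewrite /lval /= ?mulVKg ?mulKg.
Qed.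

Definition in_basis w := forall l, l \in w -> B l.1.

Lemma in_basis_step l w : B l.1 -> in_basis w -> in_basis (step l w).
Proof.
move=> Bl; case: w => [|l' w] hw l0 /=.
  by rewrite inE => /eqP ->.
case: ifPn => [_ h|_]; first by apply: hw; rewrite inE h orbT.
by rewrite inE => /predU1P[->//|]; exact: hw.
Qed.

Lemma free_group_word g : exists w, [/\ reduced w, in_basis w & ev w = g].
Proof.
apply: (@free_basis_ind (fun g => exists w, [/\ reduced w, in_basis w & ev w = g])).
- move=> b x Bb [w [h1 h2 h3]]; exists (step (b, true) w); split.
  + exact: reduced_step.
  + exact: in_basis_step.
  + by rewrite ev_step h3.
- move=> b x Bb [w [h1 h2 h3]]; exists (step (b, false) w); split.
  + exact: reduced_step.
  + exact: in_basis_step.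
  + by rewrite ev_step h3.
- by exists [::]; split.
Qed.

(** The permutations of van der Waerden's proof of the normal form. Being the identity on words that
    are not reduced makes each of them a bijection of all sequences. *)
Let wstep l w := if reduced w then step l w else w.

Let wstepK l : cancel (wstep l) (wstep (linv l)).
Proof.
move=> w; rewrite /wstep; case hw: (reduced w); last by rewrite hw.
by rewrite reduced_step// stepK.
Qed.

Let wstep_biject (l : letter) : biject (seq letter).
Proof.
apply: (@Biject _ (wstep l)); exists (wstep (linv l)); first exact: wstepK.
by move=> w; rewrite -{1}[l]linvK wstepK.
Defined.

Let wstep_inv l : ((wstep_biject l)^-1)%g = wstep_biject (linv l).
Proof.
apply: (mulgI (wstep_biject l)); rewrite mulgV; apply: biject_eq => w.
by rewrite biject_mulE biject_oneE /= -{1}[l]linvK wstepK.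
Qed.

(* Reading a reduced word off its action on the empty word. *)
Lemma ev_inj w w' : reduced w -> reduced w' -> in_basis w -> in_basis w' ->
  ev w = ev w' -> w = w'.
Proof.
have [phi h _] := hB (fun b => wstep_biject (b, true)).
suff key v : reduced v -> in_basis v -> phi (ev v) [::] = v.
  by move=> r r' b b' e; rewrite -(key w)// e key.
elim: v => [|l v IH] r b /=.
  have -> : phi 1%g = 1%g.
    by apply: (mulgI (phi 1%g)); rewrite -gmulfM !mulg1.
  by rewrite biject_oneE.
have rv := reduced_tail r.
have Bl : B l.1 by apply: b; rewrite inE eqxx.
have -> : phi (lval l * ev v)%g = (wstep_biject l * phi (ev v))%g.
  rewrite gmulfM; congr (_ * _)%g; case: l Bl {r b} => c [] /= Bl; first exact: h.
  rewrite /lval /= -[RHS](@invgK _ (wstep_biject (c, false))) wstep_inv /linv /= -(h c Bl).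
  apply: (mulgI (phi c)); rewrite -gmulfM !mulgV.
  by apply: (mulgI (phi 1%g)); rewrite -gmulfM !mulg1.
rewrite biject_mulE IH//; last by move=> l' l'v; apply: b; rewrite inE l'v orbT.
rewrite /= /wstep rv; case: v r {IH b rv} => [|l' v] //= /andP[+ _].
by move/negbTE => ->.
Qed.

End FreeGroup.

(** * Deformations of the regular representation of a free group *)

Section Rotations.
Variables (R : realType) (F : groupType).
Local Notation D := (option (F * F)).
Local Notation X := (ell2 R D).
Local Notation dl := (@delta R D).
Implicit Types (x y : X) (c s : R) (b g : F).

Definition shiftD g (d : D) : D := if d is Some (v, t) then Some (g^-1 * v, t)%g else None.

Lemma shiftDK g : cancel (shiftD g) (shiftD g^-1%g).
Proof. by case=> [[v t]|] //=; rewrite invgK mulVKg. Qed.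

Lemma shiftDVK g : cancel (shiftD g^-1%g) (shiftD g).
Proof. by case=> [[v t]|] //=; rewrite invgK mulKg. Qed.

Lemma shiftD_bij g : bijective (shiftD g).
Proof. by exists (shiftD g^-1%g); [exact: shiftDK | exact: shiftDVK]. Qed.

Lemma left_shift_summable g x : (fun d => x (shiftD g d)) \in @square_summable R D.
Proof.
rewrite inE; apply: le_lt_trans (sqsum_lty x); rewrite /sqsum.
rewrite [leRHS](@reindex_esum R _ _ setT setT (shiftD g))//.
split=> // [u v _ _|v _]; first exact: (bij_inj (shiftD_bij g)).
by exists (shiftD g^-1%g v) => //; rewrite shiftDVK.
Qed.

Definition left_shift g x : X := Ell2 (left_shift_summable g x).

Lemma left_shiftK g : cancel (left_shift g) (left_shift g^-1%g).
Proof. by move=> x; apply: ell2P => d /=; rewrite shiftDVK. Qed.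

Lemma left_shiftVK g : cancel (left_shift g^-1%g) (left_shift g).
Proof. by move=> x; apply: ell2P => d /=; rewrite shiftDK. Qed.

Lemma left_shiftM g h x : left_shift (g * h)%g x = left_shift g (left_shift h x).
Proof. by apply: ell2P => -[[v t]|] //=; rewrite invgM mulgA. Qed.

Lemma inner_left_shift g x y : <| left_shift g x, left_shift g y |> = <| x, y |>.
Proof. by rewrite /ell2_inner [RHS](reindex_csum _ (shiftD_bij g)). Qed.

Local Notation edge b := (Some (1%g, b) : D).

(* The rotation, by the angle with cosine c and sine s, of the plane spanned by
   the base vector None and by the edge from 1 to b. *)
Definition rot c s b x : X :=
  x + ((c%:C)%C * x None - x None + (s%:C)%C * x (edge b)) *: dl None +
      ((c%:C)%C * x (edge b) - x (edge b) - (s%:C)%C * x None) *: dl (edge b).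

Lemma rotE c s b x d : rot c s b x d =
  if d == None then (c%:C)%C * x None + (s%:C)%C * x (edge b)
  else if d == edge b then (c%:C)%C * x (edge b) - (s%:C)%C * x None else x d.
Proof.
rewrite (_ : rot c s b x d = x d +
   ((c%:C)%C * x None - x None + (s%:C)%C * x (edge b)) * dl None d +
   ((c%:C)%C * x (edge b) - x (edge b) - (s%:C)%C * x None) * dl (edge b) d)//.
rewrite !deltaE; have [->|dN] := eqVneq d None.
  by rewrite mulr1 mulr0 addr0; ring.
by have [->|dE] := eqVneq d (edge b); rewrite ?mulr0 ?mulr1 ?addr0//; ring.
Qed.

Lemma rotK c s b : c ^+ 2 + s ^+ 2 = 1 -> cancel (rot c s b) (rot c (- s) b).
Proof.
move=> cs x; have cs' : (c%:C)%C * (c%:C)%C + (s%:C)%C * (s%:C)%C = 1 :> R[i].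
  by rewrite -!rmorphM -rmorphD -!expr2 cs.
have ns : ((- s)%:C)%C = - (s%:C)%C :> R[i] by rewrite rmorphN.
apply: ell2P => d; rewrite !rotE ns !eqxx /=.
have [->|dN] := eqVneq d None.
  transitivity (((c%:C)%C * (c%:C)%C + (s%:C)%C * (s%:C)%C) * x None); first by ring.
  by rewrite cs' mul1r.
have [->|dE] := eqVneq d (edge b) => //.
transitivity (((c%:C)%C * (c%:C)%C + (s%:C)%C * (s%:C)%C) * x (edge b)); first by ring.
by rewrite cs' mul1r.
Qed.

Lemma inner_rot c s b x y : c ^+ 2 + s ^+ 2 = 1 ->
  <| rot c s b x, rot c s b y |> = <| x, y |>.
Proof.
move=> cs; have cs' : (c%:C)%C * (c%:C)%C + (s%:C)%C * (s%:C)%C = 1 :> R[i].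
  by rewrite -!rmorphM -rmorphD -!expr2 cs.
have rJ (r : R) : ((r%:C)%C : R[i])^* = (r%:C)%C by apply/eqP; rewrite eq_complex /= oppr0 !eqxx.
rewrite /rot !innerD !innerDr !innerZ !innerZr !inner_deltal !inner_delta.
rewrite !deltaE !eqxx /= conjC0 conjC1 !rmorphD !rmorphN !rmorphM /= !rJ.
set p := x None; set q := x (edge b); set p' := (y None)^*; set q' := (y (edge b))^*.
set C := (c%:C)%C in cs' *; set S := (s%:C)%C in cs' *.
transitivity (<| x, y |> + (C * C + S * S - 1) * (p * p' + q * q')); first by ring.
by rewrite cs' subrr mul0r addr0.
Qed.

Lemma rot_close c s b x : 0 <= c <= 1 ->
  ell2_norm (rot c s b x - x) <= 2 * ((1 - c) + `|s|) * ell2_norm x.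
Proof.
move=> /andP[c0 c1].
have hN := coord_le_norm x None; have hE := coord_le_norm x (edge b).
have n0 := ell2_norm_ge0 x.
have cc : normc ((c%:C)%C - 1 : R[i]) = 1 - c.
  rewrite (_ : (c%:C)%C - 1 = ((c - 1)%:C)%C); last by rewrite rmorphB.
  by rewrite normc_real -normrN opprB ger0_norm// subr_ge0.
have ss : normc ((s%:C)%C : R[i]) = `|s| by rewrite normc_real.
have bound (u v : R[i]) : normc u <= ell2_norm x -> normc v <= ell2_norm x ->
    normc (((c%:C)%C - 1) * u + (s%:C)%C * v) <= ((1 - c) + `|s|) * ell2_norm x.
  move=> hu hv; apply: (le_trans (le_normcD _ _)); rewrite !normcM cc ss [leRHS]mulrDl.
  by apply: lerD; apply: ler_wpM2l => //; rewrite subr_ge0.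
rewrite /rot -[x + _ + _]addrA [x + _]addrC addrK; apply: (le_trans (ler_norm2D _ _)).
rewrite !normZ !norm_delta !mulr1 -mulrA mulr_natl mulr2n; apply: lerD.
  rewrite (_ : _ + _ = ((c%:C)%C - 1) * x None + (s%:C)%C * x (edge b)); last by ring.
  exact: bound.
rewrite (_ : _ - _ = ((c%:C)%C - 1) * x (edge b) + (s%:C)%C * (- x None)); last by ring.
by apply: bound => //; rewrite normcN.
Qed.

Definition real_vector x := forall d, complex.Im (x d) = 0.

Lemma rot_real c s b x : real_vector x -> real_vector (rot c s b x).
Proof.
have ImM (r : R) (z : R[i]) : complex.Im z = 0 -> complex.Im ((r%:C)%C * z) = 0.
  by case: z => u v /= ->; rewrite mulr0 mul0r addr0.
move=> rx d; rewrite rotE; case: ifP => _.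
  by rewrite raddfD /= !ImM ?addr0.
by case: ifP => _ //; rewrite raddfB /= !ImM ?subr0.
Qed.

Lemma left_shift_real g x : real_vector x -> real_vector (left_shift g x).
Proof. by move=> rx d; exact: rx. Qed.

Lemma norm_of_inner (T : X -> X) : (forall x y, <| T x, T y |> = <| x, y |>) ->
  forall x, ell2_norm (T x) = ell2_norm x.
Proof.
by move=> h x; apply/eqP; rewrite -(@eqrXn2 _ 2) ?ell2_norm_ge0// !ell2_norm_sq h.
Qed.

Variable (B : set F).
Hypothesis hB : free_basis B.
Variable code : F -> nat.
Hypothesis code_inj : injective code.

Section Representation.
Variable m : R.
Hypotheses (m0 : 0 < m) (m1 : m < 1).

(** The coefficient of a word is the product of the cosines of its letters. An exponent growing with
    the code keeps it c_0 when the basis is infinite, where one common angle would fail along the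
    generators; the successor makes every letter count. *)
Definition cosb b : R := m ^+ (code b).+1.
Definition sinb b : R := Num.sqrt (1 - cosb b ^+ 2).

Lemma cosb_bound b : 0 <= cosb b <= 1.
Proof.
have m0' := ltW m0; have m1' := ltW m1.
by rewrite /cosb exprn_ge0//= exprn_ile1.
Qed.

Lemma cos_sin b : cosb b ^+ 2 + sinb b ^+ 2 = 1.
Proof.
have /andP[c0 c1] := cosb_bound b.
have h : 0 <= 1 - cosb b ^+ 2 by rewrite subr_ge0 exprn_ile1.
by rewrite /sinb (sqr_sqrtr h) addrC subrK.
Qed.

Lemma cos_sinN b : cosb b ^+ 2 + (- sinb b) ^+ 2 = 1.
Proof. by rewrite sqrrN cos_sin. Qed.

Definition gen_act b x := rot (cosb b) (sinb b) b (left_shift b x).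
Definition gen_inv b x := left_shift b^-1%g (rot (cosb b) (- sinb b) b x).

Lemma gen_actK b : cancel (gen_act b) (gen_inv b).
Proof. by move=> x; rewrite /gen_inv rotK ?cos_sin// left_shiftK. Qed.

Lemma gen_invK b : cancel (gen_inv b) (gen_act b).
Proof.
move=> x; rewrite /gen_act left_shiftVK.
by have := rotK b (cos_sinN b) x; rewrite opprK.
Qed.

Definition deformed_rep (pi : F -> X -> X) :=
  [/\ forall x, pi 1%g x = x, forall g h x, pi (g * h)%g x = pi g (pi h x),
      forall b x, B b -> pi b x = gen_act b x &
      forall b x, B b -> pi b^-1%g x = gen_inv b x].

Lemma deformed_rep_exists : exists pi, deformed_rep pi.
Proof.
have gb b : bijective (gen_act b) by exists (gen_inv b); [exact: gen_actK | exact: gen_invK].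
have [phi h _] := hB (fun b => Biject (gb b)).
have p1 : phi 1%g = 1%g by apply: (mulgI (phi 1%g)); rewrite -gmulfM !mulg1.
have pb b x : B b -> phi b x = gen_act b x by move=> /h ->.
exists (fun g => biject_fun (phi g)); split=> //.
- by move=> x; rewrite p1.
- by move=> g k x; rewrite gmulfM.
- move=> b x Bb; apply: (can_inj (gen_actK b)); rewrite gen_invK -pb//.
  by rewrite -biject_mulE -gmulfM mulgV p1.
Qed.

Variable pi : F -> X -> X.
Hypothesis hpi : deformed_rep pi.

Let pi1 x : pi 1%g x = x. Proof. by case: hpi. Qed.
Let piM g h x : pi (g * h)%g x = pi g (pi h x). Proof. by case: hpi. Qed.
Let pib b x : B b -> pi b x = gen_act b x. Proof. by case: hpi => _ _ + _; apply. Qed.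
Let piV b x : B b -> pi b^-1%g x = gen_inv b x. Proof. by case: hpi => _ _ _; apply. Qed.

Lemma rep_inner g x y : <| pi g x, pi g y |> = <| x, y |>.
Proof.
apply: (free_basis_ind hB (P := fun g => forall x y, <| pi g x, pi g y |> = <| x, y |>)).
- move=> b h Bb IH {}x {}y; rewrite !piM !(pib _ Bb) /gen_act inner_rot ?cos_sin//.
  by rewrite inner_left_shift.
- move=> b h Bb IH {}x {}y; rewrite !piM !(piV _ Bb) /gen_inv inner_left_shift.
  by rewrite inner_rot ?cos_sinN.
- by move=> {}x {}y; rewrite !pi1.
Qed.

Lemma rep_norm g x : ell2_norm (pi g x) = ell2_norm x.
Proof. exact: (norm_of_inner (rep_inner g)). Qed.

Lemma rep_real g x : real_vector x -> real_vector (pi g x).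
Proof.
apply: (free_basis_ind hB (P := fun g => forall x, real_vector x -> real_vector (pi g x))).
- by move=> b h Bb IH {}x rx; rewrite piM pib//; apply: rot_real; apply: left_shift_real; exact: IH.
- by move=> b h Bb IH {}x rx; rewrite piM piV//; apply: left_shift_real; apply: rot_real; exact: IH.
- by move=> {}x; rewrite pi1.
Qed.

Definition kap g : X := pi g (dl None).

Lemma kap_inner g h : <| kap g, kap h |> = kap (h^-1 * g)%g None.
Proof.
rewrite -(rep_inner h^-1%g) /kap -!piM mulVg pi1.
by rewrite -inner_delta.
Qed.

Lemma kap_real g : real_vector (kap g).
Proof. by apply: rep_real => d; rewrite deltaE; case: (d == None). Qed.

Definition weight (w : seq (letter F)) := sumn [seq (code l.1).+1 | l <- w].

(** The edge of the Cayley tree crossed by l after the prefix [w1], named by its source; a negative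
    letter crosses it backwards, so the source is the far end. *)
Definition edge_of (w1 : seq (letter F)) (l : letter F) : D :=
  Some (if l.2 then ev w1 else (ev w1 * l.1^-1)%g, l.1).

Lemma in_basis_cons l (w : seq (letter F)) : in_basis B (l :: w) -> B l.1 /\ in_basis B w.
Proof.
by move=> h; split=> [|l' l'w]; apply: h; rewrite inE ?eqxx ?l'w ?orbT.
Qed.

Lemma in_basis_cat (w w' : seq (letter F)) : in_basis B (w ++ w') -> in_basis B w.
Proof. by move=> h l lw; apply: h; rewrite mem_cat lw. Qed.

Lemma reduced_cat (w w' : seq (letter F)) : reduced (w ++ w') -> reduced w.
Proof. by case: w => [|l w] //=; rewrite /reduced /= cat_path => /andP[]. Qed.

(* A new letter meets the plane of its rotation only in the base vector. *)
Lemma kap_word (w : seq (letter F)) : reduced w -> in_basis B w ->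
  kap (ev w) None = ((m ^+ weight w)%:C)%C /\
  forall p, kap (ev w) (Some p) != 0 ->
    exists w1 l w2, w = w1 ++ l :: w2 /\ Some p = edge_of w1 l.
Proof.
elim: w => [|l w IH] rw bw.
  rewrite /= /kap pi1 expr0; split=> // p.
  by rewrite deltaE eqxx.
have [Bl bw'] := in_basis_cons bw; have rw' := reduced_tail rw.
have [kN kS] := IH rw' bw'.
have nostart l2 : l2.1 = l.1 -> l2.2 = ~~ l.2 -> forall w2, w <> l2 :: w2.
  move=> e1 e2 w2 ew; move: rw; rewrite ew /reduced /= => /andP[/eqP + _].
  by apply; case: l2 e1 e2 {ew} => a c /= -> ->.
have lbs : in_basis B [:: linv l] by move=> l'; rewrite inE => /eqP ->.
(* This is the edge coordinate that the rotation for l meets. It vanishes: were it among the edges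
   crossed by w, uniqueness of reduced words would make w begin with the inverse of l. *)
have zero : kap (ev w) (edge_of [::] (linv l)) = 0.
  apply/eqP; apply: contrapT => /negP/kS[w1 [l' [w2 [ew el]]]].
  have rw1 : reduced w1 by move: rw'; rewrite ew; exact: reduced_cat.
  have bw1 : in_basis B w1 by move: bw'; rewrite ew; exact: in_basis_cat.
  have l'l : l'.1 = l.1 by case: el.
  have start1 l2 : l2 = linv l -> w1 <> [:: l2].
    by move=> -> ew1; apply: (nostart (linv l) erefl erefl (l' :: w2)); rewrite ew ew1.
  have empty1 : l'.2 = ~~ l.2 -> w1 <> [::].
    by move=> h ew1; apply: (nostart l' l'l h w2); rewrite ew ew1.
  have b0 : in_basis B [::] by move=> l''; rewrite in_nil.
  have inj0 := ev_inj hB rw1 (erefl : reduced [::]) bw1 b0.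
  have inj1 := ev_inj hB rw1 (erefl : reduced [:: linv l]) bw1 lbs.
  move: el; rewrite /edge_of /= l'l => -[+].
  case e2 : l.2 => /=; case e3 : l'.2 => /= h.
  - by apply: (start1 (linv l)) => //; apply: inj1; rewrite -h /= /lval /= e2 mulg1 mul1g.
  - by apply: empty1; [rewrite e2 e3 | apply: inj0; apply: (mulIg (l.1^-1)%g); rewrite -h].
  - by apply: empty1; [rewrite e2 e3 | apply: inj0; rewrite -h].
  - apply: (start1 (linv l)) => //; apply: inj1.
    by apply: (mulIg (l.1^-1)%g); rewrite -h /= /lval /= e2 mulg1 mulgV.
have wE : weight (l :: w) = ((code l.1).+1 + weight w)%N by [].
have cm : cosb l.1 * m ^+ weight w = m ^+ weight (l :: w) by rewrite wE exprD.
have supp p : kap (ev w) (Some ((lval l)^-1 * p.1, p.2)%g) != 0 ->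
  exists w1 l' w2, l :: w = w1 ++ l' :: w2 /\ Some p = edge_of w1 l'.
  move=> /kS[w1 [l' [w2 [ew [e1 e2]]]]]; exists (l :: w1), l', w2; split; first by rewrite ew.
  rewrite /edge_of -e2 [p]surjective_pairing /=; congr (Some (_, _)).
  by rewrite -[in LHS](mulVKg (lval l) p.1) e1 -e2; case: ifP => _; rewrite ?mulgA.
have start : exists w1 l' w2, l :: w = w1 ++ l' :: w2 /\ edge_of [::] l = edge_of w1 l'.
  by exists [::], l, w.
rewrite [ev _]/= /kap piM -/(kap _).
case: l Bl bw rw zero wE cm supp start {nostart lbs} => b [] /= Bb _ _ zero wE cm supp start.
  rewrite /lval /= (pib _ Bb) /gen_act; split=> [|p].
    rewrite rotE eqxx.
    have -> : left_shift b (kap (ev w)) None = ((m ^+ weight w)%:C)%C by exact: kN.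
    have -> : left_shift b (kap (ev w)) (Some (1%g, b)) = kap (ev w) (edge_of [::] (b, false)).
      by rewrite /edge_of /= mulg1 mul1g.
    by rewrite zero mulr0 addr0 -rmorphM cm.
  rewrite rotE (_ : (Some p == None) = false)//.
  have [->|_] := eqVneq (Some p) (edge b); first by move=> _; exact: start.
  by case: p => v t h; apply: supp; rewrite /lval.
rewrite /lval /= (piV _ Bb) /gen_inv; split=> [|p].
  rewrite (_ : left_shift _ _ None = rot (cosb b) (- sinb b) b (kap (ev w)) None)//.
  by rewrite rotE eqxx kN zero mulr0 addr0 -rmorphM cm.
case: p => v t; rewrite (_ : left_shift _ _ _ =
  rot (cosb b) (- sinb b) b (kap (ev w)) (Some (b^-1^-1 * v, t)%g))// rotE (_ : (Some _ == None) = false)//.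
have [[e1 ->] _|_ h] := eqVneq (Some _) (edge b); last by apply: supp; rewrite /lval.
have -> : v = b^-1%g by apply: (mulgI b); rewrite mulgV -e1 invgK.
by have := start; rewrite /edge_of /= mul1g.
Qed.

(** The weight bounds both the length of a word and the codes of its letters, so only finitely many
    reduced words have weight below K. *)
Lemma kap_word_bound (K : nat) : exists A : {fset F}, forall g, g \notin A ->
  exists2 k, (K <= k)%N & kap g None = ((m ^+ k)%:C)%C.
Proof.
pose letters : seq (letter F) :=
  flatten [seq (if pselect (exists b, code b = k) is left h then
             [:: (projT1 (cid h), true); (projT1 (cid h), false)] else [::]) | k <- iota 0 K].
have lettersP l : (code l.1 < K)%N -> l \in letters.
  move=> lK; apply/flatten_mapP; exists (code l.1); first by rewrite mem_iota add0n.
  case: pselect => [h|[]]; last by exists l.1.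
  have -> : projT1 (cid h) = l.1 by apply: code_inj; exact: (projT2 (cid h)).
  by case: l {lK h} => b []; rewrite !inE eqxx ?orbT.
pose words := fix words n : seq (seq (letter F)) :=
  if n is n'.+1 then [::] :: [seq l :: w | l <- letters, w <- words n'] else [:: [::]].
have wordsP w n : (weight w < K)%N -> (size w <= n)%N -> w \in words n.
  elim: w n => [|l w IH] [|n] //=; rewrite ?inE ?eqxx// ltnS => hw hn.
  have [h1 h2] : (code l.1 < K)%N /\ (weight w < K)%N.
    by move: hw; rewrite /weight /=; lia.
  apply/orP; right; apply/allpairsP; exists (l, w); split=> //=; first exact: lettersP.
  exact: IH.
exists [fset x in [seq ev w | w <- words K]]%fset => g.
have [w [rw bw <-]] := free_group_word hB g.
have [kw _] := kap_word rw bw; rewrite kw => h.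
exists (weight w) => //; rewrite leqNgt; apply: contra h => wK.
rewrite !inE; apply/mapP; exists w => //; apply: wordsP => //.
apply: leq_trans (ltnW wK); elim: (w) => [|l w' IH] //=.
by rewrite /weight /= addSn ltnS (leq_trans IH)// leq_addl.
Qed.

End Representation.
End Rotations.

Lemma esum_inj_le (R : realType) (J J' : choiceType) (e : J' -> J) (u : J -> R) :
  injective e -> (forall j, 0 <= u j) ->
  (\esum_(j in [set: J']) (u (e j))%:E <= \esum_(j in [set: J]) (u j)%:E)%E.
Proof.
move=> ei u0; rewrite -(@reindex_esum R J' J setT (range e) e (fun j => (u j)%:E)).
  rewrite esum_mkcond; apply: le_esum => j _; case: ifP => _ //; by rewrite lee_fin.
by split=> [x _|x y _ _ /ei|] //; exists x.
Qed.

Local Notation Re := complex.Re.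

(** * The kernel of the deformed representation as the angles tend to zero *)

Section FreeKernel.
Variables (R : realType) (F : groupType) (B : set F).
Hypothesis hB : free_basis B.
Variable code : F -> nat.
Hypothesis code_inj : injective code.

(** The offset 2 keeps the value strictly between 0 and 1 for every n, starting from 1/2. *)
Definition base_cos (n : nat) : R := 1 - n.+2%:R^-1.

Lemma base_cos_gt0 n : 0 < base_cos n.
Proof. by rewrite subr_gt0 invf_lt1 ?ltr1n. Qed.

Lemma base_cos_lt1 n : base_cos n < 1.
Proof. by rewrite ltrBlDr ltrDl invr_gt0. Qed.

Lemma bernoulli (a : R) k : 0 <= a <= 1 -> 1 - a ^+ k <= k%:R * (1 - a).
Proof.
move=> /andP[a0 a1]; elim: k => [|k IH]; first by rewrite expr0 subrr mul0r.
have e : 1 - a ^+ k.+1 = (1 - a) + a * (1 - a ^+ k) by rewrite exprS; ring.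
rewrite e -natr1 mulrDl mul1r addrC lerD2r; apply: le_trans IH.
by rewrite ler_piMl// subr_ge0 exprn_ile1.
Qed.

Lemma base_cos_pow k (t : R) : 0 < t ->
  exists n0, forall n, (n0 <= n)%N -> 1 - base_cos n ^+ k <= t.
Proof.
move=> t0; have kt : 0 <= k%:R / t by rewrite divr_ge0// ltW.
exists (Num.truncn (k%:R / t)).+1 => n hn.
have b0 := ltW (base_cos_gt0 n); have b1 := ltW (base_cos_lt1 n).
apply: (le_trans (bernoulli k _)); first by rewrite b0.
rewrite /base_cos opprB addrC subrK ler_pdivrMr ?ltr0n// mulrC -ler_pdivrMr//.
apply: (le_trans (ltW (truncnS_gt _))); rewrite ler_nat.
by apply: (leq_trans hn); rewrite ltnW.
Qed.

Lemma pow_small (a e : R) : 0 < a < 1 -> 0 < e -> exists k, a ^+ k <= e.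
Proof.
move=> /andP[a0 a1] e0; have h : 0 < a^-1 - 1 by rewrite subr_gt0 invf_gt1.
have grow k : k%:R * (a^-1 - 1) <= a^-1 ^+ k.
  elim: k => [|k IH]; first by rewrite mul0r expr0 ler01.
  have p1 : 1 <= a^-1 ^+ k by rewrite exprn_ege1// ltW// invf_gt1.
  rewrite exprS -natr1 mulrDl mul1r.
  rewrite (_ : a^-1 * _ = a^-1 ^+ k + (a^-1 - 1) * a^-1 ^+ k); last by ring.
  by apply: lerD => //; rewrite ler_peMr// ltW.
exists (Num.truncn (e^-1 / (a^-1 - 1))).+1; set k := _.+1.
have ak : 0 < a ^+ k by rewrite exprn_gt0.
rewrite -[e]invrK -[a ^+ k]invrK lef_pV2 ?posrE ?invr_gt0//.
rewrite -exprVn; apply: le_trans (grow k); rewrite -ler_pdivrMr//.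
exact/ltW/truncnS_gt.
Qed.

Lemma rot_small b (t : R) : 0 < t -> exists n0, forall n, (n0 <= n)%N ->
  2 * ((1 - cosb code (base_cos n) b) + sinb code (base_cos n) b) <= t.
Proof.
move=> t0; have t4 : 0 < t / 4 by rewrite divr_gt0.
(* The sine satisfies s^2 = (1 - c)(1 + c) <= 2 (1 - c), so 1 - c below this threshold makes s at
   most t/4. *)
have u0 : 0 < (t / 4) ^+ 2 / 2 by rewrite divr_gt0// exprn_gt0.
have [n1 h1] := base_cos_pow (code b).+1 t4.
have [n2 h2] := base_cos_pow (code b).+1 u0.
exists (maxn n1 n2) => n; rewrite geq_max => /andP[/h1 {}h1 /h2 {}h2].
rewrite -/(cosb code (base_cos n) b) in h1 h2.
have /andP[c0 c1] := cosb_bound code (base_cos_gt0 n) (base_cos_lt1 n) b.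
have hs : sinb code (base_cos n) b <= t / 4.
  rewrite /sinb -[leRHS]ger0_norm; last exact: ltW.
  rewrite -sqrtr_sqr ler_wsqrtr//; move: (cosb _ _ _) c0 c1 h2 => c c0 c1 h2.
  rewrite (_ : 1 - c ^+ 2 = (1 - c) * (1 + c)); last by ring.
  apply: (@le_trans _ _ ((1 - c) * 2)); last by rewrite -ler_pdivlMr.
  by apply: ler_wpM2l; [rewrite subr_ge0 | rewrite -[2]/(1 + 1) lerD2l].
move: (cosb _ _ _) (sinb _ _ _) h1 hs => c s h1 hs.
have e : t = 2 * (t / 4 + t / 4) by field.
by rewrite {1}e; apply: ler_wpM2l => //; exact: lerD.
Qed.

Definition rep n : F -> ell2 R (option (F * F)) -> ell2 R (option (F * F)) :=
  projT1 (cid (deformed_rep_exists hB code (base_cos_gt0 n) (base_cos_lt1 n))).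

Lemma repP n : deformed_rep B code (base_cos n) (rep n).
Proof. exact: projT2 (cid _). Qed.

(** Convergence in operator norm: the index is chosen before x, so that the resulting defect of
    equivariance is uniform over the group. *)
Definition rep_close (g : F) := forall t : R, 0 < t ->
  exists n0, forall n, (n0 <= n)%N -> forall x,
    ell2_norm (rep n g x - left_shift g x) <= t * ell2_norm x.

Lemma left_shiftB g (x y : ell2 R (option (F * F))) :
  left_shift g (x - y) = left_shift g x - left_shift g y.
Proof. exact: ell2P. Qed.

Lemma norm_left_shift g (x : ell2 R (option (F * F))) : ell2_norm (left_shift g x) = ell2_norm x.
Proof. exact: (norm_of_inner (inner_left_shift g)). Qed.

Lemma rep_closeP g : rep_close g.
Proof.
have nr n h x : ell2_norm (rep n h x) = ell2_norm x.
  exact: (rep_norm hB (base_cos_gt0 n) (base_cos_lt1 n) (repP n)).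
have s0 n b : 0 <= sinb code (base_cos n) b by exact: sqrtr_ge0.
have cb n b := cosb_bound code (base_cos_gt0 n) (base_cos_lt1 n) b.
have half (t : R) (x : ell2 R (option (F * F))) :
    t * ell2_norm x = t / 2 * ell2_norm x + t / 2 * ell2_norm x.
  by rewrite -mulrDl -splitr.
apply: (free_basis_ind hB (P := rep_close)) => [b h Bb IH t t0|b h Bb IH t t0|t t0].
- have t2 : 0 < t / 2 by rewrite divr_gt0.
  have [n1 h1] := IH _ t2; have [n2 h2] := rot_small b t2.
  exists (maxn n1 n2) => n; rewrite geq_max => /andP[/h1 {}h1 /h2 {}h2] x.
  have [_ pM pb _] := repP n; rewrite pM (pb _ _ Bb) left_shiftM.
  apply: (le_trans (ler_dist2D _ _ (left_shift b (rep n h x)))).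
  rewrite half; apply: lerD; last by rewrite -left_shiftB norm_left_shift.
  apply: (le_trans (rot_close _ _ _ (cb n b))); rewrite norm_left_shift nr.
  by rewrite ger0_norm//; apply: ler_wpM2r => //; exact: ell2_norm_ge0.
- have t2 : 0 < t / 2 by rewrite divr_gt0.
  have [n1 h1] := IH _ t2; have [n2 h2] := rot_small b t2.
  exists (maxn n1 n2) => n; rewrite geq_max => /andP[/h1 {}h1 /h2 {}h2] x.
  have [_ pM _ pV] := repP n; rewrite pM (pV _ _ Bb) left_shiftM.
  rewrite -left_shiftB norm_left_shift.
  apply: (le_trans (ler_dist2D _ _ (rep n h x))).
  rewrite half; apply: lerD => //.
  apply: (le_trans (rot_close _ _ _ (cb n b))); rewrite nr.
  by rewrite normrN ger0_norm//; apply: ler_wpM2r => //; exact: ell2_norm_ge0.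
- exists 0%N => n _ x; have [p1 _ _ _] := repP n; rewrite p1.
  have -> : left_shift 1%g x = x by apply: ell2P => -[[v w]|] //=; rewrite invg1 mul1g.
  by rewrite subrr ell2_norm0 mulr_ge0 ?ell2_norm_ge0// ltW.
Qed.

Definition ker n x : ell2 R (option (F * F)) := kap (rep n) x.
Definition phase n x : R := Re (ker n x None).
Definition edgew n x (p : F * F) : R := Re (ker n x (Some p)).

Lemma ker_real n x : real_vector (ker n x).
Proof. exact: (kap_real hB (repP n)). Qed.

Lemma phase_word n x : exists k, phase n x = base_cos n ^+ k.
Proof.
have [w [rw bw <-]] := free_group_word hB x.
by exists (weight code w); rewrite /phase; have [-> _] := kap_word hB (repP n) rw bw.
Qed.

Lemma phase_ge0 n x : 0 <= phase n x.
Proof. by have [k ->] := phase_word n x; exact/exprn_ge0/ltW/base_cos_gt0. Qed.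

Lemma phase_le1 n x : phase n x <= 1.
Proof.
have [k ->] := phase_word n x.
by apply: exprn_ile1; [exact/ltW/base_cos_gt0 | exact/ltW/base_cos_lt1].
Qed.

Lemma phase1 n : phase n 1%g = 1.
Proof. by rewrite /phase /ker /kap; have [-> _ _ _] := repP n. Qed.

Lemma phase_cvg x (t : R) : 0 < t -> exists n0, forall n, (n0 <= n)%N -> 1 - phase n x <= t.
Proof.
move=> t0; have [w [rw bw <-]] := free_group_word hB x.
have [n0 h] := base_cos_pow (weight code w) t0; exists n0 => n /h.
by rewrite /phase; have [-> _] := kap_word hB (repP n) rw bw.
Qed.

Lemma phase_c0 n (e : R) : 0 < e -> exists A : {fset F}, forall x, x \notin A -> phase n x <= e.
Proof.
move=> e0; have a01 : 0 < base_cos n < 1 by rewrite base_cos_gt0 base_cos_lt1.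
have [K hK] := pow_small a01 e0.
have [A hA] := kap_word_bound hB code_inj (base_cos_gt0 n) (base_cos_lt1 n) (repP n) K.
exists A => x /hA[k Kk]; rewrite /phase => ->; apply: le_trans hK => /=.
by have := ler_wiXn2l (ltW (base_cos_gt0 n)) (ltW (base_cos_lt1 n)) Kk.
Qed.

Lemma sqsum_real (x : ell2 R (option (F * F))) : real_vector x ->
  sqsum x = (\esum_(d in [set: option (F * F)]) (Re (x d) ^+ 2)%:E)%E.
Proof.
by move=> rx; apply: eq_esum => d _; rewrite normcE2 rx expr0n addr0.
Qed.

(** Pythagoras: the full Gram matrix, computed from invariance of the inner product, minus the
    contribution of the coordinate at the base vector. *)
Lemma edgew_gram n (I : Type) (r : seq I) (z : I -> R) (x : I -> F) :
  (\esum_(p in [set: F * F]) ((\sum_(i <- r) z i * edgew n (x i) p) ^+ 2)%:E =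
   (\sum_(i <- r) \sum_(j <- r) z i * z j * phase n ((x j)^-1 * x i)%g -
     (\sum_(i <- r) z i * phase n (x i)) ^+ 2)%:E)%E.
Proof.
pose y := \sum_(i <- r) ((z i)%:C)%C *: ker n (x i).
have ReM (a : R) (w : R[i]) : Re ((a%:C)%C * w) = a * Re w.
  by case: w => u v /=; rewrite mul0r subr0.
have yE d : y d = \sum_(i <- r) ((z i)%:C)%C * ker n (x i) d.
  by rewrite /y; elim/big_rec2: _ => // i a b _ <-.
have Rey d : Re (y d) = \sum_(i <- r) z i * Re (ker n (x i) d).
  by rewrite yE raddf_sum; apply: eq_bigr => i _; exact: ReM.
have ry : real_vector y.
  move=> d; rewrite yE raddf_sum big1// => i _.
  by have := ker_real n (x i) d; case: (ker n _ d) => u v /= ->; rewrite mulr0 mul0r addr0.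
have total : ell2_norm y ^+ 2 = \sum_(i <- r) \sum_(j <- r) z i * z j * phase n ((x j)^-1 * x i)%g.
  rewrite ell2_norm_sq /y inner_suml raddf_sum; apply: eq_bigr => i _.
  rewrite inner_sumr raddf_sum; apply: eq_bigr => j _.
  rewrite innerZ innerZr (kap_inner hB (base_cos_gt0 n) (base_cos_lt1 n) (repP n)).
  have -> : ((z j)%:C)%C^* = ((z j)%:C)%C :> R[i] by apply/eqP; rewrite eq_complex /= oppr0 !eqxx.
  by rewrite /= ReM ReM mulrA.
have := sqsum_real ry; rewrite -ell2_normE total.
rewrite (esumID [set None])//; last by move=> d _; rewrite lee_fin sqr_ge0.
rewrite setTI esum_set1; last by rewrite lee_fin sqr_ge0.
have -> : (\esum_(d in setT `&` ~` [set None]) (Re (y d) ^+ 2)%:E =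
   \esum_(p in [set: F * F]) ((\sum_(i <- r) z i * edgew n (x i) p) ^+ 2)%:E)%E.
  rewrite (@reindex_esum R (F * F)%type (option (F * F)) setT _ Some).
  - by apply: eq_esum => p _; rewrite Rey.
  - split=> [p _|p q _ _ []//|[p [_ _]|[_ /(_ erefl)//]]]; first by split.
    by exists p.
rewrite Rey -/(phase n _) => e; rewrite EFinB e addrAC subee ?add0e//.
Qed.

(** The kernel at g x is the deformed representation of g applied to the kernel at x; comparing with
    plain translation on the edges leaves the difference of the two operators. *)
Lemma edgew_shift n g x : (\esum_(p in [set: F * F])
    ((edgew n x p - edgew n (g * x)%g (g * p.1, p.2)%g) ^+ 2)%:E <=
  (ell2_norm (rep n g (ker n x) - left_shift g (ker n x)) ^+ 2)%:E)%E.
Proof.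
pose v := ker n x - left_shift g^-1%g (ker n (g * x)%g).
have -> : ell2_norm (rep n g (ker n x) - left_shift g (ker n x)) = ell2_norm v.
  rewrite -(norm_left_shift g v) /v left_shiftB left_shiftVK normBC.
  by have [_ pM _ _] := repP n; rewrite [in RHS]/ker /kap pM.
rewrite ell2_normE; apply: (@le_trans _ _ (\esum_(p in [set: F * F])
   ((fun d => normc (v d) ^+ 2) (Some p))%:E)%E); last first.
  by apply: (@esum_inj_le R _ _ Some (fun d => normc (v d) ^+ 2)) => [p q []|d] //; exact: sqr_ge0.
apply: le_esum => p _; rewrite lee_fin.
have -> : edgew n x p - edgew n (g * x)%g (g * p.1, p.2)%g = Re (v (Some p)).
  rewrite (_ : v (Some p) = ker n x (Some p) - ker n (g * x)%g (shiftD g^-1%g (Some p)))//.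
  by rewrite raddfB /edgew; case: p => a b /=; rewrite invgK.
by rewrite -[leLHS]real_normK ?num_real// ler_sqr ?nnegrE ?normc_ge0// normc_Re.
Qed.

(** The crude bound (1 + 1)^2 for two unit vectors; it makes the supremum [max_defect] finite and
    serves as the dominating constant. *)
Lemma edgew_shift_le4 n g x : (\esum_(p in [set: F * F])
    ((edgew n x p - edgew n (g * x)%g (g * p.1, p.2)%g) ^+ 2)%:E <= 4%:E)%E.
Proof.
apply: (le_trans (edgew_shift n g x)); rewrite lee_fin.
have n1 : ell2_norm (ker n x) = 1.
  by rewrite (rep_norm hB (base_cos_gt0 n) (base_cos_lt1 n) (repP n)) norm_delta.
have h := ler_norm2B (rep n g (ker n x)) (left_shift g (ker n x)).
move: h; rewrite (rep_norm hB (base_cos_gt0 n) (base_cos_lt1 n) (repP n)) norm_left_shift n1 => h.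
rewrite (_ : 4 = (1 + 1) ^+ 2 :> R); last by ring.
by rewrite ler_sqr ?nnegrE ?ell2_norm_ge0// addr_ge0.
Qed.

Lemma edgew_shift_cvg g (t : R) : 0 < t -> exists n0, forall n, (n0 <= n)%N -> forall x,
  (\esum_(p in [set: F * F])
    ((edgew n x p - edgew n (g * x)%g (g * p.1, p.2)%g) ^+ 2)%:E <= t%:E)%E.
Proof.
move=> t0; have st : 0 < Num.sqrt t by rewrite sqrtr_gt0.
have [n0 h] := rep_closeP g st; exists n0 => n /h {}h x.
apply: (le_trans (edgew_shift n g x)); rewrite lee_fin.
have := h (ker n x).
rewrite (rep_norm hB (base_cos_gt0 n) (base_cos_lt1 n) (repP n)) norm_delta mulr1 => hx.
by rewrite -[leRHS](sqr_sqrtr (ltW t0)) ler_sqr ?nnegrE ?ell2_norm_ge0// ltW.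
Qed.

End FreeKernel.

(** * Vectors with a given Gram matrix *)

Section Cholesky.
Variable R : realType.

Definition psd (P : Type) (K : P -> P -> R) :=
  forall s : seq (P * R), 0 <= \sum_(u <- s) \sum_(v <- s) u.2 * v.2 * K u.1 v.1.

Section Elimination.
Variable K : nat -> nat -> R.
Hypotheses (Ksym : forall n m, K n m = K m n) (Kpsd : psd K).

Lemma psd_cons j (t : R) (s : seq (nat * R)) :
  \sum_(u <- (j, t) :: s) \sum_(v <- (j, t) :: s) u.2 * v.2 * K u.1 v.1 =
  t ^+ 2 * K j j + 2 * t * (\sum_(u <- s) u.2 * K u.1 j) +
  \sum_(u <- s) \sum_(v <- s) u.2 * v.2 * K u.1 v.1.
Proof.
rewrite big_cons big_cons /=.
rewrite [X in _ + X = _](_ : _ = \sum_(u <- s) (t * (u.2 * K u.1 j) +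
    \sum_(v <- s) u.2 * v.2 * K u.1 v.1)); last first.
  by apply: eq_bigr => u _; rewrite big_cons /=; congr (_ + _); ring.
rewrite big_split /= -mulr_sumr.
have -> : \sum_(v <- s) t * v.2 * K j v.1 = t * \sum_(u <- s) u.2 * K u.1 j.
  by rewrite mulr_sumr; apply: eq_bigr => u _; rewrite Ksym mulrA.
ring.
Qed.

Lemma psd_diag j : 0 <= K j j.
Proof. by have := Kpsd [:: (j, 1)]; rewrite !big_seq1 /= !mul1r. Qed.

(** With a zero diagonal entry the form on j and n is affine in the coefficient of j, so it stays
    nonnegative only if its slope is zero; otherwise the coefficient chosen in the proof gives
    -1. *)
Lemma psd_zero j n : K j j = 0 -> K n j = 0.
Proof.
move=> K0; apply/eqP; apply: contrapT => /negP kn.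
have h t : 0 <= 2 * t * K n j + K n n.
  by have := Kpsd [:: (j, t); (n, 1)]; rewrite psd_cons !big_seq1 /= !mul1r K0 mulr0 add0r.
have := h (- (K n n + 1) / (2 * K n j)).
rewrite (_ : _ + _ = -1); last by field.
by rewrite oppr_ge0 ler10.
Qed.

(** The Schur complement at j. If [K j j] is 0, division by zero gives 0 and nothing is removed, in
    accordance with [psd_zero]. *)
Definition eliminate j n m : R := K n m - K n j * K m j / K j j.

Lemma eliminate_sym j n m : eliminate j n m = eliminate j m n.
Proof. by rewrite /eliminate Ksym [K n j * _]mulrC. Qed.

Lemma eliminate_psd j : psd (eliminate j).
Proof.
move=> s; set L := \sum_(u <- s) u.2 * K u.1 j.
have -> : \sum_(u <- s) \sum_(v <- s) u.2 * v.2 * eliminate j u.1 v.1 =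
    \sum_(u <- s) \sum_(v <- s) u.2 * v.2 * K u.1 v.1 - L ^+ 2 / K j j.
  rewrite expr2 {1}/L mulr_suml mulr_suml -sumrB; apply: eq_bigr => u _.
  rewrite /L mulr_sumr mulr_suml -sumrB; apply: eq_bigr => v _.
  by rewrite /eliminate; ring.
have [K0|K0] := eqVneq (K j j) 0; first by rewrite K0 invr0 mulr0 subr0 Kpsd.
(* The coefficient given to j minimizes the form, and the minimum is the form of the Schur
   complement. *)
have := Kpsd ((j, - L / K j j) :: s); rewrite psd_cons -/L.
by congr (0 <= _); field.
Qed.

Lemma eliminate_zero j n : eliminate j n j = 0.
Proof.
have [K0|K0] := eqVneq (K j j) 0.
  by rewrite /eliminate (psd_zero n K0) mul0r mul0r subrr.
by rewrite /eliminate mulfK// subrr.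
Qed.

Lemma eliminate_keep j i n : (forall k, K k i = 0) -> eliminate j n i = 0.
Proof. by move=> K0; rewrite /eliminate (Ksym i j) !K0 mulr0 mul0r subrr. Qed.

Lemma eliminateE j n m :
  K n m = K n j / Num.sqrt (K j j) * (K m j / Num.sqrt (K j j)) + eliminate j n m.
Proof.
have h : (Num.sqrt (K j j) ^+ 2)^-1 = (K j j)^-1 by rewrite (sqr_sqrtr (psd_diag j)).
rewrite /eliminate -h expr2 invfM; ring.
Qed.

End Elimination.

Fixpoint schur (K : nat -> nat -> R) j : nat -> nat -> R :=
  if j is j'.+1 then eliminate (schur K j') j' else K.

Definition chol K n j : R := schur K j n j / Num.sqrt (schur K j j j).

Lemma schurP K : (forall n m, K n m = K m n) -> psd K -> forall j,
  [/\ forall n m, schur K j n m = schur K j m n, psd (schur K j) &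
      forall i n, (i < j)%N -> schur K j n i = 0].
Proof.
move=> Ks Kp; elim=> [|j [IHs IHp IHz]] //=; split.
- exact: eliminate_sym.
- exact: eliminate_psd.
move=> i n; rewrite ltnS leq_eqVlt => /predU1P[->|ij]; first exact: eliminate_zero.
by apply: eliminate_keep => // k; exact: IHz.
Qed.

(** Each elimination splits off a rank one term; after N of them the rows and columns below N of the
    remainder vanish. *)
Lemma chol_sum K : (forall n m, K n m = K m n) -> psd K -> forall N n m,
  (n < N)%N -> K n m = \sum_(j < N) chol K n j * chol K m j.
Proof.
move=> Ks Kp N n m nN.
have h N' : K n m = \sum_(j < N') chol K n j * chol K m j + schur K N' n m.
  elim: N' => [|N' ->]; first by rewrite big_ord0 add0r.
  have [hs hp _] := schurP Ks Kp N'.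
  by rewrite big_ord_recr /= -addrA -eliminateE.
have [hs _ hz] := schurP Ks Kp N.
by rewrite [LHS](h N) hs hz// addr0.
Qed.

Lemma esum_nat_trunc (u : nat -> R) N : (forall j, 0 <= u j) -> (forall j, (N <= j)%N -> u j = 0) ->
  (\esum_(j in [set: nat]) (u j)%:E = (\sum_(j < N) u j)%:E)%E.
Proof.
move=> u0 uz; rewrite -nneseries_esumT; last by move=> j; rewrite lee_fin.
rewrite (nneseries_split 0 N); last by move=> j _; rewrite lee_fin.
rewrite add0n eseries0 ?adde0; last by move=> j /= Nj _; rewrite uz.
by rewrite big_mkord sumEFin.
Qed.

(* The vectors are the rows of the triangular factor of K. *)
Lemma cholesky (P : Type) (K : P -> P -> R) (c : P -> nat) (q : nat -> P) :
  cancel c q -> (forall a b, K a b = K b a) -> psd K ->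
  exists e : P -> nat -> R, forall (I : Type) (r : seq I) (x : I -> R) (p : I -> P),
    (\esum_(j in [set: nat]) ((\sum_(i <- r) x i * e (p i) j) ^+ 2)%:E =
     (\sum_(i <- r) \sum_(k <- r) x i * x k * K (p i) (p k))%:E)%E.
Proof.
move=> cq Ks Kp; pose K' n m := K (q n) (q m).
have Ks' n m : K' n m = K' m n by exact: Ks.
have Kp' : psd K'.
  by move=> s; have := Kp [seq (q u.1, u.2) | u <- s]; rewrite big_map; under eq_bigr do rewrite big_map.
exists (fun p => chol K' (c p)) => I r x p.
pose N := (\max_(i <- r) c (p i)).+1.
have cN i : i \in [seq c (p i) | i <- r] -> (i < N)%N.
  by move=> ir; rewrite /N ltnS -(big_map (fun i => c (p i)) xpredT id); exact: leq_bigmax_seq.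
pose y := [seq (c (p i), x i) | i <- r].
have e1 j : \sum_(i <- r) x i * chol K' (c (p i)) j = \sum_(u <- y) u.2 * chol K' u.1 j.
  by rewrite big_map.
have e2 : \sum_(i <- r) \sum_(k <- r) x i * x k * K (p i) (p k) =
    \sum_(u <- y) \sum_(v <- y) u.2 * v.2 * K' u.1 v.1.
  by rewrite big_map; apply: eq_bigr => i _; rewrite big_map; apply: eq_bigr => k _; rewrite /K' !cq.
have yN u : u \in y -> (u.1 < N)%N.
  by move=> /(map_f fst); rewrite -map_comp; exact: cN.
rewrite e2.
have -> : (\esum_(j in [set: nat]) ((\sum_(i <- r) x i * chol K' (c (p i)) j) ^+ 2)%:E =
   \esum_(j in [set: nat]) ((\sum_(u <- y) u.2 * chol K' u.1 j) ^+ 2)%:E)%E.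
  by apply: eq_esum => j _; rewrite e1.
rewrite (@esum_nat_trunc _ N); last 2 first.
- by move=> j; exact: sqr_ge0.
- move=> j Nj; rewrite big_seq big1 ?expr0n// => u /yN uN.
  have [hs _ hz] := schurP Ks' Kp' j.
  by rewrite /chol hs hz ?mul0r ?mulr0// (leq_trans uN).
congr EFin; under eq_bigr do rewrite expr2 mulr_suml.
rewrite exchange_big /=; apply: eq_big_seq => u /yN uN.
under eq_bigr do rewrite mulr_sumr.
rewrite exchange_big /=; apply: eq_bigr => v _.
rewrite (chol_sum Ks' Kp' _ uN) mulr_sumr; apply: eq_bigr => j _; ring.
Qed.

End Cholesky.

(** * Fundamental domains *)

Section CountableSums.
Variables (R : realType) (I : choiceType) (c : I -> nat).
Hypothesis cI : injective c.
Local Open Scope ereal_scope.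

Lemma code_fiber n : (exists i, [set i | c i = n] = [set i]) \/ [set i | c i = n] = set0.
Proof.
have [[i ci]|h] := pselect (exists i, c i = n); [left|right].
  by exists i; apply/seteqP; split=> [j /= cj|j /= ->//]; apply: cI; rewrite ci.
by apply/seteqP; split=> // i ci; apply: h; exists i.
Qed.

(** Fibers of the code have at most one element, so an unordered sum becomes a series over [nat], to
    which monotone convergence applies. *)
Lemma esum_code (a : I -> \bar R) : (forall i, 0 <= a i) ->
  \esum_(i in [set: I]) a i = \sum_(0 <= n <oo) \esum_(i in [set i | c i = n]) a i.
Proof.
move=> a0; rewrite nneseries_esumT; last by move=> n; apply: esum_ge0.
rewrite -esum_bigcupT//.
  by congr (esum _ _); apply/seteqP; split=> // i _; exists (c i).
by move=> n m _ _ [i [/= <- <-]].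
Qed.

Variables (d : measure_display) (S : measurableType d) (nu : {measure set S -> \bar R}).
Variables (D : set S) (u : I -> S -> \bar R).
Hypotheses (mD : measurable D) (mu : forall i, measurable_fun D (u i)).
Hypothesis u0 : forall i s, 0 <= u i s.

Lemma measurable_fiber_esum n : measurable_fun D (fun s => \esum_(i in [set i | c i = n]) u i s).
Proof.
have [[i ->]| ->] := code_fiber n.
  rewrite (_ : (fun s => _) = u i)//; apply/funext => s; exact: esum_set1.
rewrite (_ : (fun s => _) = cst 0) //; apply/funext => s; exact: esum_set0.
Qed.

Lemma measurable_esum : measurable_fun D (fun s => \esum_(i in [set: I]) u i s).
Proof.
rewrite (_ : (fun s => _) =
   (fun s => \sum_(0 <= n <oo) \esum_(i in [set i | c i = n]) u i s)); last first.
  by apply/funext => s; rewrite esum_code.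
apply: ge0_emeasurable_sum => [n s _ _|n _]; first exact: esum_ge0.
exact: measurable_fiber_esum.
Qed.

Lemma integral_esum : \int[nu]_(s in D) (\esum_(i in [set: I]) u i s) =
  \esum_(i in [set: I]) \int[nu]_(s in D) u i s.
Proof.
under eq_integral do rewrite esum_code//.
rewrite integral_nneseries//; last 2 first.
- exact: measurable_fiber_esum.
- by move=> n s _; exact: esum_ge0.
rewrite esum_code; last by move=> i; apply: integral_ge0.
apply: eq_eseriesr => n _; have [[i ->]| ->] := code_fiber n.
  rewrite esum_set1; last exact: integral_ge0.
  by apply: eq_integral => s _; rewrite esum_set1.
rewrite esum_set0; apply: integral0_eq => s _; exact: esum_set0.
Qed.

End CountableSums.

(** * Integration over fundamental domains of a countable group *)

Section Discrete.
Variables (R : realType) (d : measure_display) (S : measurableType d).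
Local Open Scope ereal_scope.

(** Measurability for the full power set of the target, so that composition with an arbitrary
    function, such as a coefficient on a group, stays measurable. *)
Definition discrete_fun (T : Type) (u : S -> T) := forall B : set T, measurable (u @^-1` B).

Lemma discrete_fun_comp (T T' : Type) (h : T -> T') (u : S -> T) :
  discrete_fun u -> discrete_fun (h \o u).
Proof. by move=> du B; have := du (h @^-1` B). Qed.

Lemma discrete_fun_pre (T : Type) (u : S -> T) (f : S -> S) :
  measurable_fun setT f -> discrete_fun u -> discrete_fun (u \o f).
Proof. by move=> mf du B; rewrite -[_ @^-1` _]setTI comp_preimage; apply: mf. Qed.

Lemma discrete_fun_pair (T T' : Type) (u : S -> T) (v : S -> T') : countable [set: T] ->
  discrete_fun u -> discrete_fun v -> discrete_fun (fun s => (u s, v s)).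
Proof.
move=> cT du dv B.
rewrite (_ : _ @^-1` B = \bigcup_t (u @^-1` [set t] `&` v @^-1` [set t' | B (t, t')])).
  by apply: countable_bigcupT_measurable => // t; apply: measurableI.
by apply/seteqP; split=> [s Bs|s [t _ [/= <- //]]]; exists (u s).
Qed.

Lemma discrete_fun_fibers (T : Type) (u : S -> T) : countable [set: T] ->
  (forall t, measurable (u @^-1` [set t])) -> discrete_fun u.
Proof.
move=> cT mu B.
rewrite (_ : _ @^-1` B = \bigcup_t (u @^-1` [set t] `&` [set _ | B t])).
  apply: countable_bigcupT_measurable => // t; apply: measurableI => //.
  by have [Bt|Bt] := pselect (B t); [rewrite (_ : mkset _ = setT)//| rewrite (_ : mkset _ = set0)//];
    apply/seteqP; split.
by apply/seteqP; split=> [s Bs|s [t _ [/= <- //]]]; exists (u s).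
Qed.

Lemma discrete_measurable (T : Type) (u : S -> T) d' (U : measurableType d') (h : T -> U) D :
  discrete_fun u -> measurable_fun D (fun s => h (u s)).
Proof. by move=> du mD B mB; apply: measurableI => //; exact: (du (h @^-1` B)). Qed.

Variable nu : {measure set S -> \bar R}.

Lemma integral_fibers (I : choiceType) (c : I -> nat) (w : S -> I) A (F : S -> \bar R) :
  injective c -> discrete_fun w -> measurable A -> measurable_fun setT F ->
  (forall s, 0 <= F s) ->
  \int[nu]_(s in A) F s = \esum_(i in [set: I]) \int[nu]_(s in A `&` w @^-1` [set i]) F s.
Proof.
move=> cI dw mA mF F0.
under eq_esum do rewrite integral_mkcondr.
rewrite -(integral_esum cI)//; last 2 first.
- move=> i; apply: measurable_funTS; apply/(measurable_restrictT _ (dw _)).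
  exact: measurable_funTS.
- by move=> i s; rewrite patchE; case: ifP.
apply: eq_integral => s _; rewrite (esumID [set w s]); last first.
  by move=> i _; rewrite patchE; case: ifP.
rewrite setTI esum_set1; last by rewrite patchE; case: ifP.
rewrite patchE mem_set// esum1 ?adde0// => i [_ /= iw].
by rewrite patchE memNset// => /= wi; apply: iw.
Qed.

Section Unfold.
Variables (H : groupType) (c : H -> nat) (act : H -> S -> S) (S0 : set S).
Hypotheses (cI : injective c) (mp : measure_preserving_action nu act).
Hypotheses (mS0 : measurable S0) (inv : forall h s, S0 s -> S0 (act h s)).

Lemma act_inv h s : S0 (act h s) <-> S0 s.
Proof.
have [a1 aM _ _] := mp; split=> [|s0]; last exact: inv.
by move=> /(inv h^-1%g); rewrite -aM mulVg a1.
Qed.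

Lemma change_variable h B (F : S -> \bar R) : measurable B -> measurable_fun setT F ->
  (forall s, 0 <= F s) ->
  \int[nu]_(s in B) F s = \int[nu]_(s in act h @^-1` B) F (act h s).
Proof.
have [_ _ ma pr] := mp => mB mF F0.
rewrite -[RHS](ge0_integral_pushforward (ma h))//; last exact: measurable_funTS.
by apply: eq_measure_integral => A mA _; exact/esym/pr.
Qed.

Definition equivariant (w : S -> H) := forall h s, S0 s -> w (act h s) = (h * w s)%g.

Definition domain (w : S -> H) := S0 `&` w @^-1` [set 1%g].

Lemma measurable_domain w : discrete_fun w -> measurable (domain w).
Proof. by move=> dw; apply: measurableI. Qed.

(** The level sets of w cut [S0] into the translates of [domain w], and each is carried back to the
    domain by the measure preserving action. *)
Lemma unfold w (F : S -> \bar R) : discrete_fun w -> equivariant w ->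
  measurable_fun setT F -> (forall s, 0 <= F s) ->
  \int[nu]_(s in S0) F s = \esum_(h in [set: H]) \int[nu]_(s in domain w) F (act h s).
Proof.
move=> dw we mF F0; rewrite (integral_fibers cI dw)//; apply: eq_esum => h _.
rewrite (change_variable h)//; last exact: measurableI.
congr (integral _ _ _); apply/seteqP; split=> s /=.
  by move=> [/act_inv s0]; rewrite we// -[RHS]mulg1 => /mulgI.
by move=> [s0 /= ws]; split; [exact: inv|rewrite we// ws mulg1].
Qed.

(** Each domain is cut along the level sets of the other map. The element h carries the piece of the
    second domain at h^-1 onto the piece of the first at h, and F does not change. *)
Lemma change_domain w w' (F : S -> \bar R) : discrete_fun w -> equivariant w ->
  discrete_fun w' -> equivariant w' ->
  measurable_fun setT F -> (forall s, 0 <= F s) -> (forall h s, S0 s -> F (act h s) = F s) ->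
  \int[nu]_(s in domain w) F s = \int[nu]_(s in domain w') F s.
Proof.
move=> dw we dw' we' mF F0 Finv.
rewrite (integral_fibers cI dw')//; last exact: measurable_domain.
rewrite [RHS](integral_fibers cI dw)//; last exact: measurable_domain.
rewrite [RHS](@reindex_esum R H H setT setT (fun h => h^-1%g)); last first.
  split=> // [x y _ _ /invg_inj//|x _]; exists x^-1%g => //; exact: invgK.
apply: eq_esum => h _; rewrite (change_variable h)//; last first.
  by apply: measurableI => //; exact: measurable_domain.
rewrite (_ : act h @^-1` _ = domain w' `&` w @^-1` [set h^-1%g]); last first.
  apply/seteqP; split=> s /=.
    move=> [[/act_inv s0 /=]]; rewrite we// we'// => e1 e2; split; last first.
      by apply: (mulgI h); rewrite e1 mulgV.
    by split=> //=; apply: (mulgI h); rewrite e2 mulg1.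
  move=> [[s0 /= e1] e2]; split; last by rewrite we'// e1 mulg1.
  by split; [exact: inv | rewrite /= we// e2 mulgV].
by apply: eq_integral => s /set_mem[[s0 _] _]; rewrite Finv.
Qed.

End Unfold.
End Discrete.

(** * From almost everywhere to exact fundamental domains *)

Section NullSets.
Variables (R : realType) (d : measure_display) (S : measurableType d).
Variable nu : {measure set S -> \bar R}.
Local Open Scope ereal_scope.

Lemma countable_code (I : choiceType) : countable [set: I] -> exists c : I -> nat, injective c.
Proof.
move=> /countable_injP[c cI]; exists c => x y; apply: cI; exact: in_setT.
Qed.

Lemma null_bigcup (I : choiceType) (F : I -> set S) : countable [set: I] ->
  (forall i, measurable (F i)) -> (forall i, nu (F i) = 0) -> nu (\bigcup_i F i) = 0.
Proof.
move=> cI mF F0; have [c c_inj] := countable_code cI.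
pose F' n := \bigcup_(i in [set i | c i = n]) F i.
have F'E n : measurable (F' n) /\ nu (F' n) = 0.
  rewrite /F'; have [[i ->]| ->] := code_fiber c_inj n.
    by rewrite bigcup_set1.
  by rewrite bigcup_set0 measure0.
apply/eqP; rewrite eq_le measure_ge0 andbT.
apply: (@le_trans _ _ (\sum_(0 <= n <oo) nu (F' n))).
  apply: measure_sigma_subadditive => [n| |s [i _ Fi]]; first by have [] := F'E n.
    exact: countable_bigcupT_measurable.
  by exists (c i) => //; exists i.
by rewrite eseries0// => n _ _; have [] := F'E n.
Qed.

Section ExactDomain.
Variables (H : groupType) (act : H -> S -> S).
Hypotheses (cH : countable [set: H]) (mp : measure_preserving_action nu act).

Lemma act_image h X : act h @` X = act h^-1%g @^-1` X.
Proof.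
have [a1 aM _ _] := mp; apply/seteqP; split=> [_ [s Xs <-]|s Xs] /=.
  by rewrite -aM mulVg a1.
by exists (act h^-1%g s) => //; rewrite -aM mulgV a1.
Qed.

Lemma act_preimage_measurable h X : measurable X -> measurable (act h @^-1` X).
Proof. by have [_ _ ma _] := mp => mX; rewrite -[_ @^-1` _]setTI; exact: ma. Qed.

Definition exact_at (X : set S) s := (exists h, (act h @` X) s) /\
  forall h h', (act h @` X) s -> (act h' @` X) s -> h = h'.

Lemma fundamental_domain_exact X : fundamental_domain nu act X ->
  exists N, [/\ measurable N, nu N = 0 & forall s, ~ N s -> exact_at X s].
Proof.
move=> [mX X1 X2].
have mi h : measurable (act h @` X) by rewrite act_image; exact: act_preimage_measurable.
have cHH : countable [set: (H * H)%type] by rewrite -setXTT; exact: countableX.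
pose E p : set S := if pselect (p.1 = p.2) then set0 else act p.1 @` X `&` act p.2 @` X.
have E0 p : measurable (E p) /\ nu (E p) = 0.
  rewrite /E; case: pselect => /= h; first by rewrite measure0; split=> //; exact: measurable0.
  by split; [exact: measurableI | exact: X2].
have mU : measurable (~` \bigcup_h (act h @` X)).
  by apply: measurableC; exact: countable_bigcupT_measurable.
have mE : measurable (\bigcup_p E p).
  by apply: countable_bigcupT_measurable => // p; have [] := E0 p.
exists ((~` \bigcup_h (act h @` X)) `|` \bigcup_p E p); split.
- exact: measurableU.
- rewrite measureU0//.
  by apply: null_bigcup => // p; have [] := E0 p.
- move=> s /not_orP[/contrapT[h _ hX] nE]; split; first by exists h.
  move=> h1 h2 s1 s2; apply: contrapT => h12; apply: nE; exists (h1, h2) => //.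
  by rewrite /E; case: pselect.
Qed.

(** The value w s is the unique element whose translate of X contains s, which encodes X as the
    level set at 1. Off [S0] the value defaults to 1, so that fiber is treated apart. *)
Lemma cocycle_exists S0 X : measurable S0 -> (forall h s, S0 s -> S0 (act h s)) ->
  measurable X -> (forall s, S0 s -> exact_at X s) ->
  exists w, [/\ discrete_fun w, equivariant act S0 w & domain S0 w = S0 `&` X].
Proof.
move=> mS0 inv mX ex; have [a1 aM _ _] := mp.
pose w s := if pselect (S0 s) is left h then projT1 (cid (ex s h).1) else 1%g.
have wP s : S0 s -> (act (w s) @` X) s.
  by move=> s0; rewrite /w; case: pselect => // h; exact: (projT2 (cid (ex s h).1)).
have wE s h : S0 s -> (act h @` X) s -> w s = h.
  by move=> s0 sX; have [_ uq] := ex s s0; apply: uq => //; exact: wP.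
have w1 s : ~ S0 s -> w s = 1%g by rewrite /w; case: pselect.
exists w; split.
- apply: (discrete_fun_fibers cH) => t.
  have mt : measurable (act t @` X) by rewrite act_image; exact: act_preimage_measurable.
  have [->|t1] := pselect (t = 1%g).
    rewrite (_ : _ @^-1` _ = (S0 `&` act 1%g @` X) `|` ~` S0).
      apply: measurableU; last exact: measurableC.
      by apply: measurableI => //; rewrite act_image; exact: act_preimage_measurable.
    apply/seteqP; split=> [s /= ws|s [[s0 sX]|ns0]]; last exact: w1.
      by have [s0|] := pselect (S0 s); [left; split=> //; rewrite -ws; exact: wP | right].
    exact: wE.
  rewrite (_ : _ @^-1` _ = S0 `&` act t @` X); first exact: measurableI.
  apply/seteqP; split=> [s /= ws|s [s0 sX]]; last exact: wE.
  have [s0|/w1 e] := pselect (S0 s); first by split=> //; rewrite -ws; exact: wP.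
  by case: t1; rewrite -ws e.
- move=> h s s0; apply: wE; first exact: inv.
  by have [x Xx xs] := wP _ s0; exists x => //; rewrite aM xs.
- apply/seteqP; split=> s [s0 sX]; split=> //.
    by have [x Xx <-] := wP _ s0; rewrite (sX : w s = 1%g) a1.
  by apply: wE => //; exists s.
Qed.

End ExactDomain.
End NullSets.

Section ExactCoupling.
Variables (R : realType) (G Gam : groupType).
Local Open Scope ereal_scope.

(** Both domains become level sets of equivariant maps on an invariant set, so that later identities
    hold at every point of [S0]. Positive measure of the domain of c is what allows integrals over
    it to be normalized. *)
Definition exact_coupling (d : measure_display) (S : measurableType d)
    (nu : {measure set S -> \bar R}) (act : (G * Gam)%type -> S -> S) (S0 : set S)
    (w : S -> G) (c : S -> Gam) :=
  [/\ measurable S0, measure_preserving_action nu act,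
      forall k s, S0 s -> S0 (act k s),
      [/\ discrete_fun w, equivariant (fun g => act (g, 1%g)) S0 w & nu (domain S0 w) < +oo] &
      [/\ discrete_fun c, equivariant (fun a => act (1%g, a)) S0 c, nu (domain S0 c) < +oo &
          0 < nu (domain S0 c)]].

Lemma subaction_l d (S : measurableType d) (nu : {measure set S -> \bar R})
    (act : (G * Gam)%type -> S -> S) :
  measure_preserving_action nu act -> measure_preserving_action nu (fun g => act (g, 1%g)).
Proof.
move=> [a1 aM ma pr]; split=> [s|g h s|g|g A]; [exact: a1| |exact: ma|exact: pr].
by rewrite (_ : ((g * h)%g, 1%g) = (g, 1%g) * (h, 1%g) :> G * Gam)%g ?aM//; congr pair; rewrite mulg1.
Qed.

Lemma subaction_r d (S : measurableType d) (nu : {measure set S -> \bar R})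
    (act : (G * Gam)%type -> S -> S) :
  measure_preserving_action nu act -> measure_preserving_action nu (fun a => act (1%g, a)).
Proof.
move=> [a1 aM ma pr]; split=> [s|g h s|g|g A]; [exact: a1| |exact: ma|exact: pr].
by rewrite (_ : (1%g, (g * h)%g) = (1%g, g) * (1%g, h) :> G * Gam)%g ?aM//; congr pair; rewrite mulg1.
Qed.

Lemma exact_coupling_exists : countable [set: G] -> countable [set: Gam] ->
  measure_equivalent R G Gam ->
  exists (d : measure_display) (S : measurableType d) (nu : {measure set S -> \bar R}) act S0 w c,
    @exact_coupling d S nu act S0 w c.
Proof.
move=> cG cC [d [S [nu [act [X [Y [_ _ nu0 mp [fX fY Xoo Yoo]]]]]]]].
have [a1 aM ma pr] := mp.
have mpG := subaction_l mp; have mpC := subaction_r mp.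
have [N1 [mN1 N10 ex1]] := fundamental_domain_exact cC mpC fX.
have [N2 [mN2 N20 ex2]] := fundamental_domain_exact cG mpG fY.
have cK : countable [set: (G * Gam)%type] by rewrite -setXTT; exact: countableX.
(* Saturating the null sets under the countable group G x Gam keeps them null and makes the
   complement invariant. *)
pose N := \bigcup_k (act k @^-1` (N1 `|` N2)).
have mN12 : measurable (N1 `|` N2) by exact: measurableU.
have mk k : measurable (act k @^-1` (N1 `|` N2)) by exact: (act_preimage_measurable mp).
have mN : measurable N by exact: countable_bigcupT_measurable.
have N0 : nu N = 0.
  by apply: null_bigcup => // k; rewrite pr// measureU0.
have mS0 : measurable (~` N) by exact: measurableC.
have inv k s : (~` N) s -> (~` N) (act k s).
  by move=> ns [l _ /= h]; apply: ns; exists (l * k)%g => //=; rewrite aM.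
have S01 s : (~` N) s -> ~ N1 s /\ ~ N2 s.
  by move=> ns; split=> h; apply: ns; exists 1%g => //=; rewrite a1; [left|right].
have [mX _ _] := fX; have [mY _ _] := fY.
have [w [dw we wd]] := cocycle_exists cG mpG mS0 (fun g => inv (g, 1%g)) mY
  (fun s h => ex2 s (S01 s h).2).
have [c [dc ce cd]] := cocycle_exists cC mpC mS0 (fun a => inv (1%g, a)) mX
  (fun s h => ex1 s (S01 s h).1).
exists d, S, nu, act, (~` N), w, c; split=> //; split=> //.
- rewrite wd; apply: le_lt_trans Yoo.
  by apply: le_measure; [rewrite inE; exact: measurableI | rewrite inE | exact: subIsetr].
- rewrite cd; apply: le_lt_trans Xoo.
  by apply: le_measure; [rewrite inE; exact: measurableI | rewrite inE | exact: subIsetr].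
(* If the domain of c were null, unfolding the constant 1 would make [S0], and hence the whole
   space, null. *)
- rewrite lt0e measure_ge0 andbT; apply/eqP => d0; apply: nu0.
  have [k kI] := countable_code cC.
  have := unfold kI mpC mS0 (fun a => inv (1%g, a)) dc ce
    (measurable_cst (1 : \bar R)) (fun _ => lee01).
  rewrite integral_cst// mul1e esum1; last first.
    move=> a _; rewrite integral_cst; last exact: measurable_domain.
    by rewrite d0 mule0.
  by move=> e; rewrite -(setUv N) measureU0// ?e//; exact: measurableC.
Qed.

End ExactCoupling.

(** * Transport of a kernel through a coupling *)

Section BoundedMeasurable.
Variables (R : realType) (d : measure_display) (S : measurableType d).
Implicit Types u v : S -> R.

Definition bounded_measurable u :=
  measurable_fun setT u /\ exists M, forall s, `|u s| <= M.

Lemma bm_cst (r : R) : bounded_measurable (fun=> r).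
Proof. by split; [exact: measurable_cst | exists `|r|]. Qed.

Lemma bmD u v : bounded_measurable u -> bounded_measurable v ->
  bounded_measurable (fun s => u s + v s).
Proof.
move=> [mu [M uM]] [mv [N vN]]; split; first exact: measurable_funD.
by exists (M + N) => s; apply: (le_trans (ler_normD _ _)); exact: lerD.
Qed.

Lemma bmM u v : bounded_measurable u -> bounded_measurable v ->
  bounded_measurable (fun s => u s * v s).
Proof.
move=> [mu [M uM]] [mv [N vN]]; split; first exact: measurable_funM.
by exists (M * N) => s; rewrite normrM; apply: ler_pM.
Qed.

Lemma bm_sum (I : Type) (r : seq I) (F : I -> S -> R) :
  (forall i, bounded_measurable (F i)) -> bounded_measurable (fun s => \sum_(i <- r) F i s).
Proof.
move=> bF; elim: r => [|i r IH].
  by rewrite (_ : (fun s => _) = fun=> 0); [exact: bm_cst | apply/funext => s; rewrite big_nil].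
rewrite (_ : (fun s => _) = fun s => F i s + \sum_(j <- r) F j s); first exact: bmD.
by apply/funext => s; rewrite big_cons.
Qed.

Lemma bm_discrete (T : Type) (w : S -> T) (h : T -> R) (M : R) :
  discrete_fun w -> (forall t, `|h t| <= M) -> bounded_measurable (fun s => h (w s)).
Proof. by move=> dw hM; split; [exact: discrete_measurable | exists M => s]. Qed.

Variables (nu : {measure set S -> \bar R}) (A : set S).
Hypotheses (mA : measurable A) (Aoo : (nu A < +oo)%E).

Lemma bm_integrable u : bounded_measurable u -> nu.-integrable A (EFin \o u).
Proof.
move=> [mu [M uM]]; apply: measurable_bounded_integrable => //; first exact: measurable_funTS.
by exists M; split; [exact: num_real | move=> x Mx s _; exact: le_trans (uM s) (ltW Mx)].
Qed.

Lemma bm_RintegralE u : bounded_measurable u ->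
  (\int[nu]_(s in A) (u s)%:E)%E = (\int[nu]_(s in A) u s)%:E.
Proof.
by move=> bu; rewrite /Rintegral fineK// integrable_fin_num//; exact: bm_integrable.
Qed.

Lemma Rintegral_sum (I : Type) (r : seq I) (F : I -> S -> R) :
  (forall i, bounded_measurable (F i)) ->
  \int[nu]_(s in A) (\sum_(i <- r) F i s) = \sum_(i <- r) \int[nu]_(s in A) F i s.
Proof.
move=> bF; elim: r => [|i r IH].
  by rewrite big_nil; under eq_Rintegral do rewrite big_nil; rewrite Rintegral_cst// mul0r.
rewrite big_cons -IH -RintegralD//; last 2 first.
- exact: bm_integrable.
- by apply: bm_integrable; exact: bm_sum.
by apply: eq_Rintegral => s _; rewrite big_cons.
Qed.

Lemma Rintegral_scale (a : R) u : bounded_measurable u ->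
  \int[nu]_(s in A) (a * u s) = a * \int[nu]_(s in A) u s.
Proof. by move=> bu; rewrite RintegralZl//; exact: bm_integrable. Qed.

Lemma bm_scale (a : R) u : bounded_measurable u -> bounded_measurable (fun s => a * u s).
Proof. by move=> bu; apply: bmM => //; exact: bm_cst. Qed.

Lemma sqr_sumE (I : Type) (r : seq I) (z : I -> R) (F : I -> R) :
  (\sum_(i <- r) z i * F i) ^+ 2 = \sum_(i <- r) \sum_(k <- r) z i * z k * (F i * F k).
Proof.
rewrite expr2 mulr_suml; apply: eq_bigr => i _; rewrite mulr_sumr.
by apply: eq_bigr => k _; rewrite mulrACA.
Qed.

Lemma Rintegral_gram (I : Type) (r : seq I) (z : I -> R) (F : I -> S -> R) :
  (forall i, bounded_measurable (F i)) ->
  \int[nu]_(s in A) ((\sum_(i <- r) z i * F i s) ^+ 2) =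
  \sum_(i <- r) \sum_(k <- r) z i * z k * \int[nu]_(s in A) (F i s * F k s).
Proof.
move=> bF; under eq_Rintegral do rewrite sqr_sumE.
rewrite Rintegral_sum; last first.
  by move=> i; apply: bm_sum => k; apply: bm_scale; exact: bmM.
apply: eq_bigr => i _; rewrite Rintegral_sum; last first.
  by move=> k; apply: bm_scale; exact: bmM.
by apply: eq_bigr => k _; rewrite Rintegral_scale//; exact: bmM.
Qed.

End BoundedMeasurable.

Lemma esum_triple (R : realType) (A B C : choiceType) (f : A -> B -> C -> \bar R) :
  (forall a b c, (0 <= f a b c)%E) ->
  (\esum_(p in [set: (A * B) * C]) f p.1.1 p.1.2 p.2 =
   \esum_(b in [set: B]) \esum_(c in [set: C]) \esum_(a in [set: A]) f a b c)%E.
Proof.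
move=> f0; rewrite (@reindex_esum R (B * (C * A))%type _ setT setT
  (fun q => ((q.2.2, q.1), q.2.1))); last first.
  split=> // [[b [c a]] [b' [c' a']] _ _ /= [-> -> ->] //|[[a b] c] _].
  by exists (b, (c, a)).
rewrite (@esum_pair R _ _ (fun b (q : C * A) => f q.2 b q.1))//.
by apply: eq_esum => b _; rewrite (@esum_pair R _ _ (fun c a => f a b c)).
Qed.

Section Fields.
Variables (R : realType) (G Gam : groupType).
Variables (cG : countable [set: G]) (cC : countable [set: Gam]).
Variables (d : measure_display) (S : measurableType d) (nu : {measure set S -> \bar R}).
Variables (act : (G * Gam)%type -> S -> S) (S0 : set S) (w : S -> G) (c : S -> Gam).
Hypothesis cpl : exact_coupling nu act S0 w c.
Variables (ph : Gam -> R) (ed : Gam -> Gam * Gam -> R).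

Definition kernel_gram := forall (I : Type) (r : seq I) (z : I -> R) (x : I -> Gam),
  (\esum_(p in [set: Gam * Gam]) ((\sum_(i <- r) z i * ed (x i) p) ^+ 2)%:E =
   (\sum_(i <- r) \sum_(j <- r) z i * z j * ph ((x j)^-1 * x i)%g -
     (\sum_(i <- r) z i * ph (x i)) ^+ 2)%:E)%E.

Hypotheses (gr : kernel_gram) (ph0 : forall x, 0 <= ph x) (ph_le1 : forall x, ph x <= 1).
Hypothesis ph1 : ph 1%g = 1.

Local Notation X0 := (domain S0 c).
Local Notation Y0 := (domain S0 w).

Lemma ed_le1 x p : `|ed x p| <= 1.
Proof.
have := gr [:: tt] (fun=> 1) (fun=> x).
rewrite !big_seq1 !mul1r mulVg ph1 => e.
have : ((ed x p ^+ 2)%:E <= (1 - ph x ^+ 2)%:E)%E.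
  rewrite -e; apply: (@le_trans _ _ (\esum_(q in [set p]) ((ed x q) ^+ 2)%:E)%E).
    by rewrite esum_set1// lee_fin sqr_ge0.
  rewrite esum_mkcond; apply: le_esum => q _; rewrite big_seq1 mul1r.
  by case: ifP => _ //; rewrite lee_fin sqr_ge0.
rewrite lee_fin => h; have h1 : ed x p ^+ 2 <= 1.
  by apply: (le_trans h); rewrite lerBlDr lerDl sqr_ge0.
by rewrite -(@ler_sqr _ `|ed x p|) ?nnegrE// real_normK ?num_real// expr1n.
Qed.

(** For each s a map from G to Gam. The quotient of its values at a and b is invariant under Gam
    acting on s and plays the role of b^-1 a in the free group. *)
Definition shifted (g : G) s := c (act (g^-1, 1)%g s).
(** A single vertex is kept for each s; the other vertices appear when Gam acts on s
    ([field_translate]), so a sum over vertices becomes a sum over Gam-translates of its domain. *)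
Definition edge_field (D : Gam) (a b : G) s :=
  ed ((shifted b s)^-1 * shifted a s)%g ((shifted b s)^-1, D)%g.

Let mS0 : measurable S0. Proof. by case: cpl. Qed.
Let mp : measure_preserving_action nu act. Proof. by case: cpl. Qed.
Let inv k s : S0 s -> S0 (act k s). Proof. by case: cpl => _ _ + _ _; apply. Qed.
Let actM k l s : act (k * l)%g s = act k (act l s). Proof. by case: mp. Qed.
Let dw : discrete_fun w. Proof. by case: cpl => _ _ _ []. Qed.
Let dc : discrete_fun c. Proof. by case: cpl => _ _ _ _ []. Qed.
Let we : equivariant (fun g => act (g, 1)%g) S0 w. Proof. by case: cpl => _ _ _ []. Qed.
Let ce : equivariant (fun a => act (1, a)%g) S0 c. Proof. by case: cpl => _ _ _ _ []. Qed.
Let mX : measurable X0. Proof. exact: measurable_domain. Qed.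
Let mY : measurable Y0. Proof. exact: measurable_domain. Qed.
Let Xoo : (nu X0 < +oo)%E. Proof. by case: cpl => _ _ _ _ []. Qed.
Let Yoo : (nu Y0 < +oo)%E. Proof. by case: cpl => _ _ _ []. Qed.

Lemma shifted_discrete g : discrete_fun (shifted g).
Proof.
have [_ _ ma _] := mp.
exact: (discrete_fun_pre (ma (g^-1, 1)%g) dc).
Qed.

Lemma shifted_act g k s : shifted g (act (k, 1)%g s) = shifted (k^-1 * g)%g s.
Proof.
rewrite /shifted -actM; congr (c (act _ s)).
by congr pair; rewrite /= ?mulg1// invgM invgK.
Qed.

Lemma shifted_equivariant g : equivariant (fun a => act (1, a)%g) S0 (shifted g).
Proof.
move=> a s s0; rewrite /shifted -ce; last exact: inv.
rewrite -!actM; congr (c (act _ s)).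
by congr pair; rewrite /= ?mulg1 ?mul1g.
Qed.

Lemma field_bm D a b : bounded_measurable (edge_field D a b).
Proof.
have h := discrete_fun_pair cC (shifted_discrete a) (shifted_discrete b).
exact: (bm_discrete (h := fun t => ed (t.2^-1 * t.1)%g (t.2^-1, D)%g) h (fun t => ed_le1 _ _)).
Qed.

Lemma field_act D a b k s : edge_field D a b (act (k, 1)%g s) = edge_field D (k^-1 * a)%g (k^-1 * b)%g s.
Proof. by rewrite /edge_field !shifted_act. Qed.

Lemma field_translate D a b k s : S0 s -> edge_field D a b (act (1, k^-1)%g s) =
  ed ((shifted b s)^-1 * shifted a s)%g ((shifted b s)^-1 * k, D)%g.
Proof.
move=> s0; rewrite /edge_field !shifted_equivariant// !invgM invgK.
by rewrite -mulgA mulVKg.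
Qed.

(* The vectors obtained from the fields by elimination have, on the
   fundamental domain of G, the Gram matrix of the fields; unfolding over G and
   folding back over Gam turns sums of them into integrals over the fundamental
   domain of Gam. *)
Lemma field_vectors : exists e : Gam -> G -> G -> nat -> R,
  forall (I : Type) (r : seq I) (z : I -> R) (a b : I -> G),
  (\esum_(p in [set: (nat * Gam) * G])
     ((\sum_(i <- r) z i * e p.1.2 (p.2^-1 * a i)%g (p.2^-1 * b i)%g p.1.1) ^+ 2)%:E =
   \int[nu]_(s in X0) \esum_(q in [set: Gam * Gam])
     ((\sum_(i <- r) z i * ed ((shifted (b i) s)^-1 * shifted (a i) s)%g
        ((shifted (b i) s)^-1 * q.1, q.2)%g) ^+ 2)%:E)%E.
Proof.
pose P := (Gam * (G * G))%type.
pose F (p : P) := edge_field p.1 p.2.1 p.2.2.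
pose K (p q : P) := \int[nu]_(s in Y0) (F p s * F q s).
have [k kI] : exists k : P -> nat, injective k.
  apply: countable_code; rewrite -setXTT; apply: countableX => //.
  by rewrite -setXTT; apply: countableX.
pose q n : P := if pselect (exists p, k p = n) is left h then projT1 (cid h) else (1, (1, 1))%g.
have kq : cancel k q.
  move=> p; apply: kI; rewrite /q; case: pselect => [h|[]]; last by exists p.
  exact: (projT2 (cid h)).
have Ks p p' : K p p' = K p' p by apply: eq_Rintegral => s _; rewrite mulrC.
have bF p : bounded_measurable (F p) by exact: field_bm.
have Kp : psd K.
  move=> s; rewrite -(Rintegral_gram mY Yoo s (fun u => u.2) (fun u => bF u.1)).
  by apply: Rintegral_ge0 => x _; exact: sqr_ge0.
have [e he] := cholesky kq Ks Kp.
exists (fun D a b => e (D, (a, b))) => I r z a b.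
pose T D s := ((\sum_(i <- r) z i * edge_field D (a i) (b i) s) ^+ 2)%:E.
have bT D : bounded_measurable (fun s => (\sum_(i <- r) z i * edge_field D (a i) (b i) s) ^+ 2).
  have h : bounded_measurable (fun s => \sum_(i <- r) z i * edge_field D (a i) (b i) s).
    by apply: bm_sum => i; apply: bm_scale; exact: field_bm.
  exact: bmM.
have mT D : measurable_fun setT (T D) by apply/measurable_EFinP; case: (bT D).
have T0 D s : (0 <= T D s)%E by rewrite lee_fin sqr_ge0.
rewrite (@esum_triple R nat Gam G (fun j D g =>
  ((\sum_(i <- r) z i * e (D, (g^-1 * a i, g^-1 * b i))%g j) ^+ 2)%:E)); last first.
  by move=> *; rewrite lee_fin sqr_ge0.
transitivity (\esum_(D in [set: Gam]) \esum_(g in [set: G])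
    \int[nu]_(s in Y0) T D (act (g, 1)%g s))%E.
  apply: eq_esum => D _; apply: eq_esum => g _.
  rewrite he -Rintegral_gram// -bm_RintegralE//; last first.
    have h : bounded_measurable (fun s => \sum_(i <- r) z i *
        F (D, (g^-1 * a i, g^-1 * b i))%g s).
      by apply: bm_sum => i; apply: bm_scale.
    exact: bmM.
  apply: eq_integral => s _; rewrite /T; congr ((_ ^+ 2)%:E).
  by apply: eq_bigr => i _; rewrite field_act.
have [kG kGI] := countable_code cG; have [kC kCI] := countable_code cC.
transitivity (\esum_(D in [set: Gam]) \esum_(x in [set: Gam])
    \int[nu]_(s in X0) T D (act (1, x)%g s))%E.
  apply: eq_esum => D _.
  rewrite -(unfold kGI (subaction_l mp) mS0 (fun g => @inv (g, 1)%g) dw we (mT D) (T0 D)).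
  by rewrite -(unfold kCI (subaction_r mp) mS0 (fun g => @inv (1, g)%g) dc ce (mT D) (T0 D)).
have cC2 : countable [set: (Gam * Gam)%type] by rewrite -setXTT; exact: countableX.
have [k2 k2I] := countable_code cC2.
rewrite (integral_esum k2I)//; last 2 first.
- move=> p; apply: measurable_funTS; apply/measurable_EFinP/measurable_funX/measurable_sum => i.
  apply: measurable_funM; first exact: measurable_cst.
  have h := discrete_fun_pair cC (shifted_discrete (a i)) (shifted_discrete (b i)).
  exact: (discrete_measurable (fun t => ed (t.2^-1 * t.1)%g (t.2^-1 * p.1, p.2)%g) h).
- by move=> p s; rewrite lee_fin sqr_ge0.
rewrite -(@esum_pair R _ _ (fun D x => \int[nu]_(s in X0) T D (act (1, x)%g s))%E); last first.
  by move=> D x; apply: integral_ge0.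
rewrite (@reindex_esum R (Gam * Gam)%type _ setT setT (fun p => (p.2, p.1^-1)%g)); last first.
  split=> // [[x y] [x' y'] _ _ /= [-> /invg_inj ->]//|[x y] _].
  by exists (y^-1, x)%g => //=; rewrite invgK.
apply: eq_esum => p _; apply: eq_integral => s /set_mem[s0 _]; rewrite /T.
by congr ((_ ^+ 2)%:E); apply: eq_bigr => i _; rewrite field_translate.
Qed.

Definition mass : R := fine (nu X0).

Lemma massE : nu X0 = mass%:E.
Proof. by rewrite /mass fineK// ge0_fin_numE. Qed.

Lemma mass_gt0 : 0 < mass.
Proof. by rewrite -lte_fin -massE; case: cpl => _ _ _ _ []. Qed.

Definition corr (a b : G) : R :=
  mass^-1 * \int[nu]_(s in X0) ph ((shifted b s)^-1 * shifted a s)%g.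

Definition overlap (a b : G) : R :=
  mass^-1 * \int[nu]_(s in X0) (ph ((shifted b s)^-1 * shifted a s)%g ^+ 2).

Lemma ph_norm x : `|ph x| <= 1.
Proof. by rewrite ger0_norm. Qed.

Lemma ph_bm (a b : G) : bounded_measurable (fun s => ph ((shifted b s)^-1 * shifted a s)%g).
Proof.
have h := discrete_fun_pair cC (shifted_discrete a) (shifted_discrete b).
exact: (bm_discrete (h := fun t => ph (t.2^-1 * t.1)%g) h (fun t => ph_norm _)).
Qed.

Lemma corr1 a : corr a a = 1.
Proof.
rewrite /corr; under eq_Rintegral do rewrite mulVg ph1.
by rewrite Rintegral_cst// mul1r -/mass mulVf// gt_eqF// mass_gt0.
Qed.

Lemma overlap_le_corr a b : overlap a b <= corr a b.
Proof.
rewrite /overlap /corr; have i0 : 0 <= mass^-1 by rewrite invr_ge0 ltW// mass_gt0.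
apply: ler_wpM2l => //; apply: le_Rintegral => //.
- by apply: bm_integrable => //; apply: bmM; exact: ph_bm.
- by apply: bm_integrable => //; exact: ph_bm.
by move=> s _; rewrite expr2 ler_piMl.
Qed.

Lemma corr_le1 a b : corr a b <= 1.
Proof.
have i0 : 0 <= mass^-1 by rewrite invr_ge0 ltW// mass_gt0.
rewrite -(corr1 a); apply: ler_wpM2l => //; apply: le_Rintegral => //.
- by apply: bm_integrable => //; exact: ph_bm.
- by apply: bm_integrable => //; exact: ph_bm.
by move=> s _; rewrite mulVg ph1.
Qed.

Section Vectors.
Variable e : Gam -> G -> G -> nat -> R.
Hypothesis he : forall (I : Type) (r : seq I) (z : I -> R) (a b : I -> G),
  (\esum_(p in [set: (nat * Gam) * G])
     ((\sum_(i <- r) z i * e p.1.2 (p.2^-1 * a i)%g (p.2^-1 * b i)%g p.1.1) ^+ 2)%:E =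
   \int[nu]_(s in X0) \esum_(q in [set: Gam * Gam])
     ((\sum_(i <- r) z i * ed ((shifted (b i) s)^-1 * shifted (a i) s)%g
        ((shifted (b i) s)^-1 * q.1, q.2)%g) ^+ 2)%:E)%E.

(** At x = a^-1 p and y = a^-1 b the arguments of e become p^-1 a and p^-1 b, the form summed in
    [he]; the square root of the mass normalizes the integral. *)
Definition vec (i : nat * Gam) (x y : G) : R := e i.2 x^-1%g (x^-1 * y)%g i.1 / Num.sqrt mass.

Lemma vec_sum (I : Type) (r : seq I) (z : I -> R) (a b : I -> G) :
  (\esum_(p in [set: (nat * Gam) * G])
     ((\sum_(i <- r) z i * vec p.1 ((a i)^-1 * p.2)%g ((a i)^-1 * b i)%g) ^+ 2)%:E =
   (mass^-1)%:E * \int[nu]_(s in X0) \esum_(q in [set: Gam * Gam])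
     ((\sum_(i <- r) z i * ed ((shifted (b i) s)^-1 * shifted (a i) s)%g
        ((shifted (b i) s)^-1 * q.1, q.2)%g) ^+ 2)%:E)%E.
Proof.
have m0 := ltW mass_gt0.
rewrite -he -esumZ ?invr_ge0//; last by move=> p; exact: sqr_ge0.
apply: eq_esum => p _; congr EFin.
rewrite (_ : mass^-1 = (Num.sqrt mass)^-1 ^+ 2); last by rewrite exprVn (sqr_sqrtr m0).
rewrite -exprMn mulrC mulr_suml; congr (_ ^+ 2); apply: eq_bigr => i _.
by rewrite /vec invgM invgK -mulgA mulVKg mulrA.
Qed.

Lemma edge_sum_translate (I : Type) (r : seq I) (z : I -> R) (x : I -> Gam) (h : Gam) :
  (\esum_(q in [set: Gam * Gam]) ((\sum_(i <- r) z i * ed (x i) (h * q.1, q.2)%g) ^+ 2)%:E =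
   \esum_(q in [set: Gam * Gam]) ((\sum_(i <- r) z i * ed (x i) q) ^+ 2)%:E)%E.
Proof.
rewrite [RHS](@reindex_esum R (Gam * Gam)%type _ setT setT (fun q => (h * q.1, q.2)%g))//.
split=> // [[u v] [u' v'] _ _ /= [/mulgI -> ->]//|[u v] _].
by exists (h^-1 * u, v)%g => //=; rewrite mulVKg.
Qed.

(** With a common endpoint g the factor [shifted g s] cancels from the Gram part, so [corr] does not
    depend on g; g remains only in the subtracted square. *)
Lemma vec_sum_const (I : Type) (r : seq I) (z : I -> R) (a : I -> G) (g : G) :
  (\esum_(p in [set: (nat * Gam) * G])
     ((\sum_(i <- r) z i * vec p.1 ((a i)^-1 * p.2)%g ((a i)^-1 * g)%g) ^+ 2)%:E =
   (\sum_(i <- r) \sum_(k <- r) z i * z k * corr (a i) (a k) -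
    mass^-1 * \int[nu]_(s in X0)
      ((\sum_(i <- r) z i * ph ((shifted g s)^-1 * shifted (a i) s)%g) ^+ 2))%:E)%E.
Proof.
rewrite (vec_sum r z a (fun=> g)).
pose A s := \sum_(i <- r) \sum_(k <- r) z i * z k * ph ((shifted (a k) s)^-1 * shifted (a i) s)%g.
pose Q s := (\sum_(i <- r) z i * ph ((shifted g s)^-1 * shifted (a i) s)%g) ^+ 2.
have bA : bounded_measurable A.
  by apply: bm_sum => i; apply: bm_sum => k; apply: bm_scale; exact: ph_bm.
have bQ : bounded_measurable Q.
  have h : bounded_measurable (fun s => \sum_(i <- r) z i * ph ((shifted g s)^-1 * shifted (a i) s)%g).
    by apply: bm_sum => i; apply: bm_scale; exact: ph_bm.
  exact: bmM.
have bAQ : bounded_measurable (fun s => A s - Q s).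
  have := bmD bA (bm_scale (-1) bQ); rewrite (_ : (fun s => A s + -1 * Q s) = fun s => A s - Q s)//.
  by apply/funext => s; rewrite mulN1r.
transitivity ((mass^-1)%:E * \int[nu]_(s in X0) (A s - Q s)%:E)%E.
  congr (_ * _)%E; apply: eq_integral => s _.
  rewrite edge_sum_translate gr /A /Q; congr ((_ - _)%:E).
  apply: eq_bigr => i _; apply: eq_bigr => k _; congr (_ * ph _).
  by rewrite invgM invgK -mulgA mulVKg.
rewrite bm_RintegralE// -EFinM; congr EFin.
rewrite RintegralB//; last 2 first.
- exact: bm_integrable.
- exact: bm_integrable.
rewrite mulrBr; congr (_ - _).
rewrite Rintegral_sum//; last by move=> i; apply: bm_sum => k; apply: bm_scale; exact: ph_bm.
rewrite mulr_sumr; apply: eq_bigr => i _.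
rewrite Rintegral_sum//; last by move=> k; apply: bm_scale; exact: ph_bm.
rewrite mulr_sumr; apply: eq_bigr => k _.
by rewrite Rintegral_scale//; [rewrite mulrCA | exact: ph_bm].
Qed.

Lemma vec_gram (g : G) (F : seq G) (z : G -> R) :
  (\esum_(p in [set: (nat * Gam) * G])
     ((\sum_(s <- F) z s * vec p.1 (s^-1 * p.2)%g (s^-1 * g)%g) ^+ 2)%:E <=
   (\sum_(s <- F) \sum_(t <- F) z s * z t * corr s t)%:E)%E.
Proof.
rewrite (vec_sum_const F z id g) lee_fin lerBlDr lerDl.
rewrite mulr_ge0 ?invr_ge0 ?(ltW mass_gt0)//.
by apply: Rintegral_ge0 => s _; exact: sqr_ge0.
Qed.

Lemma vec_norm (g : G) :
  (\esum_(p in [set: (nat * Gam) * G]) (vec p.1 p.2 g ^+ 2)%:E = (1 - overlap 1 g)%:E)%E.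
Proof.
have := vec_sum_const [:: tt] (fun=> 1) (fun=> 1%g) g.
rewrite !big_seq1 !mul1r corr1 => e1.
rewrite [RHS](_ : _ = (1 - mass^-1 * \int[nu]_(s in X0)
    (\sum_(i <- [:: tt]) 1 * ph ((shifted g s)^-1 * shifted 1 s)%g) ^+ 2)%:E)%E.
  by rewrite -e1; apply: eq_esum => p _; rewrite big_seq1 mul1r invg1 !mul1g.
congr ((1 - _ * _)%:E); apply: eq_Rintegral => s _.
by rewrite big_seq1 mul1r.
Qed.

Lemma vec_left (g s : G) :
  (\esum_(p in [set: (nat * Gam) * G])
     ((vec p.1 p.2 g - vec p.1 (s^-1 * p.2)%g (s^-1 * g)%g) ^+ 2)%:E <=
   (2 - corr 1 s - corr s 1)%:E)%E.
Proof.
have := vec_sum_const [:: true; false] (fun i => if i then 1 else -1) (fun i => if i then 1%g else s) g.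
rewrite !(big_cons, big_nil) /= !addr0 !mulrN1 !mul1r !mulN1r opprK !corr1 => e1.
apply: (@le_trans _ _ (\esum_(p in [set: (nat * Gam) * G])
   ((\sum_(i <- [:: true; false]) (if i then 1 else -1) *
      vec p.1 ((if i then 1 else s)^-1 * p.2)%g ((if i then 1 else s)^-1 * g)%g) ^+ 2)%:E)%E).
  apply: le_esum => p _; rewrite !(big_cons, big_nil) /= invg1 !mul1g mul1r mulN1r addr0.
  by rewrite lexx.
rewrite e1 lee_fin; set Z := mass^-1 * _.
have Z0 : 0 <= Z.
  rewrite mulr_ge0 ?invr_ge0 ?(ltW mass_gt0)//.
  by apply: Rintegral_ge0 => x _; exact: sqr_ge0.
by move: Z Z0 => Z Z0; lra.
Qed.

(** Replacing g by g s multiplies the free group argument on the left by the quotient of the shifts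
    at g s and g. Its defect eta is averaged over the domain, and the average does not depend on
    g. *)
Lemma vec_right (eta : Gam -> R) (M : R) (g s : G) : (forall u, 0 <= eta u <= M) ->
  (forall u x, (\esum_(q in [set: Gam * Gam])
     ((ed x q - ed (u * x)%g (u * q.1, q.2)%g) ^+ 2)%:E <= (eta u)%:E)%E) ->
  (\esum_(p in [set: (nat * Gam) * G]) ((vec p.1 p.2 g - vec p.1 p.2 (g * s)%g) ^+ 2)%:E <=
   (mass^-1 * \int[nu]_(x in X0) eta ((shifted s x)^-1 * shifted 1 x)%g)%:E)%E.
Proof.
move=> etaM h.
have := vec_sum [:: true; false] (fun i => if i then 1 else -1) (fun i => 1%g)
  (fun i => if i then g else (g * s)%g).
have -> : (\esum_(p in [set: (nat * Gam) * G])
    ((\sum_(i <- [:: true; false]) (if i then 1 else -1) * vec p.1 (1^-1 * p.2)%g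
       (1^-1 * (if i then g else g * s))%g) ^+ 2)%:E =
    \esum_(p in [set: (nat * Gam) * G]) ((vec p.1 p.2 g - vec p.1 p.2 (g * s)%g) ^+ 2)%:E)%E.
  apply: eq_esum => p _; rewrite !(big_cons, big_nil) /= invg1 !mul1g mul1r mulN1r addr0 //.
move=> ->; rewrite EFinM.
have de x y : discrete_fun (fun t => (shifted x t, shifted y t)).
  by apply: discrete_fun_pair cC _ _; exact: shifted_discrete.
have eta_bm x y : bounded_measurable (fun t => eta ((shifted x t)^-1 * shifted y t)%g).
  apply: (bm_discrete (h := fun t => eta (t.1^-1 * t.2)%g) (M := M) (de x y)) => t.
  by have /andP[e0 e1] := etaM (t.1^-1 * t.2)%g; rewrite ger0_norm.
apply: lee_pmul => //.
- by rewrite lee_fin invr_ge0 ltW// mass_gt0.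
- by apply: integral_ge0 => x _; apply: esum_ge0 => q _; rewrite lee_fin sqr_ge0.
have [kC kCI] := countable_code cC.
pose E t := (eta ((shifted s t)^-1 * shifted 1 t)%g)%:E.
have mE : measurable_fun setT E by apply/measurable_EFinP; case: (eta_bm s 1%g).
have E0 t : (0 <= E t)%E by have /andP[] := etaM ((shifted s t)^-1 * shifted 1 t)%g.
have E_g t : E (act (g^-1, 1)%g t) = (eta ((shifted (g * s) t)^-1 * shifted g t)%g)%:E.
  by rewrite /E !shifted_act invgK mulg1.
rewrite -bm_RintegralE//.
(* The change of variable by g^-1 replaces the domain of c by that of [shifted g], another domain
   for Gam; since the moved integrand is Gam-invariant, [change_domain] leads back to [X0]. *)
have -> : (\int[nu]_(t in X0) E t = \int[nu]_(t in X0) E (act (g^-1, 1)%g t))%E.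
  rewrite (change_variable (subaction_l mp) g^-1%g mX mE E0).
  rewrite (_ : _ @^-1` X0 = domain S0 (shifted g)); last first.
    apply/seteqP; split=> t [s0 ct]; split=> //; last exact: inv.
    have := @inv (g, 1)%g _ s0; rewrite -actM.
    rewrite (_ : ((g, 1%g) * (g^-1, 1))%g = 1%g :> G * Gam)%g; last first.
      by congr pair; rewrite /= ?mulgV ?mulg1.
    by case: mp => -> _ _ _.
  apply: (change_domain kCI (subaction_r mp) mS0 (fun a => @inv (1, a)%g)) => //.
  - exact: shifted_discrete.
  - exact: shifted_equivariant.
  - apply/measurable_EFinP; rewrite (_ : (fun x => _) = (fun t => eta ((shifted (g * s) t)^-1 * shifted g t)%g)).
      by case: (eta_bm (g * s)%g g).
    by apply/funext => t; have [] := E_g t.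
  - move=> a t s0; rewrite !E_g !shifted_equivariant//.
    by rewrite invgM -mulgA mulKg.
have cC2 : countable [set: (Gam * Gam)%type] by rewrite -setXTT; exact: countableX.
have [k2 k2I] := countable_code cC2.
apply: ge0_le_integral => //.
- by move=> t _; apply: esum_ge0 => q _; rewrite lee_fin sqr_ge0.
- apply: (measurable_esum k2I) => [q|q t]; last by rewrite lee_fin sqr_ge0.
  apply: measurable_funTS; apply/measurable_EFinP/measurable_funX/measurable_sum => i.
  apply: measurable_funM; first exact: measurable_cst.
  exact: (discrete_measurable (fun t => ed (t.1^-1 * t.2)%g (t.1^-1 * q.1, q.2)%g) (de _ _)).
- apply: measurable_funTS; apply/measurable_EFinP.
  rewrite (_ : (fun x => _) = (fun t => eta ((shifted (g * s) t)^-1 * shifted g t)%g)).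
    by case: (eta_bm (g * s)%g g).
  by apply/funext => t; have [] := E_g t.
(* The defect is taken at x, the quotient of the shifts at g and 1, and u, that at g s and g: then u
   x is the quotient at g s and 1, and the reindexing by [shifted g t] aligns the edges. *)
move=> t _; rewrite E_g; apply: le_trans (h _ ((shifted g t)^-1 * shifted 1 t)%g).
rewrite (@reindex_esum R (Gam * Gam)%type _ setT setT (fun q => (shifted g t * q.1, q.2)%g)); last first.
  split=> // [[u v] [u' v'] _ _ /= [/mulgI -> ->]//|[u v] _].
  by exists ((shifted g t)^-1 * u, v)%g => //=; rewrite mulVKg.
apply: le_esum => -[u v] _; rewrite !(big_cons, big_nil) /= mul1r mulN1r addr0.
by rewrite -!mulgA mulKg mulVKg.
Qed.

End Vectors.

End Fields.

(** * Decay of the norm defect at infinity *)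

Section Vanishing.
Variables (R : realType) (d : measure_display) (S : measurableType d).
Variable nu : {measure set S -> \bar R}.

Lemma measure_tail (T : choiceType) (w : S -> T) (A : set S) (t : R) : countable [set: T] ->
  discrete_fun w -> measurable A -> (nu A < +oo)%E -> 0 < t ->
  exists B : {fset T}, (nu (A `&` w @^-1` [set x | x \notin B]) <= t%:E)%E.
Proof.
move=> cT dw mA Aoo t0; have [k kI] := countable_code cT.
pose E n := A `&` w @^-1` [set x | (n <= k x)%N].
have mE n : measurable (E n) by apply: measurableI => //; exact: dw.
have E0 : \bigcap_n E n = set0.
  by apply/seteqP; split=> // s h; have [_ /=] := h (k (w s)).+1 I; rewrite ltnn.
have Eoo n : (nu (E n) < +oo)%E.
  by apply: le_lt_trans Aoo; apply: le_measure; rewrite ?inE//; exact: subIsetl.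
have Em : {homo E : n m / (n <= m)%N >-> (m <= n)%O}.
  by move=> n m nm; apply/subsetPset => s [As /= h]; split=> //=; exact: leq_trans h.
have mcap : measurable (\bigcap_n E n) by rewrite E0; exact: measurable0.
have /fine_cvgP[_ /cvgr0Pnorm_le h] : (nu \o E) n @[n --> \oo] --> 0%:E.
  by have := nonincreasing_cvg_mu (Eoo 0%N) mE mcap Em; rewrite E0 measure0.
have [N _ /(_ N (leqnn N)) /= hN] := h t t0.
have fN : finite_set [set x | (k x < N)%N].
  by apply: (@finite_preimage _ _ `I_N k) => [x y _ _|]; [exact: kI | exact: finite_II].
exists (fset_set [set x | (k x < N)%N]).
apply: (@le_trans _ _ (nu (E N))).
  apply: le_measure; rewrite ?inE//; first by apply: measurableI => //; exact: dw.
  move=> s [As /=]; rewrite in_fset_set// => /negP h'; split=> //=.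
  by rewrite leqNgt; apply/negP => kN; apply: h'; exact: mem_set.
have Nf : nu (E N) \is a fin_num by rewrite ge0_fin_numE.
by rewrite -(fineK Nf) lee_fin (le_trans (ler_norm _)).
Qed.

(** Up to measure t, w takes values in finite sets B on A and B' on A'. If s and g^-1 s are in these
    good parts, equivariance gives g = x y^-1 with x in B and y in B', so g is in a finite set. *)
Lemma vanishing_overlap (G : groupType) (act : G -> S -> S) (S0 : set S) (w : S -> G) A A' (t : R) :
  countable [set: G] -> measure_preserving_action nu act -> discrete_fun w ->
  equivariant act S0 w -> A `<=` S0 -> measurable A -> measurable A' ->
  (nu A < +oo)%E -> (nu A' < +oo)%E -> 0 < t ->
  exists F : {fset G}, forall g, g \notin F -> (nu (A `&` act g^-1%g @^-1` A') <= t%:E)%E.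
Proof.
move=> cG mp dw we AS mA mA' Aoo Aoo' t0; have t2 : 0 < t / 2 by rewrite divr_gt0.
have [B hB] := measure_tail cG dw mA Aoo t2.
have [B' hB'] := measure_tail cG dw mA' Aoo' t2.
exists [fset (x * y^-1)%g | x in B, y in B']%fset => g gF.
have [_ _ ma pr] := mp.
have m1 : measurable (A `&` w @^-1` [set x | x \notin B]) by apply: measurableI => //; exact: dw.
have m2 : measurable (A' `&` w @^-1` [set x | x \notin B']) by apply: measurableI => //; exact: dw.
have mact B0 : measurable B0 -> measurable (act g^-1%g @^-1` B0) by exact: (act_preimage_measurable mp).
rewrite (_ : t = t / 2 + t / 2); last by field.
apply: (@le_trans _ _ (nu ((A `&` w @^-1` [set x | x \notin B]) `|`
    act g^-1%g @^-1` (A' `&` w @^-1` [set x | x \notin B'])))).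
  apply: le_measure; rewrite ?inE.
  - by apply: measurableI => //; exact: mact.
  - by apply: measurableU => //; exact: mact.
  move=> s [As A's]; have [wB|wB] := boolP (w s \in B); last by left.
  right; split=> //=; apply/negP => wB'; move/negP: gF; apply.
  apply/imfset2P; exists (w s) => //; exists (w (act g^-1%g s)) => //.
  by rewrite we; [rewrite invgM invgK mulVKg | exact: AS].
apply: (le_trans (measureU2 nu m1 (mact _ m2))); rewrite EFinD; apply: leeD => //.
by apply: le_trans hB'; rewrite le_eqVlt; apply/orP; left; apply/eqP; exact: pr.
Qed.

Lemma bounded_limit (T : Type) (A : set S) (v : S -> T) (h : nat -> T -> R) (M : R) :
  measurable A -> (nu A < +oo)%E -> discrete_fun v -> (forall n x, 0 <= h n x <= M) ->
  (forall x t, 0 < t -> exists n0, forall n, (n0 <= n)%N -> h n x <= t) ->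
  forall t, 0 < t -> exists n0, forall n, (n0 <= n)%N -> \int[nu]_(s in A) h n (v s) <= t.
Proof.
move=> mA Aoo dv hM hx t t0.
have bh n : bounded_measurable (fun s => h n (v s)).
  by apply: (bm_discrete (M := M) dv) => x; have /andP[h0 h1] := hM n x; rewrite ger0_norm.
have M0 : bounded_measurable (fun _ : S => M) by exact: bm_cst.
have [|||||] := @dominated_convergence _ _ _ nu A mA (fun n s => (h n (v s))%:E) (cst 0%E) (cst M%:E).
- by move=> n; apply/measurable_EFinP/measurable_funTS; case: (bh n).
- exact: measurable_cst.
- apply: aeW => s _; apply/fine_cvgP; split; first exact: nearW.
  apply/cvgr0Pnorm_le => r r0; have [n0 hn] := hx (v s) r r0; exists n0 => // n /= /hn.
  by have /andP[h0 _] := hM n (v s); rewrite ger0_norm.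
- exact: (bm_integrable mA Aoo M0).
- apply: aeW => s n _; rewrite /= lee_fin.
  by have /andP[h0 h1] := hM n (v s); rewrite ger0_norm.
move=> _ _; rewrite integral0 => /fine_cvgP[_ /cvgr0Pnorm_le h0].
have [N _ hN] := h0 t t0; exists N => n /hN /=.
by rewrite bm_RintegralE//=; exact: le_trans (ler_norm _).
Qed.

End Vanishing.

Section Overlap.
Variables (R : realType) (G Gam : groupType).
Variables (cG : countable [set: G]) (cC : countable [set: Gam]).
Variables (d : measure_display) (S : measurableType d) (nu : {measure set S -> \bar R}).
Variables (act : (G * Gam)%type -> S -> S) (S0 : set S) (w : S -> G) (c : S -> Gam).
Hypothesis cpl : exact_coupling nu act S0 w c.

(** Every fiber of c is a translate of its domain, which has finite measure. *)
Lemma fiber_measure (s : seq Gam) : (nu (S0 `&` c @^-1` [set` s]) < +oo)%E.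
Proof.
have [mS0 mp inv _ [dc ce Xoo _]] := cpl.
elim: s => [|x s IH].
  by rewrite (_ : _ `&` _ = set0) ?measure0//; apply/seteqP; split=> // t [].
have mx : measurable (S0 `&` c @^-1` [set x]) by apply: measurableI => //; exact: dc.
have ms (r : seq Gam) : measurable (S0 `&` c @^-1` [set` r]) by apply: measurableI => //; exact: dc.
have fx : (nu (S0 `&` c @^-1` [set x]) < +oo)%E.
  have [_ _ _ pr] := mp; rewrite -(pr (1, x)%g) // (_ : _ @^-1` _ = domain S0 c)//.
  apply/seteqP; split=> t /=.
    move=> [/(act_inv (subaction_r mp) (fun a => inv (1, a)%g)) t0].
    by rewrite ce// -[RHS]mulg1 => /mulgI.
  by move=> [t0 /= ct]; split; [exact: inv | rewrite ce// ct mulg1].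
apply: (@le_lt_trans _ _ (nu (S0 `&` c @^-1` [set x]) + nu (S0 `&` c @^-1` [set` s]))%E).
  apply: (le_trans _ (measureU2 nu mx (ms s))); apply: le_measure; rewrite ?inE//.
    exact: measurableU.
  by move=> t [t0 /=]; rewrite inE => /predU1P[ct|ct]; [left|right].
by rewrite lte_add_pinfty.
Qed.

(** On the domain of c the shift at 1 is 1, so the phase is evaluated at the inverse of c(g^-1 s).
    It exceeds t/2 only if g^-1 s is in finitely many fibers of c, a set of finite measure whose
    overlap with the domain vanishes at infinity. *)
Lemma overlap_c0 (ph : Gam -> R) : (forall x, 0 <= ph x <= 1) ->
  (forall t, 0 < t -> exists A : {fset Gam}, forall x, x \notin A -> ph x <= t) ->
  forall t, 0 < t -> exists F : {fset G}, forall g, g \notin F -> overlap nu act S0 c ph 1%g g <= t.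
Proof.
move=> ph01 phc t t0; have [mS0 mp inv [dw we Yoo] [dc ce Xoo _]] := cpl.
have m0 := mass_gt0 cpl; set m := mass nu S0 c in m0.
have t2 : 0 < t / 2 by rewrite divr_gt0.
have [A hA] := phc _ t2.
have mX : measurable (domain S0 c) by exact: measurable_domain.
pose A' := S0 `&` c @^-1` [set` [seq x^-1%g | x <- A]].
have mA' : measurable A' by apply: measurableI => //; exact: dc.
have tm : 0 < t / 2 * m by rewrite mulr_gt0.
have [F hF] := vanishing_overlap cG (subaction_l mp) dw we (@subIsetl _ _ _) mX mA' Xoo
  (fiber_measure _) tm.
exists F => g /hF {}hF; rewrite /overlap -/m ler_pdivrMl// mulrC.
pose bad := domain S0 c `&` act (g^-1, 1)%g @^-1` A'.
have mbad : measurable bad.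
  by apply: measurableI => //; exact: (act_preimage_measurable mp).
have b1 : bounded_measurable (fun s => ph ((shifted act c g s)^-1 * shifted act c 1 s)%g).
  have h := discrete_fun_pair cC (shifted_discrete cpl 1%g) (shifted_discrete cpl g).
  apply: (bm_discrete (h := fun t => ph (t.2^-1 * t.1)%g) (M := 1) h) => u.
  by have /andP[p0 p1] := ph01 (u.2^-1 * u.1)%g; rewrite ger0_norm.
have b2 : bounded_measurable (fun s => ph ((shifted act c g s)^-1 * shifted act c 1 s)%g ^+ 2).
  exact: (bmM b1 b1).
rewrite -lee_fin -bm_RintegralE//.
apply: (@le_trans _ _ (\int[nu]_(s in domain S0 c) ((t / 2)%:E + (\1_bad s)%:E))%E).
  apply: ge0_le_integral => //.
  - by move=> s _; rewrite lee_fin sqr_ge0.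
  - by apply: measurable_funTS; apply/measurable_EFinP; case: b2.
  - apply: emeasurable_funD; first exact: measurable_cst.
    by apply/measurable_EFinP; exact: measurable_indic.
  move=> s Xs; have [s0 cs] := Xs.
  have c1 : shifted act c 1 s = 1%g.
    rewrite /shifted (_ : (1^-1, 1)%g = 1%g :> G * Gam); last by rewrite invg1.
    by have [a1 _ _ _] := mp; rewrite a1.
  rewrite -EFinD lee_fin c1 mulg1; set x := (_^-1)%g.
  have /andP[p0 p1] := ph01 x.
  have p2 : ph x ^+ 2 <= ph x by rewrite expr2 ler_piMl.
  have [xA|/hA px] := boolP (x \in A); last first.
    by apply: (le_trans p2); apply: (le_trans px); rewrite lerDl.
  have -> : \1_bad s = 1 :> R.
    rewrite indicE mem_set//; split=> //; split; first exact: inv.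
    by apply/mapP; exists x => //; rewrite /x invgK.
  by apply: (le_trans p2); apply: (le_trans p1); rewrite lerDr ltW.
rewrite (ge0_integralD nu mX); last 4 first.
- by move=> s _; rewrite lee_fin ltW.
- exact: measurable_cst.
- by move=> s _; rewrite lee_fin.
- by apply/measurable_EFinP; exact: measurable_indic.
rewrite integral_cst// integral_indic// (massE cpl) -/m.
rewrite (_ : t * m = t / 2 * m + t / 2 * m); last by field.
rewrite EFinD -EFinM; apply: leeD => //; apply: le_trans hF.
by apply: le_measure; [rewrite inE; exact: measurableI | rewrite inE | exact: subIsetl].
Qed.

End Overlap.

Lemma eventually_all (T : eqType) (r : seq T) (P : T -> nat -> Prop) :
  (forall x, exists n0, forall n, (n0 <= n)%N -> P x n) ->
  exists n0, forall n, (n0 <= n)%N -> forall x, x \in r -> P x n.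
Proof.
move=> h; elim: r => [|x r [n1 h1]]; first by exists 0%N.
have [n2 h2] := h x; exists (maxn n1 n2) => n; rewrite geq_max => /andP[nn1 nn2] y.
by rewrite inE => /predU1P[->|yr]; [exact: h2 | exact: h1].
Qed.

(** * The array attached to a coupling with a free group *)

Section CouplingArray.
Variables (R : realType) (G Gam : groupType).
Variables (cG : countable [set: G]) (cC : countable [set: Gam]).
Variables (d : measure_display) (S : measurableType d) (nu : {measure set S -> \bar R}).
Variables (act : (G * Gam)%type -> S -> S) (S0 : set S) (w : S -> G) (c : S -> Gam).
Hypothesis cpl : exact_coupling nu act S0 w c.
Variables (B : set Gam) (hB : free_basis B) (code : Gam -> nat) (code_inj : injective code).

Local Notation ph := (@phase R Gam B hB code).
Local Notation ed := (@edgew R Gam B hB code).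
Local Notation X0 := (domain S0 c).

Definition defect n (g x : Gam) : \bar R := (\esum_(p in [set: Gam * Gam])
    ((ed n x p - ed n (g * x)%g (g * p.1, p.2)%g) ^+ 2)%:E)%E.

(** The supremum over x is taken because [vec_right] asks for a bound depending only on the
    translating element. *)
Definition max_defect n g : R := fine (ereal_sup [set defect n g x | x in [set: Gam]]).

Lemma max_defect_sup n g : [/\ (ereal_sup [set defect n g x | x in [set: Gam]] <= 4%:E)%E,
  (0 <= ereal_sup [set defect n g x | x in [set: Gam]])%E &
  ereal_sup [set defect n g x | x in [set: Gam]] = (max_defect n g)%:E].
Proof.
have s4 : (ereal_sup [set defect n g x | x in [set: Gam]] <= 4%:E)%E.
  by apply: ge_ereal_sup => _ [x _ <-]; exact: edgew_shift_le4.
have s0 : (0 <= ereal_sup [set defect n g x | x in [set: Gam]])%E.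
  apply: (@le_trans _ _ (defect n g 1%g)); last by apply: ereal_sup_ubound; exists 1%g.
  by apply: esum_ge0 => p _; rewrite lee_fin sqr_ge0.
split=> //; rewrite fineK// ge0_fin_numE//; apply: (le_lt_trans s4); exact: ltry.
Qed.

Lemma max_defect_bound n g : 0 <= max_defect n g <= 4.
Proof. by have [s4 s0 e] := max_defect_sup n g; rewrite -!lee_fin -e s0. Qed.

Lemma defect_le n g x : (defect n g x <= (max_defect n g)%:E)%E.
Proof.
by have [_ _ <-] := max_defect_sup n g; apply: ereal_sup_ubound; exists x.
Qed.

Lemma max_defect_cvg g t : 0 < t -> exists n0, forall n, (n0 <= n)%N -> max_defect n g <= t.
Proof.
move=> t0; have [n0 h] := @edgew_shift_cvg R Gam B hB code g t t0; exists n0 => n /h {}h.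
have [_ _ e] := max_defect_sup n g; rewrite -lee_fin -e.
by apply: ge_ereal_sup => _ [x _ <-]; exact: h.
Qed.

Let mX : measurable X0.
Proof. by have [mS0 _ _ _ [dc _ _ _]] := cpl; exact: measurable_domain. Qed.

Let Xoo : (nu X0 < +oo)%E. Proof. by case: cpl => _ _ _ _ []. Qed.

Let m0 : 0 < mass nu S0 c. Proof. exact: mass_gt0 cpl. Qed.

Let dsh a b : discrete_fun (fun s => ((shifted act c b s)^-1 * shifted act c a s)%g).
Proof.
have h := discrete_fun_pair cC (shifted_discrete cpl a) (shifted_discrete cpl b).
exact: (discrete_fun_comp (fun t => (t.2^-1 * t.1)%g) h).
Qed.

Lemma corr_cvg a b t : 0 < t ->
  exists n0, forall n, (n0 <= n)%N -> 1 - corr nu act S0 c (ph n) a b <= t.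
Proof.
move=> t0; have tm : 0 < t * mass nu S0 c by rewrite mulr_gt0.
have h1 n x : 0 <= 1 - ph n x <= 1 by rewrite subr_ge0 phase_le1 lerBlDr lerDl phase_ge0.
have [n0 h] := @bounded_limit R d S nu _ X0 _ (fun n x => 1 - ph n x) 1 mX Xoo (dsh a b) h1
  (fun x t => @phase_cvg R Gam B hB code x t) _ tm.
exists n0 => n /h {}h.
rewrite -(@corr1 R G Gam d S nu act S0 w c cpl (ph n) (phase1 R hB code n) a) /corr -mulrBr.
rewrite ler_pdivrMl// mulrC; apply: le_trans h.
rewrite -RintegralB//; last 2 first.
- apply: (bm_integrable mX Xoo); apply: (ph_bm cC cpl) => x; [exact: phase_ge0|exact: phase_le1].
- apply: (bm_integrable mX Xoo); apply: (ph_bm cC cpl) => x; [exact: phase_ge0|exact: phase_le1].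
rewrite le_eqVlt; apply/orP; left; apply/eqP.
by apply: eq_Rintegral => s _; rewrite mulVg phase1.
Qed.

Lemma coupling_array : equivariant_array R G (nat * Gam)%type.
Proof.
move=> F e e0; have e2 : 0 < e ^+ 2 by rewrite exprn_gt0.
have e22 : 0 < e ^+ 2 / 2 by rewrite divr_gt0.
have em : 0 < e ^+ 2 * mass nu S0 c by rewrite mulr_gt0.
pose corr' n := corr nu act S0 c (ph n).
pose disp n s := \int[nu]_(x in X0) max_defect n ((shifted act c s x)^-1 * shifted act c 1 x)%g.
(* One index n serves the whole finite set. The two correlations share e^2 in [vec_left], hence the
   halves; [disp] is not normalized, hence the factor of the mass. *)
have [n0 hn] : exists n0, forall n, (n0 <= n)%N -> forall s, s \in F ->
    [/\ 1 - corr' n 1%g s <= e ^+ 2 / 2, 1 - corr' n s 1%g <= e ^+ 2 / 2 &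
        disp n s <= e ^+ 2 * mass nu S0 c].
  apply: eventually_all => s.
  have [n1 h1] := corr_cvg 1%g s e22; have [n2 h2] := corr_cvg s 1%g e22.
  have [n3 h3] := bounded_limit mX Xoo (dsh 1%g s) max_defect_bound max_defect_cvg em.
  exists (maxn n1 (maxn n2 n3)) => n; rewrite !geq_max => /and3P[l1 l2 l3].
  by split; [exact: h1 | exact: h2 | exact: h3].
have {hn}hF s sF := hn n0 (leqnn n0) s sF; move: n0 hF => n hF.
have gr := @edgew_gram R Gam B hB code n.
have p0 := @phase_ge0 R Gam B hB code n; have p1 := @phase_le1 R Gam B hB code n.
have pe := @phase1 R Gam B hB code n.
have [v hv] := field_vectors cG cC cpl gr pe.
exists (vec nu S0 c v), (corr' n), (overlap nu act S0 c (ph n) 1%g); split.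
- by move=> g r z; exact: (vec_gram cC cpl gr p0 p1 hv).
- by move=> s; exact: (corr1 cpl pe).
- split.
  + move=> g; apply: le_trans (corr_le1 cC cpl p0 p1 pe 1%g g).
    exact: (overlap_le_corr cC cpl p0 p1 1%g g).
  + by move=> g; rewrite (vec_norm cC cpl gr p0 p1 pe hv).
  + move=> t t0; apply: (overlap_c0 cG cC cpl) => // [x|r r0]; first by rewrite p0 p1.
    exact: (@phase_c0 R Gam B hB code code_inj n r r0).
- move=> s /hF[h1 h2 _] g; apply: (le_trans (vec_left cC cpl gr p0 p1 pe hv g s)).
  rewrite lee_fin -/(corr' n 1%g s) -/(corr' n s 1%g); move: (corr' n 1%g s) (corr' n s 1%g) h1 h2 => x y h1 h2.
  by lra.
- move=> s /hF[_ _ h3] g.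
  apply: (le_trans (vec_right cC cpl hv g s (max_defect_bound n) (defect_le n))).
  by rewrite lee_fin ler_pdivrMl// mulrC.
Qed.

End CouplingArray.

Theorem corollary1p3 (R : realType) (G Gam : groupType)
    (countable_G : countable [set: G])
    (countable_Gam : countable [set: Gam])
    (free_Gam : free_group Gam)
    (ME_G_Gam : measure_equivalent R G Gam) :
  solid (group_vna R G).
Proof.
have [B hB] := free_Gam; have [code codeI] := countable_code countable_Gam.
have [d [S [nu [act [S0 [w [c cpl]]]]]]] := exact_coupling_exists countable_G countable_Gam ME_G_Gam.
exact: (array_solid countable_G (coupling_array countable_G countable_Gam cpl hB codeI)).
Qed.
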